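(* Let $N\geq 1$, $0<s<1$ and $p\geq 2$. For all $u\in \dot{W}^s_p(\mathbb{R}^N)$ in case $p < N/s$, and for all $u\in \dot{W}^s_p(\mathbb{R}^N\setminus\{0\})$ in case $p > N/s$, with $v(x)=|x|^{(N-ps)/p} u(x)$, \[ \iint_{\mathbb{R}^N\times\mathbb{R}^N} \frac{|u(x)-u(y)|^p}{|x-y|^{N+ps} } \,dx\,dy - \mathcal C_{N,s,p} \int_{\mathbb{R}^N} \frac{|u(x)|^p}{|x|^{ps}}\,dx \geq c_p\, \iint_{\mathbb{R}^N\times\mathbb{R}^N} \frac{|v(x)-v(y)|^p}{|x-y|^{N+ps} } \frac{dx}{|x|^{(N-ps)/2}} \frac{dy}{|y|^{(N-ps)/2}}, \] where $\mathcal C_{N,s,p} := 2 \int_0^1 r^{ps-1} |1 - r^{(N-ps)/p} |^p \Phi_{N,s,p}(r) \, dr$ and \[ c_p:=\min_{0<\tau<1/2} \left((1-\tau)^p -\tau^p + p\tau^{p-1}\right) \] satisfies $0<c_p\leq 1$. If $p=2$, the inequality is an equality with $c_2=1$.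
   Context: $\Phi_{N,s,p}(r) := |\mathbb{S}^{N-2}| \int_{-1}^1 (1-t^2)^{(N-3)/2} (1-2rt+r^2)^{-(N+ps)/2}\,dt$ for $N\geq 2$ and $\Phi_{1,s,p}(r) := (1-r)^{-1-ps} + (1+r)^{-1-ps}$ for $N=1$, where $|\mathbb{S}^{N-2}|$ is the surface area of the unit sphere in $\mathbb{R}^{N-1}$. $\dot{W}^s_p(\mathbb{R}^N)$ (for $p<N/s$) is the completion of $C_0^\infty(\mathbb{R}^N)$, and $\dot{W}^s_p(\mathbb{R}^N\setminus\{0\})$ (for $p>N/s$) the completion of $C_0^\infty(\mathbb{R}^N\setminus\{0\})$, with respect to $\left(\iint |u(x)-u(y)|^p|x-y|^{-N-ps}\,dx\,dy\right)^{1/p}$; elements are identified with functions. *)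

(* Defs.v *)
From HB Require Import structures.
From mathcomp Require Import all_boot all_order all_algebra.
From mathcomp Require Import all_classical all_reals all_analysis.
Set Implicit Arguments. Unset Strict Implicit. Unset Printing Implicit Defensive.
Import Order.TTheory GRing.Theory Num.Theory.
Import numFieldNormedType.Exports.
Local Open Scope classical_set_scope.
Local Open Scope ring_scope.

Definition enorm (R : realType) (N : nat) (x : 'rV[R]_N) : R :=
  Num.sqrt (\sum_(i < N) x ord0 i ^+ 2).

Definition tup2row (R : realType) (N : nat) (t : N.-tuple R) : 'rV[R]_N :=
  \row_(i < N) tnth t i.

(* iterated one-dimensional Lebesgue integrals over R^n (for the nonnegative
   Borel-measurable integrands below this is the Lebesgue integral on R^n,
   by Tonelli) *)
Fixpoint iint (R : realType) (n : nat) : (n.-tuple R -> \bar R) -> \bar R :=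
  match n with
  | 0 => fun f => f [tuple]
  | n'.+1 => fun f =>
      (\int[@lebesgue_measure R]_x iint (fun t : n'.-tuple R => f (cons_tuple x t)))%E
  end.

Definition intN (R : realType) (N : nat) (f : 'rV[R]_N -> \bar R) : \bar R :=
  iint (fun t : N.-tuple R => f (tup2row t)).

(* Lebesgue measurability of u on R^N (Borel sets of the product) *)
Definition measurableN (R : realType) (N : nat) (u : 'rV[R]_N -> R) : Prop :=
  measurable_fun setT (fun t : N.-tuple R => u (tup2row t)).

Fixpoint iter_dir (R : realType) (N : nat) (vs : seq 'rV[R]_N)
    (f : 'rV[R]_N -> R) : 'rV[R]_N -> R :=
  match vs with
  | [::] => f
  | v :: vs' => fun x => 'D_v (iter_dir vs' f) x
  end.

Definition smooth (R : realType) (N : nat) (f : 'rV[R]_N -> R) : Prop :=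
  forall (vs : seq 'rV[R]_N) (x : 'rV[R]_N), differentiable (iter_dir vs f) x.

Definition fsupport (R : realType) (N : nat) (f : 'rV[R]_N -> R) : set 'rV[R]_N :=
  closure [set x | f x != 0].

Definition Cc_inf (R : realType) (N : nat) (f : 'rV[R]_N -> R) : Prop :=
  smooth f /\ compact (fsupport f).

Definition Cc_inf_punct (R : realType) (N : nat) (f : 'rV[R]_N -> R) : Prop :=
  smooth f /\ compact (fsupport f) /\ ~ fsupport f 0.

Definition gagliardo (R : realType) (N : nat) (s p : R) (u : 'rV[R]_N -> R)
  : \bar R :=
  intN (fun x => intN (fun y =>
    (`|u x - u y| `^ p * enorm (x - y) `^ (- (N%:R + p * s)))%:E)).

Definition ae_N (R : realType) (N : nat) (P : 'rV[R]_N -> Prop) : Prop :=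
  intN (fun x => (\1_(~` [set y | P y]) x)%:E) = 0%E.

(* element of the completion of a class of test functions w.r.t. the
   Gagliardo seminorm, identified with a function *)
Definition in_completion (R : realType) (N : nat) (s p : R)
    (test : ('rV[R]_N -> R) -> Prop) (u : 'rV[R]_N -> R) : Prop :=
  measurableN u /\
  exists phi : nat -> ('rV[R]_N -> R),
    (forall k, test (phi k)) /\
    (fun k => gagliardo s p (u \- phi k)) @ \oo --> 0%E /\
    ae_N (fun x => (fun k => phi k x) @ \oo --> u x).

Definition Wdot (R : realType) (N : nat) (s p : R) (u : 'rV[R]_N -> R) : Prop :=
  in_completion s p (@Cc_inf R N) u.

Definition Wdot_punct (R : realType) (N : nat) (s p : R) (u : 'rV[R]_N -> R)
  : Prop := in_completion s p (@Cc_inf_punct R N) u.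

(* |S^d| : surface area of the unit sphere S^d in R^(d+1) *)
Fixpoint sphere_area (R : realType) (d : nat) : R :=
  match d with
  | 0 => 2
  | 1 => 2 * pi
  | (d'.+1 as d1).+1 => 2 * pi / d1%:R * sphere_area R d'
  end.

Definition Phi (R : realType) (N : nat) (s p r : R) : \bar R :=
  if N == 1%N then
    ((1 - r) `^ (-1 - p * s) + (1 + r) `^ (-1 - p * s))%:E
  else
    ((sphere_area R (N - 2))%:E *
     \int[@lebesgue_measure R]_(t in `[(-1)%R, 1%R]%classic)
        ((1 - t ^+ 2) `^ ((N%:R - 3) / 2) *
         (1 - 2 * r * t + r ^+ 2) `^ (- (N%:R + p * s) / 2))%:E)%E.

Definition CNsp (R : realType) (N : nat) (s p : R) : \bar R :=
  (2%:E * \int[@lebesgue_measure R]_(r in `[0%R, 1%R]%classic)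
     ((r `^ (p * s - 1) * `|1 - r `^ ((N%:R - p * s) / p)| `^ p)%:E
      * Phi N s p r))%E.

Definition gtau (R : realType) (p tau : R) : R :=
  (1 - tau) `^ p - tau `^ p + p * tau `^ (p - 1).

(* c_p = inf (= min, attained, see the theorem) over 0 < tau < 1/2 *)
Definition c_p (R : realType) (p : R) : R :=
  inf [set gtau p tau | tau in `]0, 1/2[%classic].

(* Main.v *)
(** Write [w x = |x|^(-(N-ps)/p)] and [u = w v]. A pointwise convexity inequality with
    optimal constant [c_p] bounds [|u x - u y|^p] from below by [c_p (w x w y)^(p/2) |v x - v y|^p]
    plus weighted multiples of [|u x|^p] and [|u y|^p]. First integrate it over the pairs with
    [delta <= |y|/|x| <= 1 - delta] only: there the two weighted terms are finite multiples of
    the Hardy integral, by polar coordinates and the homogeneity of the kernel, and their difference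
    is the part of [C_{N,s,p}] coming from the radii in [[delta, 1 - delta]]. Monotone
    convergence removes the cutoff and symmetry accounts for the pairs with [|y| > |x|]. The same
    inequality with a fixed cutoff, applied to differences of test functions, shows with Fatou's
    lemma that the Hardy integral is finite on the whole completion, so that it can be subtracted. *)
Require Import Defs.
From HB Require Import structures.
From mathcomp Require Import all_boot all_order all_algebra.
From mathcomp Require Import all_classical all_reals all_analysis measurable_realfun.
From mathcomp Require Import ring lra.
Import Order.TTheory GRing.Theory Num.Theory.
Import numFieldNormedType.Exports.
Local Open Scope classical_set_scope.
Local Open Scope ring_scope.
Set Implicit Arguments.
Unset Strict Implicit.
Unset Printing Implicit Defensive.

(** The cutoff answers a divergence at [r = 1]. With [h = (N - ps)/p], both radial weights vanish
    there only like [(1 - r)^(p - 1)], against a kernel of size [(1 - r)^(-1 - ps)], so for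
    [s >= 1 - 1/p] each radial integral is infinite and the two cannot be subtracted. Their
    difference carries [|1 - r^h|^p], which gains one more power of [1 - r] and converges because
    [s < 1]. The sign of [h], which separates the two cases of the theorem, decides which weight is
    the larger.

    The constant [c_p] enters through a Jensen gap of [|.|^p] between two points, with weights given
    by the ratio of [w x] and [w y]. A path along which this ratio tends to one bounds the gap from
    below by a value of [gtau]; symmetry and monotonicity settle the remaining configurations.

    Polar coordinates are built on iterated integrals: plane rotations give invariance, and an
    induction raising the dimension by two, with the Gaussian integral as the source of [pi],
    reproduces the recursion of [sphere_area]. *)

Section power_functions.
Context {R : realType}.
Implicit Types (p q r x y t : R).

(** * Real powers of absolute values: derivatives and convexity *)

Lemma continuous_normpow p : 0 < p -> continuous (fun x : R => `|x| `^ p).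
Proof.
move=> p0 x; have [->|x0] := eqVneq x 0; last first.
  have xp : 0 < `|x| by rewrite normr_gt0.
  apply: (@continuous_comp _ _ _ (fun x : R => `|x|) (fun y => y `^ p)).
    exact: norm_continuous.
  have := is_derive1_powR p xp.
  by move=> /@ex_derive /derivable1_diffP /differentiable_continuous.
rewrite /continuous_at normr0 powR0 ?gt_eqF//; apply/cvgrPdist_lt => e e0.
exists (e `^ p^-1) => /=; first by rewrite powR_gt0.
move=> y /=; rewrite sub0r normrN => ye; rewrite sub0r normrN ger0_norm ?powR_ge0//.
have pn0 : p != 0 by rewrite gt_eqF.
rewrite -[ltRHS](@powRr1 _ e) ?ltW// -(mulVf pn0) powRrM.
by rewrite gt0_ltr_powR// nnegrE// powR_ge0.
Qed.

Lemma is_derive_normpow p x : x != 0 ->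
  is_derive x 1 (fun x : R => `|x| `^ p) (p * `|x| `^ (p - 1) * Num.sg x).
Proof.
move=> x0; have [xp|xn] := ltP 0 x.
  rewrite gtr0_norm// gtr0_sg// mulr1.
  apply: (@near_eq_is_derive _ _ _ (fun x : R => x `^ p)).
    by near=> y; rewrite gtr0_norm//; near: y; exact: lt_nbhsr.
  exact: is_derive1_powR.
have {xn}xn : x < 0 by rewrite lt_neqAle x0.
rewrite ltr0_norm// ltr0_sg// mulrN1.
apply: (@near_eq_is_derive _ _ _ (fun x : R => (- x) `^ p)).
  by near=> y; rewrite ltr0_norm//; near: y; exact: lt_nbhsl.
have Nx0 : 0 < - x by rewrite oppr_gt0.
have d1 := is_derive1_powR p Nx0.
have := @is_derive1_comp _ (fun y => y `^ p) (fun y : R => - y) x _ _ d1 _.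
move=> /(_ (-1)) H; rewrite -mulrN1.
exact: H.
Unshelve. all: end_near. Qed.

Lemma is_derive_conv (f : R -> R) x (a b : R) :
  is_derive x 1 f a -> a = b -> is_derive x 1 f b.
Proof. by move=> ? <-. Qed.

Lemma derive_ge0_le (f df : R -> R) (a b : R) : a <= b ->
  (forall x, a < x < b -> is_derive x 1 f (df x)) ->
  {within `[a, b], continuous f} -> (forall x, a < x < b -> 0 <= df x) ->
  f a <= f b.
Proof.
rewrite le_eqVlt => /predU1P[->//|ab] dfx cf df0.
have dd x : x \in `]a, b[%R -> is_derive x 1 f (df x).
  by rewrite in_itv/=; exact: dfx.
have [c cab E] := MVT ab dd cf.
rewrite -subr_ge0 E mulr_ge0 ?subr_ge0 ?(ltW ab)//; apply: df0.
by move: cab; rewrite in_itv.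
Qed.

Lemma powR_le_id x r : 0 <= x <= 1 -> 1 <= r -> x `^ r <= x.
Proof.
move=> /andP[]; rewrite le_eqVlt => /predU1P[<- _ r1|x0 x1 r1].
  by rewrite powR0// gt_eqF// (lt_le_trans _ r1).
by rewrite ge1r_powR// x0.
Qed.

Lemma powR_convex r t x y : 1 <= r -> 0 <= t <= 1 -> 0 <= x -> 0 <= y ->
  (t * x + (1 - t) * y) `^ r <= t * x `^ r + (1 - t) * y `^ r.
Proof.
move=> r1 /andP[t0 t1] x0 y0.
have t01 : (0%:E <= t%:E <= 1%:E)%E by rewrite !lee_fin t0.
pose ti := Itv01 t0 t1.
have := @convex_powR R r r1 ti x y; rewrite !inE/= !in_itv/= !andbT.
by move=> /(_ x0 y0).
Qed.

(** Young's inequality for [y] and [x^(r - 1)], with the conjugate exponents [r] and [r/(r - 1)],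
    multiplied by [r]. The conjugate exponent degenerates at [r = 1], hence the separate case. *)
Lemma powR_tangent r x y : 1 <= r -> 0 <= x -> 0 <= y ->
  x `^ r + r * x `^ (r - 1) * (y - x) <= y `^ r.
Proof.
rewrite le_eqVlt => /predU1P[<- x0 y0|r1 x0 y0].
  by rewrite !powRr1// subrr powRr0 !mul1r subrKC.
have r0 : 0 < r by exact: lt_trans r1.
have r10 : 0 < r - 1 by rewrite subr_gt0.
have := @conjugate_powR _ y (x `^ (r - 1)) r (r / (r - 1)) y0 (powR_ge0 _ _) r0.
rewrite divr_gt0// invf_div => /(_ isT).
have -> : r^-1 + (r - 1) / r = 1 by field; rewrite gt_eqF.
move=> /(_ erefl); rewrite -powRrM (_ : (r - 1) * (r / (r - 1)) = r) => [h|]; last by field; rewrite gt_eqF.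
have := ler_wpM2l (ltW r0) h.
rewrite -subr_ge0 => h2; rewrite -subr_ge0.
rewrite (_ : _ - _ = r * (y `^ r / r + x `^ r * ((r - 1) / r)) - r * (y * x `^ (r - 1)))//.
have -> : x `^ r = x * x `^ (r - 1) by rewrite mulr_powRB1.
by field; rewrite gt_eqF.
Qed.

(** The difference of the two sides vanishes at [x = y], and its derivative in [x] is [p/2] times a
    tangent-line gap for the power [p - 1], which is convex because [p >= 2]. *)
Lemma trapezoid_powR p x y : 2 <= p -> 0 <= y -> y <= x ->
  x `^ p - y `^ p <= p / 2 * (x - y) * (x `^ (p - 1) + y `^ (p - 1)).
Proof.
move=> p2 y0 yx; have p0 : 0 < p by rewrite (lt_le_trans _ p2).
have p10 : 0 < p - 1 by lra.
pose f z := p / 2 * (z - y) * (`|z| `^ (p - 1) + y `^ (p - 1)) - (`|z| `^ p - y `^ p).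
pose df z := p / 2 * (y `^ (p - 1) - z `^ (p - 1) + (p - 1) * z `^ (p - 1 - 1) * (z - y)).
have : f y <= f x.
  apply: (@derive_ge0_le f df _ _ yx).
  - move=> z /andP[yz zx]; have z0 : 0 < z by exact: le_lt_trans yz.
    have zn0 : z != 0 by rewrite gt_eqF.
    have d1 := is_derive_normpow (p - 1) zn0; have d2 := is_derive_normpow p zn0.
    apply: is_derive_eq; rewrite gtr0_sg// gtr0_norm// /GRing.scale/= /df.
    by field.
  - apply: continuous_subspaceT => z; have c1 := continuous_normpow p10.
    have c2 := continuous_normpow p0.
    apply: cvgB; last by apply: cvgB; [exact: c2|exact: cvg_cst].
    apply: cvgM; last by apply: cvgD; [exact: c1|exact: cvg_cst].
    by apply: cvgM; [exact: cvg_cst|apply: cvgB; [exact: cvg_id|exact: cvg_cst]].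
  - move=> z /andP[yz zx]; have z0 : 0 < z by exact: le_lt_trans yz.
    apply: mulr_ge0; first by rewrite divr_ge0// ltW.
    have p11 : 1 <= p - 1 by lra.
    by have := powR_tangent p11 (ltW z0) y0; lra.
rewrite /f subrr mulr0 mul0r !ger0_norm ?(le_trans y0 yx)// subrr subr0.
by rewrite subr_ge0.
Qed.

(* The integrand of the ground state representation along the path
   [1 - c = sqrt t * rho] has a nondecreasing difference quotient, by the
   trapezoid rule; its limit at [z = 1] is the value of [gtau]. *)
Lemma ground_state_path p (rho z0 : R) : 2 <= p -> 0 < rho -> 1 < z0 ->
  rho <= z0^-1 -> rho < 1 ->
  (1 - rho) `^ (p - 1) * (p - (1 - rho)) * (z0 - z0^-1) <=
  z0^-1 * (z0 - rho) `^ p - z0 * (z0^-1 - rho) `^ p.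
Proof.
move=> p2 rho0 z01 rhoz rho1; have p0 : 0 < p by rewrite (lt_le_trans _ p2).
have z00 : 0 < z0 by exact: lt_trans z01.
(* [L] is [H'(1) / S'(1)] for the functions [H] and [S] below, that is, the limit of [H / S] at
   [z = 1], where both vanish. *)
pose L := (1 - rho) `^ (p - 1) * (p - (1 - rho)).
pose H z := z^-1 * `|z - rho| `^ p - z * `|z^-1 - rho| `^ p.
pose S (z : R) := z - z^-1.
pose dH z := - z ^- 2 * (z - rho) `^ p + z^-1 * (p * (z - rho) `^ (p - 1)) -
   ((z^-1 - rho) `^ p - z^-1 * (p * (z^-1 - rho) `^ (p - 1))).
have invz z : 1 <= z -> z < z0 -> [/\ 0 < z, 0 < z - rho & 0 < z^-1 - rho].
  move=> z1 zz0; have zp : 0 < z by exact: lt_le_trans z1.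
  split => //; first by rewrite subr_gt0 (lt_le_trans rho1).
  by rewrite subr_gt0 (le_lt_trans rhoz)// ltf_pV2.
have dHP z : 1 <= z -> z < z0 -> is_derive z 1 H (dH z).
  move=> z1 zz0; have [zp A0 B0] := invz _ z1 zz0.
  have zn0 : z != 0 by rewrite gt_eqF.
  have An0 : z - rho != 0 by rewrite gt_eqF.
  have Bn0 : z^-1 - rho != 0 by rewrite gt_eqF.
  have dV : is_derive z 1 (fun z : R => z^-1) (- z ^- 2).
    apply: (is_derive_conv (is_deriveV zn0 (is_derive_id z 1))).
    by rewrite /GRing.scale/= mulr1.
  have dA : is_derive z 1 (fun z => `|z - rho| `^ p) (p * (z - rho) `^ (p - 1)).
    have d1 : is_derive z 1 (fun z : R => z - rho) 1.
      by apply: is_derive_eq; rewrite subr0.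
    have := @is_derive1_comp _ (fun y : R => `|y| `^ p) (fun z : R => z - rho) z _ _ (is_derive_normpow p An0) d1.
    by rewrite gtr0_norm// gtr0_sg// !mulr1.
  have dB : is_derive z 1 (fun z => `|z^-1 - rho| `^ p) (p * (z^-1 - rho) `^ (p - 1) * - z ^- 2).
    have d1 : is_derive z 1 (fun z : R => z^-1 - rho) (- z ^- 2).
      by apply: is_derive_eq; rewrite subr0.
    have := @is_derive1_comp _ (fun y : R => `|y| `^ p) (fun z : R => z^-1 - rho) z _ _ (is_derive_normpow p Bn0) d1.
    by rewrite gtr0_norm// gtr0_sg// !mulr1.
  have dM1 := @is_deriveM _ _ _ _ z 1 _ _ dV dA.
  have dM2 := @is_deriveM _ _ _ _ z 1 _ _ (is_derive_id z 1) dB.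
  apply: (is_derive_conv (is_deriveB dM1 dM2)).
  rewrite /GRing.scale/= /dH !gtr0_norm//.
  by field.
have dSP (z : R) : z != 0 -> is_derive z 1 S (1 + z ^- 2).
  move=> zn0.
  apply: (is_derive_conv (is_deriveB (is_derive_id z 1) (is_deriveV zn0 (is_derive_id z 1)))).
  by rewrite /GRing.scale/= mulr1 opprK.
have cH (z : R) : z != 0 -> {for z, continuous H}.
  move=> zn0; have cp := continuous_normpow p0.
  have cV : {for z, continuous (fun z : R => z^-1)} by exact: inv_continuous.
  have cA : {for z, continuous (fun z : R => `|z - rho| `^ p)}.
    apply: (@continuous_comp _ _ _ (fun z : R => z - rho) (fun y : R => `|y| `^ p)); last exact: cp.
    by apply: cvgB; [exact: cvg_id|exact: cvg_cst].
  have cB : {for z, continuous (fun z : R => `|z^-1 - rho| `^ p)}.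
    apply: (@continuous_comp _ _ _ (fun z : R => z^-1 - rho) (fun y : R => `|y| `^ p)); last exact: cp.
    by apply: cvgB; [exact: cV|exact: cvg_cst].
  by apply: cvgB; apply: cvgM; [exact: cV|exact: cA|exact: cvg_id|exact: cB].
have cS (z : R) : z != 0 -> {for z, continuous S}.
  by move=> zn0; apply: cvgB; [exact: cvg_id|exact: inv_continuous].
have S0 (z : R) : 1 < z -> 0 < S z.
  move=> z1; rewrite subr_gt0 (lt_trans _ z1)// invf_lt1//.
  exact: lt_trans z1.
(* The numerator of the derivative of [H / S] is [2/x] times the trapezoid gap between [x - rho] and
   [1/x - rho]. *)
have mono (z : R) : 1 < z -> z < z0 -> H z / S z <= H z0 / S z0.
  move=> z1 zz0.
  apply: (@derive_ge0_le (fun x => H x / S x) (fun x => (dH x * S x - H x * (1 + x ^- 2)) / S x ^+ 2) _ _ (ltW zz0)).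
  - move=> x /andP[zx xz0]; have x1 : 1 < x by exact: lt_trans zx.
    have xn0 : x != 0 by rewrite gt_eqF// (lt_trans _ x1).
    have Sn0 : S x != 0 by rewrite gt_eqF// S0.
    have d1 := dHP x (ltW x1) xz0; have d2 := dSP x xn0.
    have d3 : is_derive x 1 (fun x => (S x)^-1) (- (S x) ^- 2 * (1 + x ^- 2)).
      by apply: (is_derive_conv (is_deriveV Sn0 d2)).
    apply: (is_derive_conv (@is_deriveM _ _ _ _ x 1 _ _ d1 d3)).
    rewrite /GRing.scale/=; move: Sn0; move: (S x) (H x) (dH x) => sx hx dx sn0.
    by field; rewrite ?sn0 ?xn0.
  - apply: continuous_in_subspaceT => x; rewrite inE/= in_itv/= => /andP[zx _].
    have x1 : 1 < x by exact: lt_le_trans zx.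
    have xn0 : x != 0 by rewrite gt_eqF// (lt_trans _ x1).
    apply: cvgM; first exact: cH.
    by apply: cvgV; [rewrite gt_eqF// S0|exact: cS].
  - move=> x /andP[zx xz0]; have x1 : 1 < x by exact: lt_trans zx.
    have [xp A0 B0] := invz _ (ltW x1) xz0.
    rewrite divr_ge0 ?sqr_ge0//.
    have AB : x^-1 - rho <= x - rho by rewrite lerB// ltW// -subr_gt0 S0.
    have := trapezoid_powR p2 (ltW B0) AB.
    rewrite -subr_ge0 => h.
    rewrite (_ : dH x * S x - H x * (1 + x ^- 2) = 2 / x * (p / 2 * (x - rho - (x^-1 - rho)) *
      ((x - rho) `^ (p - 1) + (x^-1 - rho) `^ (p - 1)) - ((x - rho) `^ p - (x^-1 - rho) `^ p))).
      by rewrite mulr_ge0// divr_ge0// ltW.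
    rewrite /dH /H /S !gtr0_norm//; have xn0 : x != 0 by rewrite gt_eqF.
    move: (_ `^ p) (_ `^ p) (_ `^ (p - 1)) (_ `^ (p - 1)) => a1 a2 a3 a4.
    by field.
have [h|lt0] := leP (L * S z0) (H z0).
  move: h; rewrite /H [`|z0 - rho|]ger0_norm ?[`|z0^-1 - rho|]ger0_norm ?subr_ge0//.
  by rewrite ltW// (lt_trans rho1).
(* If [H z0 < L * S z0], monotonicity of [H / S] forces [E = H - L S] below [- d (z - 1)] to the
   right of [1] for some [d > 0], because [S z >= z - 1]. This contradicts [E 1 = 0] and
   [E' 1 = 0]. *)
exfalso.
pose E z := H z - L * S z.
have E1 : E 1 = 0 by rewrite /E /H /S invr1; ring.
have dE : is_derive (1 : R) (1 : R) E 0.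
  have d1 := dHP 1 (lexx _) z01; have d2 := dSP 1 (oner_neq0 _).
  have d3 := is_deriveZ L d2.
  apply: (is_derive_conv (is_deriveB d1 d3)).
  rewrite /dH /L /GRing.scale/= invr1 expr1n invr1 !mul1r.
  have -> : (1 - rho) `^ p = (1 - rho) * (1 - rho) `^ (p - 1).
    by rewrite mulr_powRB1// subr_ge0 ltW.
  by ring.
pose d := L - H z0 / S z0.
have d0 : 0 < d by rewrite subr_gt0 ltr_pdivrMr// S0.
have Ez (z : R) : 1 < z -> z < z0 -> E z <= - d * (z - 1).
  move=> z1 zz0; have := mono z z1 zz0; rewrite ler_pdivrMr ?S0// => h.
  rewrite /E; apply: (@le_trans _ _ (- d * S z)).
    by rewrite /d; lra.
  rewrite !mulNr lerN2 ler_pM2l// /S lerB// invf_le1 ?ltW//.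
  exact: lt_trans z1.
have Eq : h^-1 *: (E (h *: 1 + 1) - E 1) @[h --> 0^'] --> (0:R).
  have dE0 : 'D_1 E 1 = 0 by rewrite derive_val.
  by rewrite -[X in _ --> X]dE0; have /@ex_derive := dE.
move/cvgrPdist_lt : Eq => /(_ _ d0); rewrite near_withinE => -[e /= e0 he].
pose h := Num.min (e / 2) ((z0 - 1) / 2).
have h0 : 0 < h by rewrite lt_min !divr_gt0// subr_gt0.
have he2 : h < e.
  by apply: (@le_lt_trans _ _ (e / 2)); [rewrite ge_min lexx|rewrite ltr_pdivrMr//; lra].
have hz : h <= (z0 - 1) / 2 by rewrite ge_min lexx orbT.
have hb : ball_ [eta Num.Def.normr] (0 : R) e h by rewrite /ball_/= sub0r normrN gtr0_norm.
have hn0 : h != 0 by rewrite gt_eqF.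
have := he h hb hn0; rewrite E1 subr0 sub0r normrN /GRing.scale/= mulr1.
have h1 : 1 < h + 1 by lra.
have h2 : h + 1 < z0 by lra.
have := Ez _ h1 h2; rewrite addrK => Eh.
rewrite ltNge => /negP; apply.
have Eh0 : h^-1 * E (h + 1) <= - d.
  by rewrite ler_pdivrMl// mulrC (le_trans Eh)// mulrC.
by rewrite ler0_norm; lra.
Qed.

End power_functions.

(** * Lower bounds for the Jensen gap of the power function *)

Section gap.
Context {R : realType}.
Variable p : R.
Hypothesis p2 : 2 <= p.
Implicit Types (q c t : R).

Let p0 : 0 < p. Proof. by rewrite (lt_le_trans _ p2). Qed.
Let p11 : 1 <= p - 1. Proof. by move: p2; lra. Qed.

(* With [t = 1 - q], the Jensen gap of [|.|^p] between [c - 1] and [c] with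
   weights [q] and [t]. *)
Definition jensen_gap q c := q * `|1 - c| `^ p + (1 - q) * `|c| `^ p - `|c - q| `^ p.

(** Reflection of the two points; it reduces [c <= 0] to [c >= 1] and, for [c < q], the range
    [q > 1/2] to the range [c >= q]. *)
Lemma jensen_gapC q c : jensen_gap q c = jensen_gap (1 - q) (1 - c).
Proof.
rewrite /jensen_gap opprB !subrKC [in RHS](_ : 1 - c - (1 - q) = - (c - q)); last by ring.
by rewrite normrN; ring.
Qed.

Let continuous_gap q : continuous (jensen_gap q).
Proof.
move=> x; have cp := continuous_normpow p0.
have c1 : {for x, continuous (fun x : R => `|1 - x| `^ p)}.
  apply: (@continuous_comp _ _ _ (fun z : R => 1 - z) (fun y : R => `|y| `^ p)); last exact: cp.
  by apply: cvgB; [exact: cvg_cst|exact: cvg_id].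
have c2 : {for x, continuous (fun x : R => `|x - q| `^ p)}.
  apply: (@continuous_comp _ _ _ (fun z : R => z - q) (fun y : R => `|y| `^ p)); last exact: cp.
  by apply: cvgB; [exact: cvg_id|exact: cvg_cst].
apply: cvgB; last exact: c2.
apply: cvgD; apply: cvgM; [exact: cvg_cst|exact: c1|exact: cvg_cst|exact: cp].
Qed.

Let is_derive_gap q x : 1 - x != 0 -> x != 0 -> x - q != 0 ->
  is_derive x 1 (jensen_gap q)
  (p * (- (q * `|1 - x| `^ (p - 1) * Num.sg (1 - x)) + (1 - q) * `|x| `^ (p - 1) * Num.sg x
     - `|x - q| `^ (p - 1) * Num.sg (x - q))).
Proof.
move=> n1 n2 n3.
have e1 : is_derive x 1 (fun z : R => 1 - z) (-1).
  apply: (is_derive_conv (is_deriveB (is_derive_cst (1 : R) x 1) (is_derive_id x 1))).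
  by rewrite sub0r.
have e3 : is_derive x 1 (fun z : R => z - q) 1.
  apply: (is_derive_conv (is_deriveB (is_derive_id x 1) (is_derive_cst q x 1))).
  by rewrite subr0.
have d1 := @is_derive1_comp _ (fun y : R => `|y| `^ p) (fun z : R => 1 - z) x _ _ (is_derive_normpow p n1) e1.
have d3 := @is_derive1_comp _ (fun y : R => `|y| `^ p) (fun z : R => z - q) x _ _ (is_derive_normpow p n3) e3.
have d2 := is_derive_normpow p n2.
have f1 := is_deriveZ q d1.
have f2 := is_deriveZ (1 - q) d2.
apply: (is_derive_conv (is_deriveB (is_deriveD f1 f2) d3)).
rewrite /GRing.scale/=; ring.
Qed.

(** For [c >= 1] the gap increases in [c]: [c - q] is the convex combination of [c - 1] and [c] with
    weights [q] and [1 - q], and the power [p - 1] is convex. At [c = 1] the gap is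
    [(1 - q) - (1 - q)^p], and [(1 - q)^p <= (1 - q)^2]. *)
Lemma jensen_gap_ge1 q c : 0 < q < 1 -> 1 <= c -> q * (1 - q) <= jensen_gap q c.
Proof.
move=> /andP[q0 q1] c1; have t0 : 0 < 1 - q by lra.
apply: (@le_trans _ _ (jensen_gap q 1)).
  rewrite /jensen_gap subrr normr0 powR0 ?gt_eqF// mulr0 add0r normr1 powR1 mulr1.
  rewrite gtr0_norm//; have := @ger_powR _ (1 - q) _ _ _ p2; rewrite t0 => /(_ _)/wrap[]; first by lra.
  have -> : (1 - q) `^ 2 = (1 - q) ^+ 2 by rewrite -powR_mulrn// ltW.
  by move: (_ `^ p) => y; nra.
apply: (@derive_ge0_le R (jensen_gap q) _ _ _ c1).
- move=> x /andP[x1 xc]; apply: is_derive_gap; first by rewrite lt_eqF//; lra.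
    by rewrite gt_eqF//; lra.
  by rewrite gt_eqF//; lra.
- exact: continuous_subspaceT.
- move=> x /andP[x1 xc].
  have a1 : 1 - x < 0 by lra.
  have a2 : 0 < x by lra.
  have a3 : 0 < x - q by lra.
  rewrite (ltr0_norm a1) (ltr0_sg a1) (gtr0_norm a2) (gtr0_sg a2) (gtr0_norm a3) (gtr0_sg a3).
  rewrite mulr_ge0 ?(ltW p0)// !mulr1 mulrN1 opprK opprB subr_ge0.
  have -> : x - q = q * (x - 1) + (1 - q) * x by ring.
  by apply: powR_convex => //; lra.
Qed.

(** With [sg = sqrt (1 - q)] and [1 - c = sg * rho], the gap equals [sg^p (q rho^p + sg H)], where
    [H] is the right-hand side of [ground_state_path] at [z0 = 1/sg]. The path bound replaces [sg H]
    by [q (1 - rho)^(p - 1) (p - (1 - rho))], which completes [gtau] at [tau = 1 - rho]. The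
    condition [c >= q] is exactly [rho <= sg]. *)
Lemma jensen_gap_path q c : 0 < q < 1 -> q <= c < 1 ->
  exists2 tau, 0 < tau < 1 & q * (1 - q) `^ (p / 2) * gtau p tau <= jensen_gap q c.
Proof.
move=> /andP[q0 q1] /andP[qc c1].
have t0 : 0 < 1 - q by lra.
pose sg := Num.sqrt (1 - q).
have s0 : 0 < sg by rewrite sqrtr_gt0.
have s2 : sg ^+ 2 = 1 - q by rewrite sqr_sqrtr// ltW.
have s1 : sg < 1 by nra.
have sn0 : sg != 0 by rewrite gt_eqF.
pose rho := (1 - c) / sg.
have r0 : 0 < rho by rewrite divr_gt0// subr_gt0.
have rs : rho <= sg by rewrite ler_pdivrMr// -expr2 s2; lra.
exists (1 - rho); first by apply/andP; split; lra.
have z1 : 1 < sg^-1 by rewrite invf_gt1.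
have := @ground_state_path R p rho sg^-1 p2 r0 z1; rewrite invrK => /(_ rs (le_lt_trans rs s1)).
rewrite -subr_ge0 => h.
have cE : 1 - c = sg * rho by rewrite /rho mulrC divfK.
have sp : (1 - q) `^ (p / 2) = sg `^ p.
  rewrite -s2 -powR_mulrn ?ltW// -powRrM; congr (_ `^ _); by field.
rewrite /jensen_gap cE (_ : `|c| = sg * (sg^-1 - rho)); last first.
  rewrite mulrBr divff// -cE ger0_norm; [ring|lra].
rewrite (_ : `|c - q| = sg * (sg - rho)); last first.
  by rewrite mulrBr -cE -expr2 s2 ger0_norm; [ring|lra].
have hA : 0 <= sg^-1 - rho by lra.
have hB : 0 <= sg - rho by lra.
rewrite (gtr0_norm (mulr_gt0 s0 r0)) (powRM p (ltW s0) (ltW r0)).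
rewrite (powRM p (ltW s0) hA) (powRM p (ltW s0) hB).
rewrite sp /gtau opprB subrKC.
have t1 : 0 <= 1 - rho by lra.
rewrite -(mulr_powRB1 t1 p0).
move: h; have -> : q = 1 - sg ^+ 2 by rewrite s2; ring.
move: (sg `^ p) (powR_ge0 sg p) => S S0.
move: (_ `^ (p - 1)) (_ `^ p) (_ `^ p) (_ `^ p) => T X Y Z h.
rewrite -subr_ge0.
have := mulr_ge0 (mulr_ge0 S0 (ltW s0)) h.
congr (0 <= _); field.
exact: sn0.
Qed.

(** Divide the derivative by [(1 - x)^(p - 1)]. The ratios [a = x/(1 - x)] and [b = (q - x)/(1 - x)]
    lie in [[0, 1]] since [q <= 1/2], so their powers [p - 1] are at most [a] and [b], while
    [(1 - q) a + b = q]. *)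
Lemma jensen_gap_decr q c : 0 < q <= 1 / 2 -> 0 < c <= q ->
  jensen_gap q q <= jensen_gap q c.
Proof.
move=> /andP[q0 q1] /andP[c0 cq].
rewrite -lerN2; apply: (@derive_ge0_le R (fun x => - jensen_gap q x) _ _ _ cq).
- move=> x /andP[x1 x2]; apply: is_deriveN; apply: is_derive_gap.
  + by rewrite gt_eqF//; lra.
  + by rewrite gt_eqF//; lra.
  + by rewrite lt_eqF//; lra.
- by apply: continuous_subspaceT => x; apply: cvgN; exact: continuous_gap.
- move=> x /andP[x1 x2].
  have a1 : 0 < 1 - x by lra.
  have a2 : 0 < x by lra.
  have a3 : x - q < 0 by lra.
  rewrite (gtr0_norm a1) (gtr0_sg a1) (gtr0_norm a2) (gtr0_sg a2) (ltr0_norm a3) (ltr0_sg a3).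
  rewrite oppr_ge0 pmulr_rle0// !mulr1 mulrN1 opprK opprB.
  have an0 : 1 - x != 0 by rewrite gt_eqF.
  have b1 : 0 <= x / (1 - x) <= 1.
    by apply/andP; split; [rewrite divr_ge0//; lra|rewrite ler_pdivrMr//; lra].
  have b2 : 0 <= (q - x) / (1 - x) <= 1.
    by apply/andP; split; [rewrite divr_ge0//; lra|rewrite ler_pdivrMr//; lra].
  have := powR_le_id b1 p11; have := powR_le_id b2 p11.
  have -> : x `^ (p - 1) = (1 - x) `^ (p - 1) * (x / (1 - x)) `^ (p - 1).
    rewrite -(powRM _ (ltW a1) (proj1 (andP b1))); congr (_ `^ _); by field.
  have -> : (q - x) `^ (p - 1) = (1 - x) `^ (p - 1) * ((q - x) / (1 - x)) `^ (p - 1).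
    rewrite -(powRM _ (ltW a1) (proj1 (andP b2))); congr (_ `^ _); by field.
  have e3 : (1 - q) * (x / (1 - x)) + (q - x) / (1 - x) = q by field.
  have := powR_ge0 (1 - x) (p - 1).
  move: e3; move: (x / (1 - x)) ((q - x) / (1 - x)) => a b e3.
  move: (a `^ _) (b `^ _) (_ `^ _) => U V K K0 hV hU.
  have e4 : (1 - q) * U <= (1 - q) * a by rewrite ler_pM2l//; lra.
  rewrite (_ : _ + _ = - (K * (q - ((1 - q) * U + V)))); last by ring.
  by rewrite oppr_le0 mulr_ge0//; lra.
Qed.

End gap.

(** * The constant [c_p] and the pointwise inequality *)

Section ground_state_constant.
Context {R : realType}.
Variable p : R.
Hypothesis p2 : 2 <= p.

Let p0 : 0 < p. Proof. by rewrite (lt_le_trans _ p2). Qed.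
Let p10 : 0 < p - 1. Proof. by move: p2; lra. Qed.

(** Agrees with [gtau p] on [[0, 1]]; the absolute values make it continuous on the whole line, so
    that the extreme value theorem applies on [[0, 1/2]]. *)
Let G (x : R) := `|1 - x| `^ p - `|x| `^ p + p * `|x| `^ (p - 1).

Let GE (x : R) : 0 <= x <= 1 -> G x = gtau p x.
Proof.
by move=> /andP[x0 x1]; rewrite /G /gtau (ger0_norm x0) ger0_norm// subr_ge0.
Qed.

Let continuous_G : continuous G.
Proof.
move=> x; have cp := continuous_normpow p0; have cp1 := continuous_normpow p10.
have c1 : {for x, continuous (fun x : R => `|1 - x| `^ p)}.
  apply: (@continuous_comp _ _ _ (fun z : R => 1 - z) (fun y : R => `|y| `^ p)); last exact: cp.
  by apply: cvgB; [exact: cvg_cst|exact: cvg_id].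
apply: cvgD; first by apply: cvgB; [exact: c1|exact: cp].
by apply: cvgM; [exact: cvg_cst|exact: cp1].
Qed.

Let is_derive_G (x : R) : 0 < x < 1 -> is_derive x 1 G
  (p * (- (1 - x) `^ (p - 1) - x `^ (p - 1) + (p - 1) * x `^ (p - 1 - 1))).
Proof.
move=> /andP[x0 x1]; have y0 : 0 < 1 - x by rewrite subr_gt0.
have n1 : 1 - x != 0 by rewrite gt_eqF.
have n2 : x != 0 by rewrite gt_eqF.
have e1 : is_derive x 1 (fun z : R => 1 - z) (-1).
  apply: (is_derive_conv (is_deriveB (is_derive_cst (1 : R) x 1) (is_derive_id x 1))).
  by rewrite sub0r.
have d1 := @is_derive1_comp _ (fun y : R => `|y| `^ p) (fun z : R => 1 - z) x _ _ (is_derive_normpow p n1) e1.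
have d2 := is_derive_normpow p n2.
have d3 := is_deriveZ p (is_derive_normpow (p - 1) n2).
apply: (is_derive_conv (is_deriveD (is_deriveB d1 d2) d3)).
rewrite /GRing.scale/= (gtr0_norm x0) (gtr0_sg x0) (gtr0_norm y0) (gtr0_sg y0).
by ring.
Qed.

(* [G' >= 0] as soon as [((1 - x) / x) ^ (p - 2) <= p - 1]. *)
Let G_incr (a b : R) : 0 < a -> a <= b -> b <= 1 ->
  ((1 - a) / a) `^ (p - 2) <= p - 1 -> G a <= G b.
Proof.
move=> a0 ab b1 ha.
apply: (@derive_ge0_le R G _ _ _ ab).
- by move=> x /andP[ax xb]; apply: is_derive_G; apply/andP; split; lra.
- exact: continuous_subspaceT.
move=> x /andP[ax xb].
have x0 : 0 < x by lra.
have y0 : 0 < 1 - x by lra.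
rewrite mulr_ge0 ?(ltW p0)//.
have p20 : 0 <= p - 2 by move: p2; lra.
have E (y : R) : 0 < y -> y `^ (p - 1) = y * y `^ (p - 2).
  move=> yp; rewrite -{2}(powRr1 (ltW yp)) -powRD; last by rewrite (gt_eqF yp)/= implybT.
  by congr (_ `^ _); ring.
rewrite !E// (_ : p - 1 - 1 = p - 2); last by ring.
have k1 : (1 - x) `^ (p - 2) = ((1 - x) / x) `^ (p - 2) * x `^ (p - 2).
  have hy : 0 <= (1 - x) / x by rewrite divr_ge0// ltW.
  by rewrite -(powRM _ hy (ltW x0)) divfK// gt_eqF.
have k2 : ((1 - x) / x) `^ (p - 2) <= p - 1.
  apply: le_trans ha; apply: ge0_ler_powR => //.
  - by rewrite nnegrE divr_ge0// ltW.
  - by rewrite nnegrE divr_ge0//; lra.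
  - by rewrite ler_pdivrMr// mulrAC ler_pdivlMr//; nra.
rewrite k1; move: (x `^ (p - 2)) (powR_ge0 x (p - 2)) k2 => X X0.
move: (_ `^ _) => K k2.
have k3 : (1 - x) * K + x <= p - 1.
  have : (1 - x) * K <= (1 - x) * (p - 1) by rewrite ler_pM2l.
  by move: p2; nra.
have := mulr_ge0 X0 (_ : 0 <= p - 1 - ((1 - x) * K + x)).
by rewrite subr_ge0 => /(_ k3); nra.
Qed.

Let half_ratio : (((1 - 1 / 2) / (1 / 2)) `^ (p - 2) : R) <= p - 1.
Proof.
rewrite (_ : (1 - 1 / 2) / (1 / 2) = 1); last by field.
by rewrite powR1 /=; move: p2; lra.
Qed.

Lemma gtau2 (x : R) : 0 <= x <= 1 -> gtau 2 x = 1.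
Proof.
move=> /andP[x0 x1]; rewrite /gtau (_ : (2 : R) - 1 = 1); last by ring.
by rewrite (@powR_mulrn _ _ 2) ?subr_ge0// (@powR_mulrn _ _ 2)// powRr1//; ring.
Qed.

(** A minimiser over [[0, 1/2]] exists by compactness. For [p > 2] it is not [0], since [G 0 = 1]
    and [G] takes smaller values nearby; if it is [1/2], monotonicity of [G] up to [1/2] yields
    another one inside. Since [G] increases on [[1/2, 1]], the minimum extends to all of [(0, 1)],
    the range in which the path argument produces [tau]. For [p = 2], [gtau] is constant. *)
Let gtau_min_spec : exists2 c : R, 0 < c < 1 / 2 &
  (forall x, 0 < x < 1 -> gtau p c <= gtau p x) /\ gtau p c <= 1.
Proof.
have [pE|pn2] := eqVneq p 2.
  exists (1 / 4); first by apply/andP; split; lra.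
  rewrite pE; split => [x /andP[x0 x1]|]; rewrite !gtau2//; apply/andP; split; lra.
have p2' : 0 < p - 2 by rewrite subr_gt0 lt_neqAle eq_sym pn2.
have h01 : (0 : R) <= 1 / 2 by lra.
have [c cI cmin] := @EVT_min R G 0 (1 / 2) h01 (continuous_subspaceT continuous_G).
have {}cmin x : 0 <= x <= 1 / 2 -> G c <= G x by move=> xI; apply: cmin; rewrite in_itv.
move: cI; rewrite in_itv/= => /andP[c0 c1].
have G0 : G 0 = 1.
  by rewrite /G subr0 normr1 powR1 normr0 !powR0 ?gt_eqF// mulr0 addr0 subr0.
(* Chosen so that [p x0^(p - 2) <= 1], hence [p x0^(p - 1) <= x0]; with [(1 - x0)^p <= 1 - x0] this
   leaves [G x0 <= 1 - x0^p < 1]. *)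
pose x0 : R := Num.min (1 / 4) (p^-1 `^ (p - 2)^-1).
have x0p : 0 < x0 by rewrite lt_min powR_gt0 ?invr_gt0//; apply/andP; split => //; lra.
have x04 : x0 <= 1 / 4 by rewrite ge_min lexx.
have x0q : p * x0 `^ (p - 2) <= 1.
  rewrite -ler_pdivlMl// mulr1.
  have -> : p^-1 = (p^-1 `^ (p - 2)^-1) `^ (p - 2).
    by rewrite -powRrM mulVf ?gt_eqF// powRr1// invr_ge0 ltW.
  apply: ge0_ler_powR; rewrite ?nnegrE ?powR_ge0//; [exact: ltW|exact: ltW|].
  by rewrite ge_min lexx orbT.
have Gx0 : G x0 < 1.
  rewrite GE; last by apply/andP; split; lra.
  rewrite /gtau; have h1 : (1 - x0) `^ p <= 1 - x0.
    by apply: powR_le_id; [apply/andP; split; lra|move: p2; lra].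
  have h2 : x0 `^ (p - 1) = x0 * x0 `^ (p - 2).
    rewrite -{2}(powRr1 (ltW x0p)) -powRD; last by rewrite (gt_eqF x0p)/= implybT.
    by congr (_ `^ _); ring.
  have h3 : 0 < x0 `^ p by rewrite powR_gt0.
  have h4 : p * x0 `^ (p - 1) <= x0 by rewrite h2 mulrCA ger_pMr.
  by lra.
have cn0 : 0 < c.
  rewrite lt_neqAle c0 andbT; apply/eqP => cE.
  have := cmin x0; rewrite -cE G0 => /(_ _)/wrap[]; first by apply/andP; split; lra.
  by lra.
(* [eta = 1/(1 + k)] is the point where [((1 - eta)/eta)^(p - 2) = p - 1], the threshold from which
   [G] is known to increase; [k > 1] puts it below [1/2]. *)
pose k : R := (p - 1) `^ (p - 2)^-1.
have k1 : 1 < k.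
  have ip : 0 < (p - 2)^-1 by rewrite invr_gt0.
  have := @gt0_ltr_powR R _ ip 1 (p - 1); rewrite powR1 !nnegrE => /(_ ler01 (ltW p10)).
  by apply; lra.
pose eta := (1 + k)^-1.
have eta0 : 0 < eta by rewrite invr_gt0; lra.
have eta2 : eta < 1 / 2 by rewrite /eta div1r ltf_pV2 ?posrE//; lra.
have Geta : G eta <= G (1 / 2).
  apply: G_incr => //; [exact: ltW|lra|].
  have -> : (1 - eta) / eta = k by rewrite /eta; field; apply/eqP; lra.
  by rewrite /k -powRrM mulVf ?gt_eqF// powRr1//; exact: ltW.
have Ghalf x : 1 / 2 <= x <= 1 -> G (1 / 2) <= G x.
  by move=> /andP[xh x1]; apply: G_incr => //; lra.
have [c' c'I c'min] : exists2 c' : R, 0 < c' < 1 / 2 & G c' = G c.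
  have [cE|cne] := eqVneq c (1 / 2); last first.
    by exists c => //; rewrite cn0 lt_neqAle cne c1.
  exists eta; first by rewrite eta0.
  apply/eqP; rewrite eq_le {1}cE Geta/= cmin//; apply/andP; split; lra.
have [c'0 c'1] := andP c'I.
exists c' => //; rewrite -GE; last by apply/andP; split; lra.
rewrite c'min; split; last by apply: (le_trans (cmin x0 _) (ltW Gx0)); apply/andP; split; lra.
move=> x /andP[xp x1]; rewrite -GE; last by apply/andP; split; lra.
have [xh|xh] := leP x (1 / 2); first by apply: cmin; apply/andP; split; lra.
apply: le_trans (Ghalf x _); last by apply/andP; split; lra.
by apply: cmin; apply/andP; split; lra.
Qed.

Let c_pE (c : R) : 0 < c < 1 / 2 -> (forall x, 0 < x < 1 -> gtau p c <= gtau p x) ->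
  c_p p = gtau p c.
Proof.
move=> cI cmin; have [c0 c1] := andP cI.
pose A := [set gtau p tau | tau in `]0, 1/2[%classic].
have Ac : A (gtau p c) by exists c => //=; rewrite in_itv.
have lbA : lbound A (gtau p c).
  move=> _ [x /= + <-]; rewrite in_itv/= => /andP[x0 x1].
  by apply: cmin; apply/andP; split; lra.
apply/eqP; rewrite eq_le; apply/andP; split.
  by apply: ge_inf => //; exists (gtau p c).
by apply: lb_le_inf => //; exists (gtau p c).
Qed.

Lemma c_p_attained : exists2 tau, 0 < tau < 1 / 2 & gtau p tau = c_p p.
Proof.
have [c cI [cmin _]] := gtau_min_spec.
by exists c => //; rewrite (c_pE cI cmin).
Qed.

Lemma c_p_le (x : R) : 0 < x < 1 -> c_p p <= gtau p x.
Proof.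
by have [c cI [cmin _]] := gtau_min_spec; rewrite (c_pE cI cmin); exact: cmin.
Qed.

Lemma c_p_bounds : 0 < c_p p <= 1.
Proof.
have [c cI [cmin c1]] := gtau_min_spec; rewrite (c_pE cI cmin) c1 andbT.
have [c0 ch] := andP cI; rewrite /gtau.
have h1 : c `^ p <= (1 - c) `^ p.
  by apply: ge0_ler_powR; rewrite ?nnegrE ?(ltW p0)//; lra.
have h2 : 0 < p * c `^ (p - 1) by rewrite mulr_gt0// powR_gt0.
by lra.
Qed.

Lemma c_2 : p = 2 -> c_p p = 1.
Proof.
move=> pE; have [c cI [cmin _]] := gtau_min_spec; rewrite (c_pE cI cmin) pE gtau2//.
by have [c0 ch] := andP cI; apply/andP; split; lra.
Qed.

(** Points [c] outside [(0, 1)] satisfy the stronger bound [q (1 - q)], and [c >= q] is the path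
    argument. For [c < q], either [q <= 1/2] and the gap at [c] is at least the one at [q], or
    [q > 1/2] and reflection returns to the path argument. *)
Lemma jensen_gap_ge (q c : R) : 0 < q < 1 ->
  c_p p * q * (1 - q) `^ (p / 2) <= jensen_gap p q c.
Proof.
have /andP[cp0 cp1] := c_p_bounds.
have ph : 1 <= p / 2 by move: p2; lra.
(* Both orientations are below [a (1 - a)] because [c_p <= 1] and [p/2 >= 1]; the second one serves
   the reflected case [c <= 0]. *)
have out (a b : R) : 0 < a < 1 -> 1 <= b -> c_p p * a * (1 - a) `^ (p / 2) <= jensen_gap p a b /\
    c_p p * (1 - a) * a `^ (p / 2) <= jensen_gap p a b.
  move=> aI b1; have [a0 a1] := andP aI.
  have h := jensen_gap_ge1 p2 aI b1.
  have h1 : (1 - a) `^ (p / 2) <= 1 - a by apply: powR_le_id => //; apply/andP; split; lra.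
  have h2 : a `^ (p / 2) <= a by apply: powR_le_id => //; apply/andP; split; lra.
  have h3 := powR_ge0 a (p / 2); have h4 := powR_ge0 (1 - a) (p / 2).
  split; apply: le_trans h.
    rewrite -mulrA; apply: (@le_trans _ _ (1 * (a * (1 - a) `^ (p / 2)))).
      by rewrite ler_wpM2r// mulr_ge0// ltW.
    by rewrite mul1r ler_pM2l.
  rewrite -mulrA; apply: (@le_trans _ _ (1 * ((1 - a) * a `^ (p / 2)))).
    by rewrite ler_wpM2r// mulr_ge0//; lra.
  by rewrite mul1r mulrC ler_wpM2r//; lra.
have path (a b : R) : 0 < a < 1 -> a <= b < 1 -> c_p p * a * (1 - a) `^ (p / 2) <= jensen_gap p a b.
  move=> aI bI; have [tau tI h] := jensen_gap_path p2 aI bI; apply: le_trans h.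
  rewrite -mulrA mulrC ler_wpM2l ?c_p_le// mulr_ge0 ?powR_ge0//.
  by have [a0 _] := andP aI; exact: ltW.
move=> qI; have [q0 q1] := andP qI.
have qI' : 0 < 1 - q < 1 by apply/andP; split; lra.
have [c1|c1] := leP 1 c; first by have [] := out q c qI c1.
have [c0|c0] := leP c 0.
  have c1' : 1 <= 1 - c by lra.
  have [_] := out (1 - q) (1 - c) qI' c1'.
  by rewrite -jensen_gapC subKr.
have [qc|qc] := leP q c; first by apply: path => //; rewrite qc.
have [qh|qh] := leP q (1 / 2).
  apply: (@le_trans _ _ (jensen_gap p q q)); first by apply: path => //; rewrite lexx.
  by apply: jensen_gap_decr => //; apply/andP; split; lra.
(* Reflection yields the bound with [(1 - q) q^(p/2)] in place of [q (1 - q)^(p/2)]; since [q > 1/2]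
   and [p/2 >= 1], the former is the larger. *)
have h : 1 - q <= 1 - c < 1 by apply/andP; split; lra.
have := path (1 - q) (1 - c) qI' h; rewrite -jensen_gapC subKr; apply: le_trans.
have E (y : R) : 0 < y -> y `^ (p / 2) = y * y `^ (p / 2 - 1) by move=> y0; rewrite mulr_powRB1// ?ltW// divr_gt0.
rewrite -!mulrA ler_pM2l// !E//; last by lra.
rewrite mulrCA ler_pM2l//; last by lra.
rewrite ler_pM2l//.
by apply: ge0_ler_powR; rewrite ?nnegrE ?subr_ge0//; lra.
Qed.

(** For [v1 != v2] this is the bound on the Jensen gap with [1 - q = w2/w1], multiplied by
    [w1^p |v1 - v2|^p / q]. For [v1 = v2] both sides coincide. *)
Lemma ground_state_pointwise (w1 w2 v1 v2 : R) : 0 < w2 < w1 ->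
  (w1 - w2) `^ (p - 1) * (w1 * `|v1| `^ p - w2 * `|v2| `^ p) +
  c_p p * (w1 * w2) `^ (p / 2) * `|v1 - v2| `^ p <= `|w1 * v1 - w2 * v2| `^ p.
Proof.
move=> /andP[w20 w21]; have w10 : 0 < w1 by exact: lt_trans w21.
have pn0 : p != 0 by rewrite gt_eqF.
pose t := w2 / w1; pose q := 1 - t.
have wn0 : w1 != 0 by rewrite gt_eqF.
have w2E : w2 = w1 * t by rewrite mulrC divfK.
have t0 : 0 < t by rewrite divr_gt0.
have t1 : t < 1 by rewrite ltr_pdivrMr// mul1r.
have q0 : 0 < q by rewrite subr_gt0.
have qn0 : q != 0 by rewrite gt_eqF.
have qI : 0 < q < 1 by rewrite q0 /q; lra.
have wsE : w1 - w2 = w1 * q by rewrite /q w2E; ring.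
have wmE : (w1 * w2) `^ (p / 2) = w1 `^ p * t `^ (p / 2).
  rewrite w2E (_ : w1 * (w1 * t) = w1 ^+ 2 * t); last by ring.
  rewrite (powRM _ (sqr_ge0 w1) (ltW t0)) -(powR_mulrn _ (ltW w10)) -powRrM.
  by congr (_ `^ _ * _); field.
have wp : w1 * w1 `^ (p - 1) = w1 `^ p by rewrite mulr_powRB1// ltW.
have W0 : 0 < w1 `^ p by rewrite powR_gt0.
have [vE|vne] := eqVneq v1 v2.
  have h0 : 0 < w1 * q by rewrite mulr_gt0.
  rewrite vE subrr normr0 (powR0 pn0) mulr0 addr0 -!mulrBl wsE.
  rewrite normrM (powRM _ (normr_ge0 _) (normr_ge0 _)) (gtr0_norm h0) mulrA.
  by rewrite [X in X * _ <= _]mulrC (mulr_powRB1 (ltW h0) p0).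
pose d := v2 - v1; have dn0 : d != 0 by rewrite subr_eq0 eq_sym.
(* This [c] makes [v1], [v2] and [w1 v1 - w2 v2] proportional to [c - q], [c] and [c - 1], the three
   arguments in the gap. *)
pose c := q * v2 / d.
have e1 : w1 * v1 - w2 * v2 = w1 * (d * (c - 1)) by rewrite w2E /c /q /d; field.
have e2 : v1 = d * ((c - q) / q) by rewrite /c /d; field; rewrite qn0 -/d dn0.
have e3 : v2 = d * (c / q) by rewrite /c; field; rewrite qn0.
have e4 : v1 - v2 = - d by rewrite /d; ring.
move: c e1 e2 e3 => c e1 e2 e3.
have := jensen_gap_ge c qI; rewrite /jensen_gap (_ : 1 - q = t); last by rewrite /q; ring.
rewrite wsE wmE e4 normrN e1 [in X in _ -> X]e2 [in X in _ -> X]e3 w2E.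
have nn (x y : R) : `|x * y| `^ p = `|x| `^ p * `|y| `^ p by rewrite normrM powRM.
have wq : (w1 * q) `^ (p - 1) = w1 `^ (p - 1) * q `^ (p - 1) by rewrite (powRM _ (ltW w10) (ltW q0)).
rewrite !nn (distrC c 1) wq (gtr0_norm w10) [`|q^-1|]normfV (gtr0_norm q0).
have qp : q^-1 `^ p = (q * q `^ (p - 1))^-1.
  by rewrite (mulr_powRB1 (ltW q0) p0) -powRN -(powR_inv1 (ltW q0)) -powRrM mulN1r.
rewrite qp -wp => h.
have Q0 : 0 < q `^ (p - 1) by rewrite powR_gt0.
have Qn0 : q `^ (p - 1) != 0 by rewrite gt_eqF.
have X0 : 0 <= w1 * w1 `^ (p - 1) * (`|d| `^ p / q).
  by rewrite mulr_ge0// ?divr_ge0 ?powR_ge0// ?ltW// wp.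
rewrite -subr_ge0; rewrite -subr_ge0 in h.
have := mulr_ge0 X0 h; congr (0 <= _).
move: (w1 `^ (p - 1)) (t `^ (p / 2)) (`|d| `^ p) Qn0 => a1 a2 a3.
move: (q `^ (p - 1)) (`|1 - c| `^ p) (`|c - q| `^ p) (`|c| `^ p) => b1 b2 b3 b4 bn0.
by field; rewrite qn0 bn0.
Qed.

End ground_state_constant.

(** * Lebesgue measure on tuples as an iterated product *)

Section product_sigma_finite.
Context d1 d2 (T1 : measurableType d1) (T2 : measurableType d2) (R : realType).
Variables (m1 : {sigma_finite_measure set T1 -> \bar R})
  (m2 : {sigma_finite_measure set T2 -> \bar R}).
Local Open Scope ereal_scope.

Lemma sigma_finite_product : sigma_finite setT (m1 \x m2).
Proof.
have /sigma_finiteP[F [FT ndF Foo]] := sigma_finiteT m1.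
have /sigma_finiteP[G [GT ndG Goo]] := sigma_finiteT m2.
exists (fun k => F k `*` G k).
  apply/seteqP; split=> // -[x y] _.
  have [i _ Fx] : (\bigcup_i F i) x by rewrite -FT.
  have [j _ Gy] : (\bigcup_i G i) y by rewrite -GT.
  exists (maxn i j) => //; split => /=.
    by have /subsetPset := ndF _ _ (leq_maxl i j); apply.
  by have /subsetPset := ndG _ _ (leq_maxr i j); apply.
move=> k; have [mF Fk] := Foo k; have [mG Gk] := Goo k.
split; first exact: measurableX.
by rewrite product_measure1E// lte_mul_pinfty// ge0_fin_numE.
Qed.

End product_sigma_finite.

Section lebN.
Context {R : realType}.
Local Open Scope ereal_scope.
Implicit Types n : nat.

Definition consp n (z : R * n.-tuple R) : n.+1.-tuple R := cons_tuple z.1 z.2.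
Definition unconsp n (t : n.+1.-tuple R) : R * n.-tuple R :=
  (thead t, behead_tuple t).

Lemma consp_can n : cancel (@consp n) (@unconsp n).
Proof.
by move=> [x t]; rewrite /unconsp /consp /=; congr pair; apply: val_inj.
Qed.

Lemma measurable_consp n : measurable_fun setT (@consp n).
Proof.
exact: (@measurable_cons _ _ _ _ fst n snd measurable_fst measurable_snd).
Qed.

Lemma measurable_unconsp n : measurable_fun setT (@unconsp n).
Proof.
apply/measurable_fun_pairP; split.
  exact: (measurable_tnth ord0).
exact: measurable_behead.
Qed.

Section step.
Variables (n : nat) (m : {sigma_finite_measure set (n.-tuple R) -> \bar R}).

Definition pushcons : set (n.+1.-tuple R) -> \bar R :=
  pushforward (@lebesgue_measure R \x m) (@consp n).

HB.instance Definition _ := Measure.copy pushcons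
  (measure_function_pushforward__canonical__measure_function_Measure
     (@lebesgue_measure R \x m) (@measurable_consp n)).

Lemma sigma_finite_pushcons : sigma_finite setT pushcons.
Proof.
have [F FT Foo] := sigma_finite_product (@lebesgue_measure R) m.
exists (fun k => (@unconsp n) @^-1` (F k)).
  by rewrite -preimage_bigcup -FT preimage_setT.
move=> k; have [mF Fk] := Foo k; split.
  by rewrite -[X in measurable X]setTI; exact: measurable_unconsp.
rewrite /pushcons /pushforward -comp_preimage.
rewrite (_ : _ \o _ = id) ?preimage_id//.
by apply/funext => z /=; exact: consp_can.
Qed.

HB.instance Definition _ := Measure_isSigmaFinite.Build _ _ _ pushcons
  sigma_finite_pushcons.

End step.

(** Lebesgue measure on [R^n] as one sigma-finite measure, so that the iterated integrals [iint] can
    be exchanged by Tonelli; the zero-dimensional case is the Dirac mass at the empty tuple. *)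
Fixpoint lebN n : {sigma_finite_measure set (n.-tuple R) -> \bar R} :=
  match n with
  | 0 => dirac [tuple]
  | n'.+1 => pushcons (lebN n')
  end.

Lemma integral_lebNS n (f : n.+1.-tuple R -> \bar R) :
  measurable_fun setT f -> (forall t, 0 <= f t) ->
  \int[lebN n.+1]_t f t =
  \int[@lebesgue_measure R]_x \int[lebN n]_t f (cons_tuple x t).
Proof.
move=> mf f0 /=; rewrite ge0_integral_pushforward//=; last exact: measurable_consp.
rewrite preimage_setT fubini_tonelli1//.
by apply: measurableT_comp => //; exact: measurable_consp.
Qed.

Lemma iintE n (f : n.-tuple R -> \bar R) :
  measurable_fun setT f -> (forall t, 0 <= f t) ->
  iint f = \int[lebN n]_t f t.
Proof.
elim: n f => [|n ih] f mf f0.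
  by rewrite /= integral_dirac// diracT mul1e.
rewrite integral_lebNS//=; apply: eq_integral => x _; rewrite ih//.
apply: (measurableT_comp mf).
exact: measurable_cons.
Qed.

End lebN.

Section measurable_sets.
Context d (T : measurableType d) (R : realType).
Implicit Types f g : T -> R.

Lemma measurable_set_bool (b : T -> bool) :
  measurable_fun setT b -> measurable [set x | b x].
Proof.
move=> mb; rewrite -[X in measurable X]setTI.
by rewrite (_ : [set x | b x] = b @^-1` [set true])//; exact: mb.
Qed.

Lemma measurable_set_ltr f g : measurable_fun setT f -> measurable_fun setT g ->
  measurable [set x | f x < g x].
Proof. by move=> mf mg; exact/measurable_set_bool/measurable_fun_ltr. Qed.

End measurable_sets.

Lemma ge0_integral_mrestr d (T : measurableType d) (R : realType)
    (m : {measure set T -> \bar R}) (D : set T) (mD : measurable D)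
    (f : T -> \bar R) :
  measurable_fun setT f -> (forall x, 0 <= f x)%E ->
  (\int[mrestr m mD]_x f x = \int[m]_(x in D) f x)%E.
Proof.
move=> mf f0; have m0 : mrestr m mD (~` D) = 0%E by rewrite /mrestr setICl measure0.
rewrite (ge0_negligible_integral (measurableC mD) measurableT mf (fun z _ => f0 z) m0).
rewrite setTD setCK; apply: eq_measure_integral => A mA AD.
by rewrite /= /mrestr setIidl.
Qed.

(** Writing [1/x] as [(x^2)^(-1) * x] reduces the inverse to a real power of a nonnegative base; at
    [x = 0] both expressions are [0]. *)
Lemma measurable_invr {R : realType} : measurable_fun setT (@GRing.inv R).
Proof.
rewrite (_ : @GRing.inv R = fun x : R => (x ^+ 2) `^ (- 1) * x).
  apply: measurable_funM => //; apply: (measurableT_comp (measurable_powR _)).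
  exact: measurable_funX.
apply/funext => x; have [->|x0] := eqVneq x 0; first by rewrite invr0 mulr0.
by rewrite powR_inv1 ?sqr_ge0//; field.
Qed.

(** * One-dimensional changes of variables for nonnegative integrands *)

Section change_of_variables.
Context {R : realType}.
Local Open Scope ereal_scope.
Local Notation mu := (@lebesgue_measure R).
Implicit Types f g : R -> \bar R.

(** The image of Lebesgue measure under a translation gives half-open intervals their length, and
    this determines the measure. Dilations are treated in the same way after rescaling the image
    measure. *)
Lemma ge0_integral_shift f (a : R) :
  measurable_fun setT f -> (forall x, 0 <= f x) ->
  \int[mu]_x f (x + a)%R = \int[mu]_x f x.
Proof.
move=> mf f0; pose phi (x : measurableTypeR R) : measurableTypeR R := (x + a)%R.
have mphi : measurable_fun setT phi.
  exact: measurable_funD.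
rewrite -(@ge0_integral_pushforward _ _ _ _ _ phi mphi mu setT f)//.
apply: eq_measure_integral => A mA _.
apply/esym; pose m := measure_function_pushforward__canonical__measure_function_Measure mu mphi.
apply: (@lebesgue_measure_unique _ m) => //= _ [[b c]] _ <-.
rewrite /pushforward (_ : phi @^-1` _ = `](b - a)%R, (c - a)%R]%classic).
  rewrite !lebesgue_measure_itv/= !lte_fin ltrD2r; case: ifP => // _.
  by rewrite -!EFinB; congr EFin; ring.
by apply/seteqP; split=> x /=; rewrite /phi !in_itv/= ltrBlDr lerBrDr.
Qed.

Lemma ge0_integral_scale_pos f (c : R) : (0 < c)%R ->
  measurable_fun setT f -> (forall x, 0 <= f x) ->
  c%:E * \int[mu]_x f (c * x)%R = \int[mu]_x f x.
Proof.
move=> c0 mf f0; pose phi (x : measurableTypeR R) : measurableTypeR R := (c * x)%R.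
have mphi : measurable_fun setT phi.
  exact: measurable_funM.
rewrite -(@ge0_integral_pushforward _ _ _ _ _ phi mphi mu setT f)//.
pose m := measure_function_pushforward__canonical__measure_function_Measure mu mphi.
pose k : {nonneg R} := NngNum (ltW c0).
rewrite -(@ge0_integral_mscale _ _ _ m setT measurableT k f)//.
apply: eq_measure_integral => A mA _.
apply/esym; apply: (@lebesgue_measure_unique _ (mscale k m)) => //= _ [[a b]] _ <-.
rewrite /mscale /= /pushforward (_ : phi @^-1` _ = `](a / c)%R, (b / c)%R]%classic).
  rewrite !lebesgue_measure_itv/= !lte_fin ltr_pM2r ?invr_gt0//.
  case: ifP => [_|]; last by rewrite mule0.
  by rewrite -!EFinB -EFinM; congr EFin; field; rewrite gt_eqF.
by apply/seteqP; split=> x /=; rewrite /phi !in_itv/= ltr_pdivrMr// ler_pdivlMr// ![(x * c)%R]mulrC.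
Qed.

Lemma ge0_integral_opp f :
  measurable_fun setT f -> (forall x, 0 <= f x) ->
  \int[mu]_x f (- x)%R = \int[mu]_x f x.
Proof.
move=> mf f0; pose phi (x : measurableTypeR R) : measurableTypeR R := (- x)%R.
have mphi : measurable_fun setT phi.
  exact: measurableT_comp.
rewrite -(@ge0_integral_pushforward _ _ _ _ _ phi mphi mu setT f)//.
by apply: eq_measure_integral => A mA _; exact: lebesgue_measureN.
Qed.

Lemma ge0_integral_scale f (c : R) : c != 0%R ->
  measurable_fun setT f -> (forall x, 0 <= f x) ->
  `|c|%:E * \int[mu]_x f (c * x)%R = \int[mu]_x f x.
Proof.
move=> c0 mf f0; have [cp|cn] := leP 0%R c.
  by rewrite ger0_norm// ge0_integral_scale_pos// lt_neqAle eq_sym c0.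
rewrite ltr0_norm// -[RHS]ge0_integral_opp//.
rewrite -(@ge0_integral_scale_pos (fun x => f (- x)%R) (- c)%R)//.
- by congr (_ * _); apply: eq_integral => x _; rewrite mulNr opprK.
- by rewrite oppr_gt0.
- exact: (measurableT_comp mf).
Qed.

Lemma ge0_integral_affine f (c a : R) : c != 0%R ->
  measurable_fun setT f -> (forall x, 0 <= f x) ->
  `|c|%:E * \int[mu]_x f (c * x + a)%R = \int[mu]_x f x.
Proof.
move=> c0 mf f0; rewrite -[RHS](ge0_integral_shift a)//.
rewrite -(@ge0_integral_scale (fun x => f (x + a)%R) c)//.
by apply: (measurableT_comp mf); exact: measurable_funD.
Qed.

(* Lebesgue measure is the image under [ln] of the area below the graph of
   [x |-> 1 / x] on the positive half-line. *)
Let hyp_region : set (R * R) := [set z | (0 < z.1)%R /\ (0 < z.2 < z.1^-1)%R].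

Let hyp_regionE : hyp_region = [set z | (0 < z.1)%R] `&`
  ([set z | (0 < z.2)%R] `&` [set z | (z.1 * z.2 < 1)%R]).
Proof.
apply/seteqP; split=> -[x y] /=.
  move=> [/= x0] /andP[y0 yx]; split => //; split => //.
  by rewrite -ltr_pdivlMl// mulr1.
move=> [/= x0 [y0 yx]]; split => //=; rewrite y0/=.
by rewrite -div1r ltr_pdivlMr// mulrC.
Qed.

Let measurable_hyp_region :
  measurable (hyp_region : set (measurableTypeR R * measurableTypeR R)).
Proof.
have m1 : measurable_fun setT (fun z : R * R => z.1) by exact: measurable_fst.
have m2 : measurable_fun setT (fun z : R * R => z.2) by exact: measurable_snd.
have m0 r : measurable_fun setT (fun z : R * R => r : R) by exact: measurable_cst.
rewrite hyp_regionE; apply: measurableI; last apply: measurableI.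
- exact: measurable_set_ltr.
- exact: measurable_set_ltr.
- by apply: measurable_set_ltr => //; exact: measurable_funM.
Qed.

Let integral_hyp_section g (x : R) :
  \int[mu]_y ((fun z => g z.1) \_ hyp_region) (x, y) =
  ((fun x => (x^-1)%:E * g x) \_ `]0%R, +oo[) x.
Proof.
rewrite patchE mem_setE in_itv/= andbT; case: ifPn => x0.
  transitivity (\int[mu]_(y in `]0%R, (x^-1)%R[) (cst (g x) y)).
    rewrite [RHS]integral_mkcond; apply: eq_integral => y _ /=.
    rewrite !patchE mem_setE in_itv/=; congr (if _ then _ else _).
    by apply/idP/idP => [/set_mem[]//|?]; apply/mem_set; split.
  rewrite integral_cst//= lebesgue_measure_itv/= lte_fin invr_gt0 x0.
  by rewrite oppr0 adde0 muleC.
rewrite integral0_eq// => y _; rewrite patchE ifF//; apply/negbTE/negP.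
by move=> /set_mem[/=]; rewrite (negbTE x0).
Qed.

Let integral_hyp_region g : measurable_fun setT g -> (forall x, 0 <= g x) ->
  \int[mu \x mu]_(z in hyp_region) g z.1 =
  \int[mu]_(x in `]0%R, +oo[) ((x^-1)%:E * g x).
Proof.
move=> mg g0; rewrite integral_mkcond fubini_tonelli1//; last 2 first.
- apply/(measurable_restrictT _ measurable_hyp_region)/measurable_funTS.
  exact: measurableT_comp.
- by move=> z; rewrite erestrict_ge0.
rewrite [RHS]integral_mkcond; apply: eq_integral => x _.
exact: integral_hyp_section.
Qed.

Lemma integral_inv_itv (a b : R) : (0 < a < b)%R ->
  \int[mu]_(x in `[a, b]) (x^-1)%:E = (ln b - ln a)%:E.
Proof.
move=> /andP[a0 ab].
have dln (x : R) : (0 < x)%R -> is_derive x (1%R : R) (@ln R) (x^-1)%R by exact: is_derive1_ln.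
rewrite (@continuous_FTC2 _ _ (@ln R))//.
- apply: continuous_in_subspaceT => x /[1!inE]/= /[1!in_itv]/= /andP[ax _].
  by apply: inv_continuous; rewrite gt_eqF// (lt_le_trans a0).
- split.
  + by move=> x /[1!in_itv]/= /andP[ax _]; have /@ex_derive := dln x (lt_trans a0 ax).
  + by apply/cvg_at_right_filter/continuous_ln.
  + by apply/cvg_at_left_filter/continuous_ln; rewrite (lt_trans a0).
- move=> x /[1!in_itv]/= /andP[ax _].
  by rewrite derive1E; have /@derive_val := dln x (lt_trans a0 ax).
Qed.

(** Under [ln] of the first coordinate, the region below [1/x] gives []a, b]] the mass of [1/x]
    between [expR a] and [expR b], which is [b - a]; uniqueness of Lebesgue measure identifies the
    image. *)
Lemma ge0_integral_ln g : measurable_fun setT g -> (forall x, 0 <= g x) ->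
  \int[mu]_(x in `]0%R, +oo[) ((x^-1)%:E * g (ln x)) = \int[mu]_z g z.
Proof.
move=> mg g0.
pose phi (z : measurableTypeR R * measurableTypeR R) : measurableTypeR R := ln z.1.
have mphi : measurable_fun setT phi.
  by apply: measurableT_comp => //; exact: measurable_ln.
pose M := mrestr (mu \x mu) measurable_hyp_region.
pose m := measure_function_pushforward__canonical__measure_function_Measure M mphi.
rewrite -(@integral_hyp_region (fun x => g (ln x)))//; last first.
  by apply: (measurableT_comp mg); exact: measurable_ln.
transitivity (\int[m]_z g z); last first.
  apply: eq_measure_integral => A mA _; apply/esym.
  apply: (@lebesgue_measure_unique _ m) => //= _ [[a b]] _ <-.
  have -> : m `]a, b]%classic = \int[mu]_(x in `]0%R, +oo[)
      ((x^-1)%:E * (\1_((@ln R) @^-1` `]a, b]) x)%:E).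
    rewrite -integral_hyp_region//; last first.
      apply/measurable_EFinP/measurable_indic.
      by rewrite -[X in measurable X]setTI; exact: measurable_ln.
    rewrite (_ : \int[_]_(z in _) _ = \int[mu \x mu]_(z in hyp_region)
      (\1_(phi @^-1` `]a, b]) z)%:E)//.
    rewrite integral_indic//.
    by rewrite -[X in measurable X]setTI; exact: (mphi).
  rewrite lebesgue_measure_itv/= lte_fin integral_mkcond.
  rewrite (_ : _ \_ _ = (fun x : R => (x^-1)%:E) \_ `]expR a, expR b]); last first.
    apply/funext => x; rewrite !patchE !mem_setE !in_itv/= andbT.
    have [x0|x0] := ltP 0%R x; last first.
      by rewrite ifF//; apply/negbTE; rewrite negb_and -leNgt (le_trans x0)// expR_ge0.
    rewrite indicE (_ : (x \in _) = (a < ln x <= b)%R); last first.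
      by apply/idP/idP => [/set_mem|h]; [|apply/mem_set]; rewrite /= in_itv.
    rewrite (_ : (expR a < x <= expR b)%R = (a < ln x <= b)%R); last first.
      by rewrite -[(a < _)%R]ltr_expR -[(_ <= b)%R]ler_expR lnK.
    by case: ifP => _; rewrite ?mule1 ?mule0.
  rewrite -integral_mkcond; case: ifPn => [ab|]; last first.
    rewrite -leNgt => ba; rewrite set_itv_ge ?integral_set0// bnd_simp -leNgt.
    by rewrite ler_expR.
  rewrite integral_itv_obnd_cbnd; last first.
    apply/measurable_EFinP/measurable_funTS; exact: measurable_invr.
  by rewrite integral_inv_itv ?expRK ?EFinB// expR_gt0 ltr_expR.
transitivity (\int[M]_z g (phi z)); last first.
  apply/esym; have := @ge0_integral_pushforward _ _ _ _ _ phi mphi M setT g.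
  by rewrite preimage_setT; apply.
apply/esym/ge0_integral_mrestr => [|z]; last exact: g0.
exact: (measurableT_comp mg mphi).
Qed.

(** In the logarithmic variable, squaring becomes the dilation by two and inversion becomes the
    reflection; the substitutions [x^2] and [1/x] below reduce to these linear ones. *)
Lemma ge0_integral_expR f : measurable_fun setT f ->
    (forall x, (0 < x)%R -> 0 <= f x) ->
  \int[mu]_(x in `]0%R, +oo[) f x = \int[mu]_z ((expR z)%:E * f (expR z)).
Proof.
move=> mf f0; rewrite -ge0_integral_ln; last 2 first.
- apply: emeasurable_funM; first exact/measurable_EFinP.
  exact: measurableT_comp.
- by move=> z; rewrite mule_ge0// ?lee_fin ?expR_ge0// f0// expR_gt0.
apply: eq_integral => x; rewrite inE/= in_itv/= andbT => x0.
by rewrite lnK// muleA -EFinM mulVf ?mul1e// gt_eqF.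
Qed.

Lemma ge0_integral_sqr f : measurable_fun setT f ->
    (forall x, (0 < x)%R -> 0 <= f x) ->
  \int[mu]_(x in `]0%R, +oo[) f x =
  \int[mu]_(x in `]0%R, +oo[) ((2 * x)%:E * f (x ^+ 2)%R).
Proof.
move=> mf f0; rewrite !ge0_integral_expR//; last 2 first.
- apply: emeasurable_funM; first exact/measurable_EFinP/measurable_funM.
  by apply: measurableT_comp => //; exact: measurable_funX.
- by move=> x x0; rewrite mule_ge0 ?lee_fin ?f0 ?exprn_gt0// mulr_ge0// ltW.
have mg : measurable_fun setT (fun z : R => (expR z)%:E * f (expR z)).
  by apply: emeasurable_funM; [exact/measurable_EFinP|exact: measurableT_comp].
have g0 z : 0 <= (expR z)%:E * f (expR z).
  by rewrite mule_ge0// ?lee_fin ?expR_ge0// f0// expR_gt0.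
rewrite -(@ge0_integral_scale_pos _ 2)// -ge0_integralZl//; first last.
  by apply: (measurableT_comp mg); exact: measurable_funM.
apply: eq_integral => z _; rewrite !muleA -!EFinM; congr (EFin _ * f _).
  by rewrite mulrCA -expRD; congr (_ * expR _)%R; ring.
by rewrite expr2 -expRD; congr expR; ring.
Qed.

Lemma ge0_integral_inv f : measurable_fun setT f ->
    (forall x, (0 < x)%R -> 0 <= f x) ->
  \int[mu]_(x in `]0%R, +oo[) f x =
  \int[mu]_(x in `]0%R, +oo[) ((x ^- 2)%:E * f (x^-1)%R).
Proof.
move=> mf f0; rewrite !ge0_integral_expR//; last 2 first.
- apply: emeasurable_funM; last exact: (measurableT_comp mf measurable_invr).
  apply/measurable_EFinP/(measurableT_comp measurable_invr).
  exact: measurable_funX.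
- by move=> x x0; rewrite mule_ge0 ?lee_fin ?f0 ?invr_gt0// invr_ge0 exprn_ge0// ltW.
have mg : measurable_fun setT (fun z : R => (expR z)%:E * f (expR z)).
  by apply: emeasurable_funM; [exact/measurable_EFinP|exact: measurableT_comp].
have g0 z : 0 <= (expR z)%:E * f (expR z).
  by rewrite mule_ge0// ?lee_fin ?expR_ge0// f0// expR_gt0.
rewrite -ge0_integral_opp//.
apply: eq_integral => z _; rewrite !muleA -!EFinM; congr (EFin _ * f _).
  by rewrite expRN; field; rewrite expR_eq0.
exact: expRN.
Qed.

End change_of_variables.

(** * Measurability and Tonelli in the forms used below *)

Section measurable_tools.
Context d (T : measurableType d) (R : realType).
Local Open Scope ereal_scope.

Lemma measurable_boolR (b : T -> bool) : measurable_fun setT b ->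
  measurable_fun setT (fun x => (b x)%:R : R).
Proof.
move=> mb; rewrite (_ : (fun _ => _) = \1_[set x | b x]).
  exact/measurable_indic/measurable_set_bool.
by apply/funext => x; rewrite indicE mem_setE.
Qed.

Lemma measurable_sqrtT (f : T -> R) : measurable_fun setT f ->
  measurable_fun setT (fun x => Num.sqrt (f x)).
Proof.
move=> mf; apply: (measurableT_comp _ mf).
by apply: continuous_measurable_fun; exact: sqrt_continuous.
Qed.

Lemma measurable_powRT (p : R) (f : T -> R) : measurable_fun setT f ->
  measurable_fun setT (fun x => (f x `^ p)%R).
Proof. by move=> mf; apply: (measurableT_comp (measurable_powR p)). Qed.

Lemma integral_boolR (m : {measure set T -> \bar R}) (D : set T) (b : T -> bool)
    (f : T -> \bar R) : D = [set x | b x] ->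
  \int[m]_(x in D) f x = \int[m]_x ((b x)%:R%:E * f x).
Proof.
move=> ->; rewrite integral_mkcond; apply: eq_integral => x _.
by rewrite patchE mem_setE (_ : (x \in b) = b x)//; case: (b x); rewrite /= ?mul1e ?mul0e.
Qed.

End measurable_tools.

Section tonelli.
Context d1 d2 (T1 : measurableType d1) (T2 : measurableType d2) (R : realType).
Variables (m1 : {sigma_finite_measure set T1 -> \bar R})
  (m2 : {sigma_finite_measure set T2 -> \bar R}).
Variable f : T1 -> T2 -> \bar R.
Local Open Scope ereal_scope.
Hypothesis mf : measurable_fun setT (fun z => f z.1 z.2).
Hypothesis f0 : forall x y, 0 <= f x y.

Lemma exchange_integral :
  \int[m1]_x \int[m2]_y f x y = \int[m2]_y \int[m1]_x f x y.
Proof. exact: (@fubini_tonelli _ _ _ _ _ m1 m2 (fun z => f z.1 z.2)). Qed.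

Lemma measurable_integral1 : measurable_fun setT (fun x => \int[m2]_y f x y).
Proof.
exact: (@measurable_fun_fubini_tonelli_F _ _ _ _ _ m2 (fun z => f z.1 z.2)).
Qed.

End tonelli.

Lemma measurable_fun_app d1 d2 d3 d4 (T1 : measurableType d1)
    (T2 : measurableType d2) (T3 : measurableType d3) (T : measurableType d4)
    (f : T1 -> T2 -> T3) (g : T -> T1) (h : T -> T2) :
  measurable_fun setT (fun z => f z.1 z.2) -> measurable_fun setT g ->
  measurable_fun setT h -> measurable_fun setT (fun z => f (g z) (h z)).
Proof.
move=> mf mg mh.
by apply: (measurableT_comp mf (g := fun z => (g z, h z))); exact/measurable_fun_pair.
Qed.

Ltac meas1 := cbv beta; match goal with
  | H : ?P |- ?P => exact: H
  | |- measurable_fun _ fst => exact: measurable_fst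
  | |- measurable_fun _ snd => exact: measurable_snd
  | |- measurable_fun _ (fun z => z) => exact: measurable_id
  | |- measurable_fun _ (fun z => ?c) => exact: measurable_cst
  | |- measurable_fun _ (fun z => tnth _ _) => apply: (measurableT_comp (measurable_tnth _))
  | |- measurable_fun _ (fun z => (@?f z, @?g z)) => apply: (measurable_fun_pair (f := f) (g := g))
  | |- measurable_fun _ (fun z => (@?f z).1) => apply: (measurableT_comp measurable_fst (g := f))
  | |- measurable_fun _ (fun z => (@?f z).2) => apply: (measurableT_comp measurable_snd (g := f))
  | |- measurable_fun _ (fun z => EFin (@?f z)) => apply/measurable_EFinP
  | |- measurable_fun _ (fun z => (@?f z + @?g z)%R) => apply: (measurable_funD (f := f) (g := g))
  | |- measurable_fun _ (fun z => (- @?f z)%R) => apply: (measurable_funN (f := f))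
  | |- measurable_fun _ (fun z => (@?f z * @?g z)%R) => apply: (measurable_funM (f := f) (g := g))
  | |- measurable_fun _ (fun z => (@?f z ^+ _)%R) => apply: (measurable_funX _ (f := f))
  | |- measurable_fun _ (fun z => ((@?f z)^-1)%R) => apply: (measurableT_comp measurable_invr (g := f))
  | |- measurable_fun _ (fun z => (`| @?f z |)%R) => apply: (measurableT_comp (@normr_measurable _ setT) (g := f))
  | |- measurable_fun _ (fun z => powR (@?f z) _) => apply: (measurable_powRT _ (f := f))
  | |- measurable_fun _ (fun z => expR (@?f z)) => apply: (measurableT_comp (@measurable_expR _) (g := f))
  | |- measurable_fun _ (fun z => Num.sqrt (@?f z)) => apply: (measurable_sqrtT (f := f))
  | |- measurable_fun _ (fun z => (@?f z + @?g z)%E) => apply: (emeasurable_funD (f := f) (g := g))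
  | |- measurable_fun _ (fun z => (@?f z * @?g z)%E) => apply: (emeasurable_funM (f := f) (g := g))
  | |- measurable_fun _ (fun z => (nat_of_bool (@?b z))%:R) => apply: (measurable_boolR (b := b))
  | |- measurable_fun _ (fun z => (@?f z < @?g z)%R) => apply: (measurable_fun_ltr (f := f) (g := g))
  | |- measurable_fun _ (fun z => (@?f z <= @?g z)%R) => apply: (measurable_fun_ler (f := f) (g := g))
  | |- measurable_fun _ (fun z => (@?f z && @?g z)) => apply: (measurable_and (f := f) (g := g))
  | H : measurable_fun _ ?f |- measurable_fun _ (fun z => ?f (@?g z)) => apply: (measurableT_comp H (g := g))
  | H : measurable_fun _ (fun z => ?f z.1 z.2) |- measurable_fun _ (fun z => ?f (@?g z) (@?h z)) => apply: (measurable_fun_app (f := f) (g := g) (h := h))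
  end.
Ltac meas := repeat meas1.

(** * Rotations and polar coordinates *)

Section rotation.
Context {R : realType}.
Local Open Scope ereal_scope.
Local Notation mu := (@lebesgue_measure R).

Lemma measurable_integral_mu d (T : measurableType d) (f : T -> R -> \bar R) :
  measurable_fun setT (fun z : T * R => f z.1 z.2) -> (forall x y, 0 <= f x y) ->
  measurable_fun setT (fun x => \int[mu]_y f x y).
Proof. by move=> mf f0; exact: measurable_integral1. Qed.

Lemma exchange_integral_mu (f : R -> R -> \bar R) :
  measurable_fun setT (fun z : R * R => f z.1 z.2) -> (forall x y, 0 <= f x y) ->
  \int[mu]_x \int[mu]_y f x y = \int[mu]_y \int[mu]_x f x y.
Proof. by move=> mf f0; exact: exchange_integral. Qed.

(** For [c != 0], substitute [z = c x + s y] at fixed [y]: the second argument becomes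
    [y/c - s z/c], and the substitution in [y] undoes the Jacobian. For [c = 0] the map is an
    exchange of the variables with reflections. *)
Lemma ge0_integral_rot (G : R -> R -> \bar R) (c s : R) :
  measurable_fun setT (fun z : R * R => G z.1 z.2) -> (forall x y, 0 <= G x y) ->
  (c ^+ 2 + s ^+ 2 = 1)%R ->
  \int[mu]_x \int[mu]_y G (c * x + s * y)%R (c * y - s * x)%R =
  \int[mu]_x \int[mu]_y G x y.
Proof.
move=> mG G0 cs1; have [c0|c0] := eqVneq c 0%R.
  have s2 : (`|s| = 1)%R.
    by apply/eqP; rewrite -sqrp_eq1// -normrX; move: cs1; rewrite c0 expr0n/= add0r => ->; rewrite normr1.
  have s0 : s != 0%R by rewrite -normr_eq0 s2 oner_eq0.
  transitivity (\int[mu]_x \int[mu]_y G y (- (s * x))%R).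
    apply: eq_integral => x _.
    rewrite -[RHS](@ge0_integral_scale _ (fun y => G y (- (s * x))%R) s)//; last by meas.
    rewrite s2 mul1e; apply: eq_integral => y _.
    by rewrite c0 !mul0r add0r sub0r.
  rewrite (@exchange_integral_mu (fun x y => G y (- (s * x))%R))//; last by meas.
  apply: eq_integral => y _.
  rewrite -[RHS](@ge0_integral_scale _ (fun x => G y x) (- s)%R) ?oppr_eq0//; last by meas.
  by rewrite normrN s2 mul1e; apply: eq_integral => x _; rewrite mulNr.
rewrite (@exchange_integral_mu (fun x y => G (c * x + s * y) (c * y - s * x))%R)//; last by meas.
have cn0 : `|c|%R != 0%R by rewrite normr_eq0.
transitivity (\int[mu]_y \int[mu]_z (`|c|^-1%:E * G z (c^-1 * y + - (s * z / c))%R)).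
  apply: eq_integral => y _.
  rewrite ge0_integralZl//; last by meas.
  rewrite -(@ge0_integral_affine _ (fun z => G z (c^-1 * y + - (s * z / c))%R) c (s * y))//; last by meas.
  rewrite muleA -EFinM mulVf// mul1e; apply: eq_integral => x _; congr G.
  have -> : (c * y = c^-1 * (c ^+ 2 * y))%R by field.
  rewrite (_ : c ^+ 2 = 1 - s ^+ 2)%R; last by rewrite -cs1; ring.
  by field.
rewrite exchange_integral_mu//; last 2 first.
- by meas.
- by move=> x y; rewrite mule_ge0// lee_fin invr_ge0.
apply: eq_integral => z _.
rewrite ge0_integralZl//; last by meas.
rewrite -normfV (@ge0_integral_affine _ (fun w => G z w)) ?invr_eq0//; by meas.
Qed.

Lemma ge0_integral_rot_dot (F : R -> R -> \bar R) (a b : R) :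
  measurable_fun setT (fun z : R * R => F z.1 z.2) -> (forall x y, 0 <= F x y) ->
  \int[mu]_x \int[mu]_y F (x ^+ 2 + y ^+ 2)%R (a * x + b * y)%R =
  \int[mu]_x \int[mu]_y F (x ^+ 2 + y ^+ 2)%R (Num.sqrt (a ^+ 2 + b ^+ 2) * x)%R.
Proof.
move=> mF F0; set r := Num.sqrt _.
have ab0 : (0 <= a ^+ 2 + b ^+ 2)%R by rewrite addr_ge0// sqr_ge0.
have r2 : (r ^+ 2 = a ^+ 2 + b ^+ 2)%R by rewrite sqr_sqrtr.
have [r0|r0] := eqVneq r 0%R.
  have /eqP : (a ^+ 2 + b ^+ 2 = 0)%R by rewrite -r2 r0 expr0n.
  rewrite paddr_eq0 ?sqr_ge0// !sqrf_eq0 => /andP[/eqP -> /eqP ->].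
  by apply: eq_integral => x _; apply: eq_integral => y _; rewrite r0 !mul0r addr0.
rewrite -[RHS](@ge0_integral_rot (fun u v => F (u ^+ 2 + v ^+ 2)%R (r * u)%R) (a / r) (b / r))//.
- apply: eq_integral => x _; apply: eq_integral => y _; congr F; last by field.
  transitivity ((a ^+ 2 + b ^+ 2) / r ^+ 2 * (x ^+ 2 + y ^+ 2))%R; last by field.
  by rewrite r2 divff ?mul1r// -r2 sqrf_eq0.
- by meas.
- transitivity ((a ^+ 2 + b ^+ 2) / r ^+ 2)%R; first by field.
  by rewrite r2 divff// -r2 sqrf_eq0.
Qed.

End rotation.

Section lebN_rotation.
Context {R : realType}.
Local Open Scope ereal_scope.
Local Notation mu := (@lebesgue_measure R).
Implicit Types n : nat.

Definition sqnorm n (t : n.-tuple R) : R := (\sum_(i < n) tnth t i ^+ 2)%R.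
Definition dotp n (a t : n.-tuple R) : R := (\sum_(i < n) tnth a i * tnth t i)%R.

Lemma sqnorm_cons n x (t : n.-tuple R) :
  sqnorm (cons_tuple x t) = (x ^+ 2 + sqnorm t)%R.
Proof.
rewrite /sqnorm big_ord_recl tnth0; congr +%R.
by apply: eq_bigr => i _; rewrite tnthS.
Qed.

Lemma dotp_cons n a x (s t : n.-tuple R) :
  dotp (cons_tuple a s) (cons_tuple x t) = (a * x + dotp s t)%R.
Proof.
rewrite /dotp big_ord_recl !tnth0; congr +%R.
by apply: eq_bigr => i _; rewrite !tnthS.
Qed.

Lemma sqnorm0 (t : 0.-tuple R) : sqnorm t = 0%R.
Proof. by rewrite /sqnorm big_ord0. Qed.

Lemma dotp0 (s t : 0.-tuple R) : dotp s t = 0%R.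
Proof. by rewrite /dotp big_ord0. Qed.

Lemma sqnorm_ge0 n (t : n.-tuple R) : (0 <= sqnorm t)%R.
Proof. by apply: sumr_ge0 => i _; exact: sqr_ge0. Qed.

Lemma measurable_sqnorm n : measurable_fun setT (@sqnorm n).
Proof.
apply: measurable_sum => i; apply: measurable_funX; exact: measurable_tnth.
Qed.

Lemma measurable_dotp n (a : n.-tuple R) : measurable_fun setT (@dotp n a).
Proof.
by apply: measurable_sum => i; apply: measurable_funM => //; exact: measurable_tnth.
Qed.

Lemma measurable_thead n : measurable_fun setT (fun t : n.+1.-tuple R => thead t).
Proof. exact: (measurable_tnth ord0). Qed.

Lemma measurable_consT d (T : measurableType d) n (f : T -> R) (g : T -> n.-tuple R) :
  measurable_fun setT f -> measurable_fun setT g ->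
  measurable_fun setT (fun z => cons_tuple (f z) (g z)).
Proof. exact: measurable_cons. Qed.

Lemma tuple_consE n (t : n.+1.-tuple R) : exists x s, t = cons_tuple x s.
Proof. by exists (thead t), (behead_tuple t); rewrite [LHS]tuple_eta; exact: val_inj. Qed.

Lemma integral_lebNSS n (f : n.+2.-tuple R -> \bar R) :
  measurable_fun setT f -> (forall t, 0 <= f t) ->
  \int[lebN n.+2]_t f t =
  \int[mu]_x \int[mu]_y \int[lebN n]_t f (cons_tuple x (cons_tuple y t)).
Proof.
move=> mf f0; rewrite integral_lebNS//; apply: eq_integral => x _.
rewrite integral_lebNS//; apply: (measurableT_comp mf).
exact: measurable_consT.
Qed.

Lemma integral_lebN0 (f : 0.-tuple R -> \bar R) : \int[lebN 0]_t f t = f [tuple].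
Proof.
rewrite (_ : f = cst (f [tuple])); last by apply/funext => t; rewrite (tuple0 t).
by rewrite /= integral_dirac// diracT mul1e.
Qed.

Lemma integral_lebN1 (f : 1.-tuple R -> \bar R) :
  measurable_fun setT f -> (forall t, 0 <= f t) ->
  \int[lebN 1]_t f t = \int[mu]_x f (cons_tuple x [tuple]).
Proof.
move=> mf f0; rewrite integral_lebNS//; apply: eq_integral => x _.
exact: integral_lebN0.
Qed.

Lemma measurable_integral_lebN d (T : measurableType d) n
    (f : T -> n.-tuple R -> \bar R) :
  measurable_fun setT (fun z : T * n.-tuple R => f z.1 z.2) ->
  (forall x y, 0 <= f x y) ->
  measurable_fun setT (fun x => \int[lebN n]_y f x y).
Proof. by move=> mf f0; exact: measurable_integral1. Qed.

(** Induction on the dimension: the tail of [a] is first turned onto the first axis of the tail, and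
    a plane rotation in the two leading coordinates then merges it with the head of [a]. In
    dimension one only a sign has to be removed. *)
Lemma ge0_integral_lebN_rot n (f : R -> R -> \bar R) (a : n.+1.-tuple R) :
  measurable_fun setT (fun z : R * R => f z.1 z.2) -> (forall x y, 0 <= f x y) ->
  \int[lebN n.+1]_t f (sqnorm t) (dotp a t) =
  \int[lebN n.+1]_t f (sqnorm t) (Num.sqrt (sqnorm a) * thead t)%R.
Proof.
elim: n f a => [|n ih] f a mf f0.
  have [x [s ->]] := tuple_consE a.
  have ms := @measurable_sqnorm 1; have md := @measurable_dotp 1.
  have mt := @measurable_thead 0.
  rewrite !integral_lebN1//; [|by meas..].
  rewrite sqnorm_cons sqnorm0 addr0 sqrtr_sqr.
  transitivity (\int[mu]_y f (y ^+ 2)%R (x * y)%R).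
    apply: eq_integral => y _.
    by rewrite sqnorm_cons dotp_cons sqnorm0 dotp0 !addr0.
  transitivity (\int[mu]_y f (y ^+ 2)%R (`|x| * y)%R); last first.
    by apply: eq_integral => y _; rewrite sqnorm_cons sqnorm0 addr0.
  have [x0|x0] := leP 0%R x; first by rewrite ger0_norm.
  rewrite ltr0_norm// -(@ge0_integral_opp _ (fun y => f (y ^+ 2)%R (x * y)%R))//.
    by apply: eq_integral => y _; rewrite sqrrN mulrN mulNr.
  by meas.
have [x [s ->]] := tuple_consE a.
have ms := @measurable_sqnorm; have md := @measurable_dotp.
have mt := @measurable_thead n.+1.
have ms2 := ms n.+2; have md2 := md n.+2.
have ms1 := ms n.+1; have md1 := md n.+1; have ms0 := ms n.
have mt1 := @measurable_thead n.
pose F q w := \int[lebN n]_t f (q + sqnorm t)%R w.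
have mF : measurable_fun setT (fun z : R * R => F z.1 z.2).
  apply: (@measurable_integral_lebN _ _ _ (fun (z : R * R) t => f (z.1 + sqnorm t)%R z.2)) => //.
  by meas.
have F0 q w : 0 <= F q w by exact: integral_ge0.
transitivity (\int[mu]_y \int[mu]_z
    F (y ^+ 2 + z ^+ 2)%R (x * y + Num.sqrt (sqnorm s) * z)%R).
  rewrite integral_lebNS//; last by meas.
  apply: eq_integral => y _.
  transitivity (\int[lebN n.+1]_t f (y ^+ 2 + sqnorm t)%R (x * y + dotp s t)%R).
    by apply: eq_integral => t _; rewrite sqnorm_cons dotp_cons.
  rewrite (ih (fun q w => f (y ^+ 2 + q)%R (x * y + w)%R))//; last by meas.
  rewrite integral_lebNS//; last by meas.
  apply: eq_integral => z _; apply: eq_integral => t _.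
  by rewrite sqnorm_cons addrA.
rewrite ge0_integral_rot_dot// sqr_sqrtr ?sqnorm_ge0// -sqnorm_cons.
rewrite [RHS]integral_lebNSS; [|by meas|by []].
apply: eq_integral => y _; apply: eq_integral => z _; apply: eq_integral => t _.
by rewrite !sqnorm_cons addrA.
Qed.

Lemma ge0_integral_halves (f : R -> \bar R) : measurable_fun setT f ->
  (forall x, 0 <= f x) ->
  \int[mu]_x f x = \int[mu]_(x in `]0%R, +oo[) (f x + f (- x)%R).
Proof.
move=> mf f0; have mfN : measurable_fun setT (fun x : R => f (- x)%R) by meas.
rewrite ge0_integralD//; [|exact: measurable_funTS..].
rewrite [X in _ + X]integral_itv_obnd_cbnd; last exact: measurable_funTS.
rewrite ge0_integration_by_substitution0//.
under [X in _ + X]eq_integral do rewrite opprK.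
rewrite addeC -ge0_integral_setU//.
- by congr (integral _ _ _); rewrite -setCitvr setvU.
- exact: measurable_funTS.
- by apply/disj_setPS => x []/=; rewrite !in_itv/= andbT => /le_lt_trans/[apply]; rewrite ltxx.
Qed.

Lemma integral_mu_boolR (D : set R) (b : R -> bool) (f : R -> \bar R) :
  D = [set x | b x] -> \int[mu]_(x in D) f x = \int[mu]_x ((b x)%:R%:E * f x).
Proof. by move=> ->; exact: (@integral_boolR _ (measurableTypeR R) R mu _ b). Qed.

Lemma integral_pos_boolR (f : R -> \bar R) :
  \int[mu]_(x in `]0%R, +oo[) f x = \int[mu]_x ((0 < x)%R%:R%:E * f x).
Proof.
apply: integral_mu_boolR.
by apply/seteqP; split => q /=; rewrite in_itv/= andbT.
Qed.

Lemma measurable_integral_mu_in d (T : measurableType d) (D : set R)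
    (b : R -> bool) (f : T -> R -> \bar R) :
  D = [set x | b x] -> measurable_fun setT b ->
  measurable_fun setT (fun z : T * R => f z.1 z.2) -> (forall x y, 0 <= f x y) ->
  measurable_fun setT (fun x => \int[mu]_(y in D) f x y).
Proof.
move=> DE mb mf f0.
rewrite (_ : (fun _ => _) = fun x => \int[mu]_y ((b y)%:R%:E * f x y)).
  apply: (@measurable_integral_mu _ _ _ (fun x y => (b y)%:R%:E * f x y)); first by meas.
  by move=> x y; rewrite mule_ge0.
by apply/funext => x; rewrite (integral_mu_boolR _ DE).
Qed.

Lemma itvN11E : `](-1)%R, 1%R[%classic = [set t : R | (t ^+ 2 < 1)%R].
Proof.
apply/seteqP; split => t /=; rewrite in_itv/= -ltr_norml -[(t ^+ 2)%R]real_normK ?num_real//.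
  by move=> ?; rewrite expr_lt1.
by rewrite expr_lt1.
Qed.

(** On the logarithmic scale the exponent is a dilation, so the integral reduces to exponent one on
    []0, Q^a[], where the integrand is constant. The singularity at [0] for [a < 1] then needs no
    limit. *)
Lemma integral_powR_itv (a Q : R) : (0 < a)%R -> (0 < Q)%R ->
  \int[mu]_(q in `]0%R, Q[) (q `^ (a - 1))%:E = (Q `^ a / a)%:E.
Proof.
move=> a0 Q0.
have step (b P : R) : (0 < b)%R -> (0 < P)%R ->
    \int[mu]_(q in `]0%R, P[) (q `^ (b - 1))%:E =
    \int[mu]_z ((expR (b * z) < P `^ b)%R%:R%:E * (expR (b * z))%:E).
  move=> b0 P0.
  transitivity (\int[mu]_(q in `]0%R, +oo[) ((q < P)%R%:R%:E * (q `^ (b - 1))%:E)).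
    rewrite (@integral_mu_boolR _ (fun q => 0 < q < P)%R); last first.
      by apply/seteqP; split => q /=; rewrite in_itv.
    rewrite integral_pos_boolR.
    by apply: eq_integral => q _; rewrite [RHS]muleA; congr (_ * _); rewrite -EFinM -natrM mulnb.
  rewrite ge0_integral_expR; [|by meas|by move=> q q0; rewrite -EFinM lee_fin mulr_ge0// powR_ge0].
  apply: eq_integral => z _; rewrite muleCA -EFinM.
  have -> : (expR z * expR z `^ (b - 1) = expR (b * z))%R.
    by rewrite -expRM -expRD; congr expR; ring.
  rewrite (_ : (expR (b * z) < P `^ b)%R = (expR z < P)%R)// (mulrC b) expRM.
  have [h|h] := ltP (expR z) P.
    by apply/gt0_ltr_powR => //; rewrite nnegrE ?expR_ge0// ltW.
  by apply/negbTE; rewrite -leNgt ge0_ler_powR ?nnegrE ?expR_ge0// ltW.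
have Qa0 : (0 < Q `^ a)%R by rewrite powR_gt0.
rewrite step//; set I := (X in X = _).
suff aI : a%:E * I = (Q `^ a)%:E.
  by rewrite mulrC EFinM -aI muleA -EFinM mulVf ?mul1e// gt_eqF.
rewrite /I -{1}(gtr0_norm a0) (@ge0_integral_scale _
  (fun z => (expR z < Q `^ a)%R%:R%:E * (expR z)%:E)); last 3 first.
- by rewrite gt_eqF.
- by meas.
- by move=> z; rewrite -EFinM lee_fin mulr_ge0// expR_ge0.
have := step 1%R (Q `^ a)%R ltr01 Qa0; rewrite subrr.
under eq_integral do rewrite powRr0.
rewrite powRr1 ?powR_ge0// integral_cst//= lebesgue_measure_itv/= lte_fin Qa0 oppr0 adde0 mul1e.
by under eq_integral do rewrite mul1r.
Qed.

(** Stated in the squared radius: with [Q = r^2], the density [K r^n dr] becomes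
    [(K/2) Q^((n + 1)/2 - 1) dQ], and [K] stands for the area of the unit sphere of [R^(n + 1)]. *)
Definition radial_formula n (K : R) := forall h : R -> \bar R,
  measurable_fun setT h -> (forall x, 0 <= h x) ->
  \int[lebN n.+1]_t h (sqnorm t) =
  (K / 2)%:E * \int[mu]_(Q in `]0%R, +oo[) ((Q `^ (n.+1%:R / 2 - 1))%:E * h Q).

Lemma radial_formula0 : radial_formula 0 2.
Proof.
move=> h mh h0; rewrite divff ?pnatr_eq0// mul1e.
have ms := @measurable_sqnorm 1.
rewrite integral_lebN1//; last by meas.
under eq_integral do rewrite sqnorm_cons sqnorm0 addr0.
rewrite ge0_integral_halves//; last by meas.
rewrite [RHS]ge0_integral_sqr; [|by meas|by move=> x _; rewrite mule_ge0// lee_fin powR_ge0].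
apply: eq_integral => x; rewrite inE/= in_itv/= andbT => x0.
rewrite sqrrN muleA -EFinM -mule2n (_ : _ * _ = 2)%R ?mule_natl//.
rewrite -powR_mulrn ?ltW// -powRrM (_ : 2%:R * (1%:R / 2 - 1) = - 1)%R; last by field.
by rewrite powR_inv1 ?ltW// mulfK// gt_eqF.
Qed.

(** The radial formula is applied to all coordinates but the first, and the total squared radius is
    taken as the new variable. Setting the first coordinate to [r t] produces the density
    [(1 - t^2)^((N - 3)/2)] with [N = n + 2]. *)
Lemma polar_head n K (f : R -> R -> \bar R) : (0 <= K)%R -> radial_formula n K ->
  measurable_fun setT (fun z : R * R => f z.1 z.2) -> (forall x y, 0 <= f x y) ->
  \int[lebN n.+2]_t f (sqnorm t) (thead t) =
  K%:E * \int[mu]_(r in `]0%R, +oo[) ((r ^+ n.+1)%:E * \int[mu]_(t in `](-1)%R, 1%R[)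
    (((1 - t ^+ 2) `^ ((n.+2%:R - 3) / 2))%:E * f (r ^+ 2)%R (r * t)%R)).
Proof.
move=> K0 rad mf f0; set e := ((n.+2%:R - 3) / 2)%R.
have ms := @measurable_sqnorm; have ms1 := ms n.+1; have ms2 := ms n.+2.
have mt := @measurable_thead n.+1.
have K20 : 0 <= (K / 2)%:E by rewrite lee_fin divr_ge0.
(* Here [Q] is the squared norm of the whole vector and [x] its first coordinate, so [Q - x^2] is
   the squared norm of the rest. *)
pose g Q x : \bar R := (x ^+ 2 < Q)%R%:R%:E * (((Q - x ^+ 2) `^ e)%:E * f Q x).
have mg : measurable_fun setT (fun z : R * R => g z.1 z.2) by rewrite /g; meas.
have g0 Q x : 0 <= g Q x.
  by rewrite /g !mule_ge0 ?lee_fin// powR_ge0.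
have mG : measurable_fun setT (fun x : R => \int[mu]_Q g Q x).
  by apply: (@measurable_integral_mu _ _ _ (fun x Q => g Q x)) => //; meas.
have s1 : \int[lebN n.+2]_t f (sqnorm t) (thead t) =
    (K / 2)%:E * \int[mu]_x \int[mu]_Q g Q x.
  rewrite integral_lebNS//; last by meas.
  rewrite -ge0_integralZl//; last by move=> x _; exact: integral_ge0.
  apply: eq_integral => x _.
  transitivity (\int[lebN n.+1]_t f (x ^+ 2 + sqnorm t)%R x).
    by apply: eq_integral => t _; rewrite sqnorm_cons.
  rewrite (rad (fun q => f (x ^+ 2 + q)%R x))//; last by meas.
  congr (_ * _); rewrite integral_pos_boolR.
  have mgx : measurable_fun setT (fun Q => g Q x) by meas.
  rewrite -[RHS](ge0_integral_shift (x ^+ 2) mgx (fun Q => g0 Q x)).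
  apply: eq_integral => Q _; rewrite /g ltrDr addrK (addrC Q).
  by congr (_ * ((_ `^ _)%:E * _)); rewrite /e -natr1; field.
have mg' : measurable_fun setT (fun z : R * R => g z.2 z.1) by meas.
rewrite s1 (exchange_integral_mu mg' (fun x Q => g0 Q x)).
have s2 : \int[mu]_Q \int[mu]_x g Q x = \int[mu]_(Q in `]0%R, +oo[)
    ((Q `^ (n%:R / 2))%:E * \int[mu]_(t in `](-1)%R, 1%R[)
    (((1 - t ^+ 2) `^ e)%:E * f Q (Num.sqrt Q * t)%R)).
  rewrite integral_pos_boolR; apply: eq_integral => Q _.
  have [Q0|Q0] := ltP 0%R Q; last first.
    rewrite mul0e integral0_eq// => x _; rewrite /g ltNge (le_trans Q0) ?sqr_ge0//.
    by rewrite mul0e.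
  have sQ : (0 < Num.sqrt Q)%R by rewrite sqrtr_gt0.
  have sQ2 : (Num.sqrt Q ^+ 2 = Q)%R by rewrite sqr_sqrtr// ltW.
  have mgQ : measurable_fun setT (g Q) by rewrite /g; meas.
  rewrite mul1e -(ge0_integral_scale_pos sQ mgQ (g0 Q)).
  have -> : (Q `^ (n%:R / 2) = Num.sqrt Q * Q `^ e)%R.
    rewrite -powR12_sqrt ?ltW// -powRD; last by rewrite (gt_eqF Q0) /= implybT.
    by congr (_ `^ _)%R; rewrite /e -!natr1; field.
  rewrite EFinM -muleA; congr (_ * _).
  rewrite (integral_mu_boolR _ itvN11E) -ge0_integralZl//; last 3 first.
  - by meas.
  - by move=> t _; rewrite !mule_ge0 ?lee_fin// powR_ge0.
  - by rewrite lee_fin powR_ge0.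
  apply: eq_integral => t _; rewrite /g exprMn sQ2 -[X in (_ < X)%R]mulr1 ltr_pM2l//.
  have [t1|t1] := ltP (t ^+ 2)%R 1%R; last by rewrite !mul0e mule0.
  rewrite !mul1e muleA -EFinM -powRM ?subr_ge0 ?ltW//.
  by congr ((_ `^ _)%R%:E * _); ring.
rewrite s2 ge0_integral_sqr//; last 2 first.
- apply: emeasurable_funM; first by meas.
  apply: (measurable_integral_mu_in itvN11E
    (f := fun Q t => ((1 - t ^+ 2) `^ e)%:E * f Q (Num.sqrt Q * t)%R)); [by meas|by meas|].
  by move=> x y; rewrite mule_ge0// lee_fin powR_ge0.
- by move=> x _; rewrite mule_ge0 ?lee_fin ?powR_ge0// integral_ge0// => t _; rewrite mule_ge0// lee_fin powR_ge0.
have mI : measurable_fun setT (fun r : R => \int[mu]_(t in `](-1)%R, 1%R[)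
    (((1 - t ^+ 2) `^ e)%:E * f (r ^+ 2)%R (r * t)%R)).
  apply: (measurable_integral_mu_in itvN11E
    (f := fun (r t : R) => ((1 - t ^+ 2) `^ e)%:E * f (r ^+ 2)%R (r * t)%R)); [by meas|by meas|].
  by move=> x y; rewrite mule_ge0// lee_fin powR_ge0.
have -> : K%:E = (K / 2)%:E * 2%:E by rewrite -EFinM; congr EFin; field.
rewrite -muleA; congr (_ * _); rewrite -ge0_integralZl//; last 2 first.
- by apply: measurable_funTS; meas.
- move=> r; rewrite /= in_itv/= andbT => r0.
  apply: mule_ge0; first by rewrite lee_fin exprn_ge0// ltW.
  by apply: integral_ge0 => t _; rewrite mule_ge0// lee_fin powR_ge0.
apply: eq_integral => r; rewrite inE/= in_itv/= andbT => r0.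
rewrite sqrtr_sqr gtr0_norm// !muleA -!EFinM; congr (EFin _ * _).
rewrite -powR_mulrn ?ltW// -powRrM (_ : 2%:R * (n%:R / 2) = n%:R)%R; last by field.
by rewrite powR_mulrn ?ltW// exprS mulrA.
Qed.

End lebN_rotation.

Section lebN_polar.
Context {R : realType}.
Local Open Scope ereal_scope.
Local Notation mu := (@lebesgue_measure R).
Implicit Types n : nat.

Lemma integral_expRN : \int[mu]_(Q in `]0%R, +oo[) (expR (- Q))%:E = 1.
Proof.
rewrite -(@integral_exponential_pdf R 1 ltr01) integral_itv_obnd_cbnd; last first.
  by apply: measurable_funTS; meas.
rewrite integral_mkcond; apply: eq_integral => x _.
rewrite /exponential_pdf !patchE; case: ifP => // _.
by rewrite mul1r mulN1r.
Qed.

(** The Gaussian integral over the plane is computed twice: [polar_head], started from the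
    one-dimensional radial formula, gives the unknown value [W] with factor one; the product of two
    Gaussian integrals gives [pi]. *)
Lemma integral_arcsine :
  \int[mu]_(t in `](-1)%R, 1%R[) ((1 - t ^+ 2) `^ (- 2^-1))%:E = pi%:E.
Proof.
set W := (X in X = _).
have ms2 := @measurable_sqnorm R 2.
have mh : measurable_fun setT (fun z : R * R => (expR (- z.1))%:E : \bar R) by meas.
have W0 : 0 <= W by apply: integral_ge0 => t _; rewrite lee_fin powR_ge0.
have key : \int[lebN 2]_t (expR (- sqnorm t))%:E = W.
  rewrite (polar_head (f := fun q _ => (expR (- q))%:E) _ radial_formula0 mh)//.
  transitivity (2%:E * \int[mu]_(r in `]0%R, +oo[) ((r * expR (- r ^+ 2))%:E * W)).
    congr (_ * _); apply: eq_integral => r; rewrite inE/= in_itv/= andbT => r0.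
    rewrite [in LHS]ge0_integralZr//; last 2 first.
    - by apply: measurable_funTS; meas.
    - by move=> t _; rewrite lee_fin powR_ge0.
    rewrite expr1 EFinM -muleA [RHS](_ : _ = r%:E * (W * (expR (- r ^+ 2))%:E)); last by rewrite [W * _]muleC.
    congr (_ * (_ * _)).
    by apply: eq_integral => t _; congr ((_ `^ _)%R%:E); field.
  rewrite ge0_integralZr//; last 2 first.
  - by apply: measurable_funTS; meas.
  - by move=> r; rewrite /= in_itv/= andbT => r0; rewrite lee_fin mulr_ge0 ?expR_ge0// ltW.
  rewrite muleA -[RHS]mul1e -integral_expRN; congr (_ * _).
  rewrite [RHS]ge0_integral_sqr; [|by meas|by move=> *; rewrite lee_fin expR_ge0].
  rewrite -ge0_integralZl//; last 2 first.
  - by apply: measurable_funTS; meas.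
  - by move=> r; rewrite /= in_itv/= andbT => r0; rewrite lee_fin mulr_ge0 ?expR_ge0// ltW.
  by apply: eq_integral => r _; rewrite -!EFinM mulrA.
rewrite -key integral_lebNSS; [|by meas|by move=> *; rewrite lee_fin expR_ge0].
transitivity (\int[mu]_x \int[mu]_y ((gauss_fun x)%:E * (gauss_fun y)%:E)).
  apply: eq_integral => x _; apply: eq_integral => y _.
  by rewrite integral_lebN0 !sqnorm_cons sqnorm0 addr0 opprD expRD.
under eq_integral => x _.
  rewrite ge0_integralZl//; last 3 first.
  - by apply/measurable_EFinP; exact: measurable_gauss_fun.
  - by move=> y _; rewrite lee_fin gauss_fun_ge0.
  - by rewrite lee_fin gauss_fun_ge0.
  rewrite integralT_gauss; over.
rewrite ge0_integralZr//; last 2 first.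
- by apply/measurable_EFinP; exact: measurable_gauss_fun.
- by move=> y _; rewrite lee_fin gauss_fun_ge0.
by rewrite integralT_gauss -EFinM -expr2 sqr_sqrtr// pi_ge0.
Qed.

Lemma radial_formula1 : radial_formula 1 (2 * pi : R)%R.
Proof.
move=> h mh h0.
have mh1 : measurable_fun setT (fun z : R * R => h z.1) by meas.
rewrite (polar_head (f := fun q _ => h q) _ radial_formula0 mh1 (fun x _ => h0 x))//.
transitivity (2%:E * \int[mu]_(r in `]0%R, +oo[) (r%:E * h (r ^+ 2)%R * pi%:E)).
  congr (_ * _); apply: eq_integral => r; rewrite inE/= in_itv/= andbT => r0.
  rewrite [in LHS]ge0_integralZr//; last 2 first.
  - by apply: measurable_funTS; meas.
  - by move=> t _; rewrite lee_fin powR_ge0.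
  rewrite expr1 -muleA (muleC (h _)) -integral_arcsine; congr (_ * (_ * _)).
  by apply: eq_integral => t _; congr ((_ `^ _)%R%:E); field.
rewrite ge0_integralZr; last 4 first.
- exact: measurable_itv.
- by apply: measurable_funTS; meas.
- by move=> r; rewrite /= in_itv/= andbT => r0; rewrite mule_ge0// lee_fin ltW.
- by rewrite lee_fin pi_ge0.
rewrite muleA muleC (_ : 2 * pi / 2 = pi)%R; last by field.
congr (_ * _); rewrite [RHS]ge0_integral_sqr; last 2 first.
- by meas.
- by move=> x _; rewrite mule_ge0// lee_fin powR_ge0.
rewrite -ge0_integralZl; last 4 first.
- exact: measurable_itv.
- by apply: measurable_funTS; meas.
- by move=> r; rewrite /= in_itv/= andbT => r0; rewrite mule_ge0// lee_fin ltW.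
- by rewrite lee_fin.
apply: eq_integral => r _.
by rewrite divff ?pnatr_eq0// subrr powRr0 mul1e muleA -EFinM.
Qed.

(** Split off two coordinates: in the plane the squared radius has the constant density [pi].
    Convolving this constant with [q^((n + 1)/2 - 1)] gives [2/(n + 1) Q^((n + 1)/2)], which
    accounts for the factor [2 pi/(n + 1)] in the recursion of [sphere_area]. *)
Lemma radial_formulaSS n (K : R) : (0 <= K)%R -> radial_formula n K ->
  radial_formula n.+2 (2 * pi / n.+1%:R * K)%R.
Proof.
move=> K0 rad h mh h0; pose e : R := (n.+1%:R / 2 - 1)%R.
have ms := @measurable_sqnorm R; have ms3 := ms n.+3; have ms1 := ms n.+1.
have ms2 := ms 2%N.
have K20 : 0 <= (K / 2)%:E by rewrite lee_fin divr_ge0.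
pose F q := \int[lebN n.+1]_t h (q + sqnorm t)%R.
have mF : measurable_fun setT F.
  by apply: (measurable_integral_lebN (f := fun (q : R) t => h (q + sqnorm t)%R)) => //; meas.
have F0 q : 0 <= F q by exact: integral_ge0.
transitivity (\int[lebN 2]_t F (sqnorm t)).
  rewrite [LHS]integral_lebNSS; [|by meas|by []].
  rewrite [RHS]integral_lebNSS; [|by meas|by []].
  apply: eq_integral => x _; apply: eq_integral => y _.
  rewrite integral_lebN0 !sqnorm_cons sqnorm0 addr0 /F.
  by apply: eq_integral => t _; rewrite !sqnorm_cons addrA.
rewrite (radial_formula1 mF F0) (_ : 2 * pi / 2 = pi)%R; last by field.
(* [Q] is the squared radius in the split plane and [q] that of the remaining coordinates; shifting
   by [q] then turns [Q] into the total squared radius. *)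
pose G Q q : \bar R := (0 < Q)%R%:R%:E * ((0 < q)%R%:R%:E * ((q `^ e)%:E * h (Q + q)%R)).
have mG : measurable_fun setT (fun z : R * R => G z.1 z.2) by rewrite /G; meas.
have G0 Q q : 0 <= G Q q by rewrite /G !mule_ge0// lee_fin powR_ge0.
have -> : \int[mu]_(Q in `]0%R, +oo[) ((Q `^ (2%:R / 2 - 1))%:E * F Q) =
    (K / 2)%:E * \int[mu]_Q \int[mu]_q G Q q.
  rewrite integral_pos_boolR -ge0_integralZl; last 4 first.
  - by [].
  - exact: (measurable_integral_mu mG).
  - by move=> x _; exact: integral_ge0.
  - by [].
  apply: eq_integral => Q _; rewrite divff ?pnatr_eq0// subrr powRr0 mul1e /F.
  have mhQ : measurable_fun setT (fun q => h (Q + q)%R) by meas.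
  rewrite (rad _ mhQ (fun q => h0 _)) integral_pos_boolR muleCA; congr (_ * _).
  rewrite -ge0_integralZl//; last by move=> q _; rewrite !mule_ge0// lee_fin powR_ge0.
  by meas.
rewrite (exchange_integral_mu mG G0).
have mh2 (q : R) : measurable_fun setT (fun Q => (q < Q)%R%:R%:E * ((0 < q)%R%:R%:E * ((q `^ e)%:E * h Q))).
  by meas.
have mh3 : measurable_fun setT (fun z : R * R => (z.1 < z.2)%R%:R%:E * ((0 < z.1)%R%:R%:E * ((z.1 `^ e)%:E * h z.2))).
  by meas.
have -> : \int[mu]_q \int[mu]_Q G Q q = \int[mu]_q \int[mu]_Q
    ((q < Q)%R%:R%:E * ((0 < q)%R%:R%:E * ((q `^ e)%:E * h Q))).
  apply: eq_integral => q _.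
  rewrite -(ge0_integral_shift q (mh2 q)); last first.
    by move=> Q; rewrite !mule_ge0// lee_fin powR_ge0.
  by apply: eq_integral => Q _; rewrite /G ltrDr.
rewrite (exchange_integral_mu mh3); last first.
  by move=> q Q; rewrite !mule_ge0// lee_fin powR_ge0.
have en : (0 < n.+1%:R / 2 :> R)%R by rewrite divr_gt0.
have -> : \int[mu]_Q \int[mu]_q ((q < Q)%R%:R%:E * ((0 < q)%R%:R%:E * ((q `^ e)%:E * h Q)))
    = (2 / n.+1%:R)%:E * \int[mu]_(Q in `]0%R, +oo[)
     ((Q `^ (n.+3%:R / 2 - 1))%:E * h Q).
  rewrite integral_pos_boolR -ge0_integralZl; last 4 first.
  - by [].
  - by meas.
  - by move=> Q _; rewrite !mule_ge0// lee_fin powR_ge0.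
  - by rewrite lee_fin divr_ge0.
  apply: eq_integral => Q _.
  have [Q0|Q0] := ltP 0%R Q; last first.
    rewrite mul0e mule0 integral0_eq// => q _.
    by have [q0|q0] := ltP 0%R q; [rewrite ltNge (le_trans Q0 (ltW q0)) mul0e|rewrite mul0e mule0].
  transitivity (\int[mu]_(q in `]0%R, Q[) ((q `^ e)%:E * h Q)).
    rewrite [RHS](@integral_mu_boolR R _ (fun q => 0 < q < Q)%R); last first.
      by apply/seteqP; split => q /=; rewrite in_itv.
    apply: eq_integral => q _; rewrite muleA; congr (_ * _).
    by rewrite -EFinM -natrM mulnb andbC.
  rewrite ge0_integralZr; last 4 first.
  - by [].
  - by apply: measurable_funTS; meas.
  - by move=> q _; rewrite lee_fin powR_ge0.
  - by [].
  rewrite integral_powR_itv// mul1e muleA -EFinM; congr (EFin _ * _).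
  rewrite invf_div mulrC; congr (_ * (_ `^ _))%R.
  by rewrite -[in RHS]natr1 -[in RHS]natr1; field.
rewrite !muleA -!EFinM; congr (EFin _ * _).
have : (n.+1%:R != 0 :> R)%R by rewrite pnatr_eq0.
by set m : R := n.+1%:R => m0; field.
Qed.

Lemma sphere_area_ge0 n : (0 <= sphere_area R n)%R.
Proof.
elim/ltn_ind: n => -[|[|n]] ih //=; first by rewrite mulr_ge0// pi_ge0.
by rewrite mulr_ge0 ?ih// divr_ge0// mulr_ge0// pi_ge0.
Qed.

Lemma radial_formulaP n : radial_formula n (sphere_area R n).
Proof.
elim/ltn_ind: n => -[|[|n]] ih; first exact: radial_formula0.
  exact: radial_formula1.
by apply: radial_formulaSS; [exact: sphere_area_ge0|exact: ih].
Qed.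

Lemma polar_lebN n (f : R -> R -> \bar R) (a : n.+2.-tuple R) :
  measurable_fun setT (fun z : R * R => f z.1 z.2) -> (forall x y, 0 <= f x y) ->
  \int[lebN n.+2]_t f (sqnorm t) (dotp a t) =
  (sphere_area R n)%:E * \int[mu]_(r in `]0%R, +oo[) ((r ^+ n.+1)%:E *
    \int[mu]_(t in `](-1)%R, 1%R[) (((1 - t ^+ 2) `^ ((n.+2%:R - 3) / 2))%:E *
      f (r ^+ 2)%R (Num.sqrt (sqnorm a) * (r * t))%R)).
Proof.
move=> mf f0; rewrite ge0_integral_lebN_rot//.
have mf' : measurable_fun setT (fun z : R * R => f z.1 (Num.sqrt (sqnorm a) * z.2)%R).
  by meas.
exact: (polar_head (f := fun q w => f q (Num.sqrt (sqnorm a) * w)%R) (sphere_area_ge0 n) (@radial_formulaP n) mf' (fun x y => f0 _ _)).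
Qed.

End lebN_polar.

(** * The kernel averaged over spheres *)

Section kernel.
Context {R : realType}.
Local Open Scope ereal_scope.
Local Notation mu := (@lebesgue_measure R).
Implicit Types (n : nat) (r t : R).

Lemma enorm_tup2row n (t : n.-tuple R) : enorm (tup2row t) = Num.sqrt (sqnorm t).
Proof. by rewrite /enorm /sqnorm; congr Num.sqrt; apply: eq_bigr => i _; rewrite mxE. Qed.

Lemma enorm_sub_tup2row n (x y : n.-tuple R) :
  enorm (tup2row x - tup2row y)%R = Num.sqrt (sqnorm x - 2 * dotp x y + sqnorm y).
Proof.
rewrite /enorm /sqnorm /dotp; congr Num.sqrt.
rewrite mulr_sumr -sumrB -big_split/=; apply: eq_bigr => i _.
by rewrite !mxE; ring.
Qed.

Lemma sqdist_ge0 n (x y : n.-tuple R) : (0 <= sqnorm x - 2 * dotp x y + sqnorm y)%R.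
Proof.
rewrite /sqnorm /dotp mulr_sumr -sumrB -big_split/=; apply: sumr_ge0 => i _.
rewrite (_ : _ + _ = (tnth x i - tnth y i) ^+ 2)%R ?sqr_ge0//; ring.
Qed.

Lemma dotpC n (x y : n.-tuple R) : dotp x y = dotp y x.
Proof. by apply: eq_bigr => i _; rewrite mulrC. Qed.

Lemma measurable_dotp2 n :
  measurable_fun setT (fun z : n.-tuple R * n.-tuple R => dotp z.1 z.2).
Proof.
apply: measurable_sum => i; apply: measurable_funM.
  exact: (measurableT_comp (measurable_tnth i)).
exact: (measurableT_comp (measurable_tnth i)).
Qed.

Lemma sqrt_powR (z a : R) : (0 <= z)%R -> (Num.sqrt z `^ a = z `^ (a / 2))%R.
Proof. by move=> z0; rewrite -powR12_sqrt// -powRrM mulrC. Qed.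

Variables (s p : R).

Lemma kbase_ge0 r t : (-1 <= t <= 1)%R -> (0 <= 1 - 2 * r * t + r ^+ 2)%R.
Proof.
move=> /andP[t1 t2].
rewrite (_ : _ + _ = (r - t) ^+ 2 + (1 - t) * (1 + t))%R; last by ring.
by rewrite addr_ge0 ?sqr_ge0// mulr_ge0//; lra.
Qed.

(** Half of the exponent [-(N + ps)], with [N = n + 1], since the base is a squared distance. *)
Definition kexp n : R := (- (n.+1%:R + p * s) / 2)%R.
Definition kfun n (r t : R) : R := ((1 - 2 * r * t + r ^+ 2) `^ kexp n)%R.

(* [Phi] without the junk values of [powR] at the negative base [1 - r] for
   [N = 1] and [r > 1]; here [n = N - 1]. *)
Definition Psi n (r : R) : \bar R :=
  match n with
  | 0 => (kfun 0 r 1 + kfun 0 r (-1))%:E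
  | m.+1 => (sphere_area R m)%:E * \int[mu]_(t in `](-1)%R, 1%R[)
      ((1 - t ^+ 2) `^ ((m.+2%:R - 3) / 2) * kfun m.+1 r t)%:E
  end.

Lemma Psi_ge0 n r : 0 <= Psi n r.
Proof.
case: n => [|m] /=; first by rewrite lee_fin addr_ge0// powR_ge0.
apply: mule_ge0; first by rewrite lee_fin sphere_area_ge0.
by apply: integral_ge0 => t _; rewrite lee_fin mulr_ge0// powR_ge0.
Qed.

Lemma measurable_kfun n : measurable_fun setT (fun z : R * R => kfun n z.1 z.2).
Proof. by rewrite /kfun; meas. Qed.

Lemma measurable_Psi n : measurable_fun setT (Psi n).
Proof.
case: n => [|m].
  by rewrite /Psi; apply/measurable_EFinP; rewrite /kfun; meas.
rewrite /Psi; apply: emeasurable_funM => //.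
have mk := measurable_kfun m.+1.
apply: (measurable_integral_mu_in (@itvN11E R)
  (f := fun (r t : R) => ((1 - t ^+ 2) `^ ((m.+2%:R - 3) / 2) * kfun m.+1 r t)%:E)).
- by meas.
- by meas.
- by move=> r t; rewrite lee_fin mulr_ge0// powR_ge0.
Qed.

(** Replacing [r] by [1/r] divides the squared distance by [r^2]. This is the homogeneity that moves
    radii above one back to [(0, 1)]. *)
Lemma kfun_inv n r t : (0 < r)%R -> (-1 <= t <= 1)%R ->
  kfun n r^-1 t = (r `^ (n.+1%:R + p * s) * kfun n r t)%R.
Proof.
move=> r0 tI; have rn0 : r != 0%R by rewrite gt_eqF.
have -> : (r `^ (n.+1%:R + p * s) = (r ^- 2) `^ kexp n)%R.
  rewrite -(powR_invn _ (ltW r0)) -powRrM; congr (_ `^ _)%R; rewrite /kexp; by field.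
rewrite /kfun -powRM.
- congr (_ `^ _)%R; by field.
- by rewrite invr_ge0 sqr_ge0.
- exact: kbase_ge0.
Qed.

Lemma Psi_inv n r : (0 < r)%R -> Psi n r^-1%R = (r `^ (n.+1%:R + p * s))%:E * Psi n r.
Proof.
move=> r0; case: n => [|m] /=.
  by rewrite -EFinM mulrDr !kfun_inv//; apply/andP; split; lra.
rewrite muleCA; congr (_ * _).
rewrite -ge0_integralZl; last 4 first.
- exact: measurable_itv.
- apply: measurable_funTS; have mk := measurable_kfun m.+1; by meas.
- by move=> t _; rewrite lee_fin mulr_ge0// powR_ge0.
- by rewrite lee_fin powR_ge0.
apply: eq_integral => t; rewrite inE/= in_itv/= => /andP[t1 t2].
rewrite kfun_inv//; last by rewrite !ltW.
by rewrite -EFinM mulrCA.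
Qed.

(** For [N = 1] the angles [t = 1] and [t = -1] make the base the perfect squares [(1 - r)^2] and
    [(1 + r)^2]; for [N >= 2] only the endpoints of the angular interval differ. *)
Lemma Psi_Phi n r : (0 < r < 1)%R -> Phi n.+1 s p r = Psi n r.
Proof.
move=> /andP[r0 r1]; case: n => [|m]; rewrite /Phi/=.
  have E (z : R) : (0 < z)%R -> (z `^ (-1 - p * s) = (z ^+ 2) `^ kexp 0)%R.
    move=> z0; rewrite -(powR_mulrn _ (ltW z0)) -powRrM; congr (_ `^ _)%R; rewrite /kexp; by field.
  rewrite !E; [|lra..]; rewrite /kfun; congr (_ + _)%:E; congr (_ `^ _)%R; ring.
rewrite subSS subn1/=; congr (_ * _).
rewrite integral_itv_bndoo; last first.
  by apply: measurable_funTS; meas.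
by apply: eq_integral => t _.
Qed.

(** For fixed [x], rotation turns [dotp x y] into [|x|] times one coordinate, and the dilation
    [|y| = |x| r] pulls out [|x|^(-ps)]; the angular integral that remains is [Psi]. In dimension
    one a reflection takes the place of the rotation. *)
Lemma integral_kernel n (b : R -> R) (x : n.+1.-tuple R) :
  measurable_fun setT b -> (forall r, (0 <= b r)%R) -> (0 < sqnorm x)%R ->
  \int[lebN n.+1]_y (b (Num.sqrt (sqnorm y) / Num.sqrt (sqnorm x)) *
    (sqnorm x - 2 * dotp x y + sqnorm y) `^ kexp n)%:E =
  (Num.sqrt (sqnorm x) `^ (- (p * s)))%:E *
  \int[mu]_(r in `]0%R, +oo[) ((b r * r ^+ n)%:E * Psi n r).
Proof.
move=> mb b0 x0; set rho := Num.sqrt (sqnorm x).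
have rho0 : (0 < rho)%R by rewrite sqrtr_gt0.
have rn0 : rho != 0%R by rewrite gt_eqF.
have rho2 : (rho ^+ 2 = sqnorm x)%R by rewrite sqr_sqrtr// ltW.
(* Exponent count: [1] from the Jacobian, [n] from the radial density and [-(n + 1 + ps)] from the
   kernel. *)
have rexp : (rho * (rho ^+ n * (rho ^+ 2) `^ kexp n) = rho `^ (- (p * s)))%R.
  rewrite -!(powR_mulrn _ (ltW rho0)) -powRrM -{1}(powRr1 (ltW rho0)).
  have I a : (a ==> (rho != 0%R)) by rewrite rn0 implybT.
  rewrite -!powRD//; congr (_ `^ _)%R; rewrite /kexp -natr1; by field.
have rps : 0 <= (rho `^ (- (p * s)))%:E by rewrite lee_fin powR_ge0.
have mP := measurable_Psi n.
have ms := @measurable_sqnorm R n.+1; have md := @measurable_dotp R n.+1.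
rewrite -ge0_integralZl; last 4 first.
- exact: measurable_itv.
- by apply: measurable_funTS; meas.
- move=> r; rewrite /= in_itv/= andbT => r0.
  by rewrite mule_ge0 ?Psi_ge0// lee_fin mulr_ge0// exprn_ge0// ltW.
- by [].
case: n x x0 @rho rho0 rn0 rho2 rexp rps mP ms md => [|m] x x0 rho rho0 rn0 rho2 rexp rps mP ms md.
  rewrite integral_lebN1; [|by meas|by move=> t; rewrite lee_fin mulr_ge0// powR_ge0].
  have [x1 [x' xE]] := tuple_consE x.
  have xx : (x1 ^+ 2 = rho ^+ 2)%R by rewrite rho2 xE sqnorm_cons sqnorm0 addr0.
  pose g (w y : R) : \bar R := (b (`|y| / rho) * (rho ^+ 2 - 2 * (w * y) + y ^+ 2) `^ kexp 0)%:E.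
  have mg w : measurable_fun setT (g w) by rewrite /g; meas.
  have g0 w y : 0 <= g w y by rewrite lee_fin mulr_ge0// powR_ge0.
  transitivity (\int[mu]_y g x1 y).
    apply: eq_integral => y _; rewrite /g -rho2 xE dotp_cons dotp0 addr0.
    by rewrite sqnorm_cons sqnorm0 addr0 sqrtr_sqr.
  have -> : \int[mu]_y g x1 y = \int[mu]_y g rho y.
    have [->|->] : x1 = rho \/ x1 = (- rho)%R.
      by move/eqP : xx; rewrite eqf_sqr => /orP[/eqP ->|/eqP ->]; [left|right].
      by [].
    rewrite -[RHS](ge0_integral_opp (mg rho) (g0 rho)); apply: eq_integral => y _.
    by rewrite /g normrN sqrrN mulrN mulNr.
  rewrite -(ge0_integral_scale_pos rho0 (mg rho) (g0 rho)).
  rewrite ge0_integral_halves; last 2 first.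
  - by apply: (measurableT_comp (mg rho)); meas.
  - by move=> y; exact: g0.
  rewrite -ge0_integralZl; last 4 first.
  - exact: measurable_itv.
  - apply: measurable_funTS; apply: emeasurable_funD;
      by apply: (measurableT_comp (mg rho)); meas.
  - by move=> r _; rewrite adde_ge0.
  - by rewrite lee_fin ltW.
  apply: eq_integral => r; rewrite inE/= in_itv/= andbT => r0.
  have I1 : (-1 <= (1 : R) <= 1)%R by apply/andP; split; lra.
  have I2 : (-1 <= (-1 : R) <= 1)%R by apply/andP; split; lra.
  have h1 := kbase_ge0 r I1; have h2 := kbase_ge0 r I2.
  have k1 : ((rho ^+ 2 - 2 * (rho * (rho * r)) + (rho * r) ^+ 2) `^ kexp 0 =
      (rho ^+ 2) `^ kexp 0 * kfun 0 r 1)%R.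
    by rewrite /kfun -(powRM _ (sqr_ge0 rho) h1); congr (_ `^ _)%R; ring.
  have k2 : ((rho ^+ 2 - 2 * (rho * (rho * - r)) + (rho * - r) ^+ 2) `^ kexp 0 =
      (rho ^+ 2) `^ kexp 0 * kfun 0 r (-1))%R.
    by rewrite /kfun -(powRM _ (sqr_ge0 rho) h2); congr (_ `^ _)%R; ring.
  rewrite /g k1 k2 normrM (normrM _ (- r)%R) normrN (gtr0_norm rho0) (gtr0_norm r0).
  have -> : (rho * r / rho = r)%R by field.
  rewrite -rexp expr0 !mul1r -EFinD -!EFinM; congr EFin; ring.
pose e : R := ((m.+2%:R - 3) / 2)%R.
pose f (q w : R) : \bar R := (b (Num.sqrt q / rho) * (rho ^+ 2 - 2 * w + q) `^ kexp m.+1)%:E.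
have mf : measurable_fun setT (fun z : R * R => f z.1 z.2) by rewrite /f; meas.
have f0 q w : 0 <= f q w by rewrite lee_fin mulr_ge0// powR_ge0.
pose F (r : R) : \bar R := (0 < r)%R%:R%:E * ((r ^+ m.+1)%:E *
  \int[mu]_(t in `](-1)%R, 1%R[) (((1 - t ^+ 2) `^ e)%:E * f (r ^+ 2)%R (rho * (r * t))%R)).
have mI : measurable_fun setT (fun r : R => \int[mu]_(t in `](-1)%R, 1%R[)
    (((1 - t ^+ 2) `^ e)%:E * f (r ^+ 2)%R (rho * (r * t))%R)).
  apply: (measurable_integral_mu_in (@itvN11E R)
    (f := fun (r t : R) => ((1 - t ^+ 2) `^ e)%:E * f (r ^+ 2)%R (rho * (r * t))%R)).
  - by meas.
  - by meas.
  - by move=> r t; rewrite mule_ge0// lee_fin powR_ge0.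
have mF : measurable_fun setT F by rewrite /F; meas.
have F0 r : 0 <= F r.
  rewrite /F; have [r0|r0] := ltP 0%R r; last by rewrite mul0e.
  rewrite mul1e; apply: mule_ge0; first by rewrite lee_fin exprn_ge0// ltW.
  by apply: integral_ge0 => t _; rewrite mule_ge0// lee_fin powR_ge0.
transitivity ((sphere_area R m)%:E * \int[mu]_r F r).
  rewrite -integral_pos_boolR -(polar_lebN x mf f0).
  by apply: eq_integral => y _; rewrite /f rho2.
rewrite -(ge0_integral_scale_pos rho0 mF F0) [RHS]integral_pos_boolR.
have mFs : measurable_fun setT (fun r : R => F (rho * r)%R) by apply: (measurableT_comp mF); meas.
rewrite -ge0_integralZl; [|by []|exact: mFs|by []|by rewrite lee_fin ltW].
rewrite -ge0_integralZl; last 4 first.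
- by [].
- by meas.
- by move=> r _; rewrite mule_ge0// lee_fin ltW.
- by rewrite lee_fin sphere_area_ge0.
apply: eq_integral => r _; rewrite /F pmulr_rgt0//.
have [r0|r0] := ltP 0%R r; last by rewrite !mul0e !mule0.
rewrite !mul1e.
have -> : \int[mu]_(t in `](-1)%R, 1%R[) (((1 - t ^+ 2) `^ e)%:E * f ((rho * r) ^+ 2)%R (rho * (rho * r * t))%R) =
    (b r * (rho ^+ 2) `^ kexp m.+1)%:E *
    \int[mu]_(t in `](-1)%R, 1%R[) ((1 - t ^+ 2) `^ e * kfun m.+1 r t)%:E.
  have mk := measurable_kfun m.+1.
  rewrite -ge0_integralZl; last 4 first.
  - exact: measurable_itv.
  - by apply: measurable_funTS; meas.
  - by move=> t _; rewrite lee_fin mulr_ge0// powR_ge0.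
  - by rewrite lee_fin mulr_ge0// powR_ge0.
  apply: eq_integral => t; rewrite inE/= in_itv/= => /andP[t1 t2].
  rewrite /f sqrtr_sqr gtr0_norm ?mulr_gt0// (_ : rho * r / rho = r)%R; last by field.
  have -> : ((rho ^+ 2 - 2 * (rho * (rho * r * t)) + (rho * r) ^+ 2) `^ kexp m.+1 =
      (rho ^+ 2) `^ kexp m.+1 * kfun m.+1 r t)%R.
    have tI : (-1 <= t <= 1)%R by rewrite !ltW.
    by rewrite /kfun -(powRM _ (sqr_ge0 rho) (kbase_ge0 r tI)); congr (_ `^ _)%R; ring.
  by rewrite -!EFinM; congr EFin; ring.
rewrite /= -rexp -/e; set I := integral _ _ _.
rewrite !muleA; congr (_ * _); rewrite -!EFinM; congr EFin.
by rewrite exprMn; ring.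
Qed.

End kernel.

(** * The pointwise inequality in terms of [u = w v] *)

Section weighted_pointwise.
Context {R : realType}.
Variable p : R.
Hypothesis p2 : 2 <= p.

Let p0 : 0 < p. Proof. by rewrite (lt_le_trans _ p2). Qed.

Lemma powR_quotient (w d v : R) : 0 < w -> 0 <= d ->
  `|d / w| `^ (p - 1) * `|w * v| `^ p = d `^ (p - 1) * (w * `|v| `^ p).
Proof.
move=> w0 d0; have dw : 0 <= d / w by rewrite divr_ge0// ltW.
rewrite ger0_norm// normrM (powRM _ (normr_ge0 _) (normr_ge0 _)) (gtr0_norm w0).
rewrite -(mulr_powRB1 (ltW w0) p0).
have <- : (d / w) `^ (p - 1) * w `^ (p - 1) = d `^ (p - 1).
  by rewrite -(powRM _ dw (ltW w0)) divfK// gt_eqF.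
by ring.
Qed.

(** Without subtraction, both sides can be integrated as nonnegative functions; the coefficients of
    the two powers of [u] depend only on the ratio of the weights, so polar coordinates apply to
    them. *)
Lemma ground_state_weighted (w1 w2 v1 v2 : R) : 0 < w2 < w1 ->
  `|(w1 - w2) / w1| `^ (p - 1) * `|w1 * v1| `^ p +
    c_p p * ((w1 * w2) `^ (p / 2) * `|v1 - v2| `^ p) <=
  `|w1 * v1 - w2 * v2| `^ p + `|(w1 - w2) / w2| `^ (p - 1) * `|w2 * v2| `^ p.
Proof.
move=> wI; have [w20 w21] := andP wI; have w10 : 0 < w1 by exact: lt_trans w21.
have d0 : 0 <= w1 - w2 by rewrite subr_ge0 ltW.
rewrite !powR_quotient//; have := ground_state_pointwise p2 v1 v2 wI.
by rewrite mulrBr; lra.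
Qed.

(** For [p = 2] and [c_2 = 1], expanding the squares leaves an algebraic identity. *)
Lemma ground_state_weighted2 (w1 w2 v1 v2 : R) : p = 2 -> 0 < w2 < w1 ->
  `|(w1 - w2) / w1| `^ (p - 1) * `|w1 * v1| `^ p +
    c_p p * ((w1 * w2) `^ (p / 2) * `|v1 - v2| `^ p) =
  `|w1 * v1 - w2 * v2| `^ p + `|(w1 - w2) / w2| `^ (p - 1) * `|w2 * v2| `^ p.
Proof.
move=> pE wI; have [w20 w21] := andP wI; have w10 : 0 < w1 by exact: lt_trans w21.
have d0 : 0 <= w1 - w2 by rewrite subr_ge0 ltW.
rewrite !powR_quotient// c_2// pE.
have E (x : R) : `|x| `^ 2 = x ^+ 2 by rewrite powR_mulrn// real_normK// num_real.
rewrite !E (_ : 2 - 1 = 1 :> R); last by ring.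
rewrite (_ : 2 / 2 = 1 :> R); last by field.
by rewrite !powRr1//; [ring|rewrite mulr_ge0// ltW].
Qed.

End weighted_pointwise.

(** * Double integrals of nonnegative functions *)

Section double_integral.
Context d (T : measurableType d) (R : realType).
Variable m : {sigma_finite_measure set T -> \bar R}.
Local Open Scope ereal_scope.
Implicit Types f g : T -> T -> \bar R.

Definition dint f := \int[m]_x \int[m]_y f x y.

Lemma dintE f : measurable_fun setT (fun z : T * T => f z.1 z.2) ->
  (forall x y, 0 <= f x y) -> dint f = \int[m \x m]_z f z.1 z.2.
Proof.
by move=> mf f0; rewrite (@fubini_tonelli1 _ _ _ _ _ m m (fun z => f z.1 z.2)).
Qed.

Lemma dint_ge0 f : (forall x y, 0 <= f x y) -> 0 <= dint f.
Proof. by move=> f0; do 2 apply: integral_ge0 => ? _. Qed.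

Lemma dintD f g : measurable_fun setT (fun z : T * T => f z.1 z.2) ->
  measurable_fun setT (fun z : T * T => g z.1 z.2) ->
  (forall x y, 0 <= f x y) -> (forall x y, 0 <= g x y) ->
  dint (fun x y => f x y + g x y) = dint f + dint g.
Proof.
move=> mf mg f0 g0; rewrite !dintE//; first by rewrite ge0_integralD.
- exact: emeasurable_funD.
- by move=> x y; rewrite adde_ge0.
Qed.

Lemma dintZl f k : measurable_fun setT (fun z : T * T => f z.1 z.2) ->
  (forall x y, 0 <= f x y) -> (0 <= k)%R ->
  dint (fun x y => k%:E * f x y) = k%:E * dint f.
Proof.
move=> mf f0 k0; rewrite !dintE//; first by rewrite ge0_integralZl.
- exact: emeasurable_funM.
- by move=> x y; rewrite mule_ge0.
Qed.

Lemma le_dint f g : measurable_fun setT (fun z : T * T => f z.1 z.2) ->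
  measurable_fun setT (fun z : T * T => g z.1 z.2) ->
  (forall x y, 0 <= f x y) -> (forall x y, f x y <= g x y) ->
  dint f <= dint g.
Proof.
move=> mf mg f0 fg; have g0 x y : 0 <= g x y by exact: le_trans (fg x y).
by rewrite !dintE//; apply: ge0_le_integral => // z _; exact: fg.
Qed.

Lemma eq_dint f g : (forall x y, f x y = g x y) -> dint f = dint g.
Proof. by move=> fg; apply: eq_integral => x _; apply: eq_integral => y _; exact: fg. Qed.

Lemma dintC f : measurable_fun setT (fun z : T * T => f z.1 z.2) ->
  (forall x y, 0 <= f x y) -> dint f = dint (fun x y => f y x).
Proof. by move=> mf f0; rewrite /dint (exchange_integral m m mf f0). Qed.

Lemma dint_cut (b : nat -> T -> T -> bool) (c : T -> T -> bool) f :
  (forall k, measurable_fun setT (fun z : T * T => b k z.1 z.2)) ->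
  (forall x y i j, (i <= j)%N -> b i x y -> b j x y) ->
  (forall x y, c x y -> exists k, b k x y) -> (forall x y k, b k x y -> c x y) ->
  measurable_fun setT (fun z : T * T => c z.1 z.2) ->
  measurable_fun setT (fun z : T * T => f z.1 z.2) -> (forall x y, 0 <= f x y) ->
  dint (fun x y => (b k x y)%:R%:E * f x y) @[k --> \oo] -->
  dint (fun x y => (c x y)%:R%:E * f x y).
Proof.
move=> mb ndb cb bc mc mf f0.
have mbf k : measurable_fun setT (fun z : T * T => (b k z.1 z.2)%:R%:E * f z.1 z.2).
  by apply: emeasurable_funM => //; apply/measurable_EFinP/measurable_boolR.
have mcf : measurable_fun setT (fun z : T * T => (c z.1 z.2)%:R%:E * f z.1 z.2).
  by apply: emeasurable_funM => //; apply/measurable_EFinP/measurable_boolR.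
have nn (e : bool) x y : 0 <= e%:R%:E * f x y by rewrite mule_ge0// lee_fin.
rewrite dintE//.
rewrite (_ : (fun k => _) = (fun k => \int[m \x m]_z ((b k z.1 z.2)%:R%:E * f z.1 z.2))); last first.
  by apply/funext => k; rewrite dintE.
rewrite (_ : \int[_]_z _ = \int[m \x m]_z
    limn (fun k => (b k z.1 z.2)%:R%:E * f z.1 z.2)); last first.
  apply: eq_integral => -[x y] _ /=; apply/esym/cvg_lim => //.
  have [cxy|ncxy] := boolP (c x y).
    have [k0 bk0] := cb _ _ cxy.
    apply: (cvg_near_cst _); exists k0 => // k /= k0k.
    by rewrite (ndb _ _ _ _ k0k bk0).
  apply: (cvg_near_cst _); exists 0%N => // k /= _.
  by case: (boolP (b k x y)) => // /bc; rewrite (negbTE ncxy).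
apply: cvg_monotone_convergence => //.
- by move=> z _ i j ij; apply: lee_wpmul2r => //; rewrite lee_fin ler_nat;
     case: (boolP (b i z.1 z.2)) => // /(ndb _ _ _ _ ij) ->.
Qed.

End double_integral.

(** * The inequality over pairs whose ratio [|y|/|x|] is cut off *)

Section cutoff.
Context {R : realType}.
Variables (n : nat) (s p : R).
Hypothesis p2 : 2 <= p.
Hypothesis s0 : 0 < s.
Local Open Scope ereal_scope.
Local Notation mu := (@lebesgue_measure R).
Local Notation T := (n.+1.-tuple R).
Local Notation dlint := (@dint _ T R (lebN n.+1)).

Let p0 : (0 < p)%R. Proof. by rewrite (lt_le_trans _ p2). Qed.

Definition hexp : R := ((n.+1%:R - p * s) / p)%R.
Hypothesis hexp_neq0 : hexp != 0%R.

Definition nrm (x : T) : R := Num.sqrt (sqnorm x).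
Definition ker (x y : T) : R :=
  ((sqnorm x - 2 * dotp x y + sqnorm y) `^ kexp s p n)%R.
(** [wy] and [wx] are the coefficients of [|u y|^p] and [|u x|^p] in [ground_state_weighted] for the
    weight [|x|^(-hexp)], as functions of [r = |y|/|x|]. *)
Definition wy (r : R) : R := (`|1 - r `^ hexp| `^ (p - 1))%R.
Definition wx (r : R) : R := (`|r `^ (- hexp) - 1| `^ (p - 1))%R.

Lemma ker_ge0 x y : (0 <= ker x y)%R. Proof. exact: powR_ge0. Qed.

Lemma kerC x y : ker x y = ker y x.
Proof. by rewrite /ker dotpC; congr (_ `^ _)%R; ring. Qed.

Lemma nrm_ge0 x : (0 <= nrm x)%R. Proof. exact: sqrtr_ge0. Qed.

Lemma measurable_nrm : measurable_fun setT nrm.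
Proof. by rewrite /nrm; have ms := @measurable_sqnorm R n.+1; meas. Qed.

Lemma measurable_ker : measurable_fun setT (fun z : T * T => ker z.1 z.2).
Proof.
rewrite /ker; have ms := @measurable_sqnorm R n.+1; have md := @measurable_dotp2 R n.+1.
by meas.
Qed.

Lemma measurable_wy : measurable_fun setT wy.
Proof. by rewrite /wy; meas. Qed.

Lemma measurable_wx : measurable_fun setT wx.
Proof. by rewrite /wx; meas. Qed.

Variable J : R -> bool.
Hypothesis mJ : measurable_fun setT J.
Hypothesis J01 : forall r, J r -> (0 < r < 1)%R.

Definition Jxy (x y : T) : bool := (0 < sqnorm x)%R && J (nrm y / nrm x).

Lemma measurable_Jxy : measurable_fun setT (fun z : T * T => Jxy z.1 z.2).
Proof.
rewrite /Jxy; have ms := @measurable_sqnorm R n.+1; have mn := measurable_nrm.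
by meas.
Qed.

Lemma JxyP x y : Jxy x y -> (0 < nrm y < nrm x)%R.
Proof.
move=> /andP[x0 /J01/andP[r0 r1]].
have nx : (0 < nrm x)%R by rewrite sqrtr_gt0.
by move: r0 r1; rewrite ltr_pdivrMr// mul1r => h ->; rewrite andbT -(pmulr_lgt0 _ (_ : 0 < (nrm x)^-1)%R)// invr_gt0.
Qed.

(** [kintP] and [kintQ] are the multiples of the Hardy integral produced by the terms in [|u y|^p]
    and [|u x|^p]; [kintC] is their difference up to sign, which is half of [C_{N,s,p}] when [J] is
    all of [(0, 1)]. *)
Definition kintP := \int[mu]_(r in `]0%R, +oo[)
  (((J r)%:R * wy r * r `^ (p * s - 1))%:E * Psi s p n r).
Definition kintQ := \int[mu]_(r in `]0%R, +oo[)
  (((J r)%:R * wx r * r ^+ n)%:E * Psi s p n r).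
Definition kintC := \int[mu]_(r in `]0%R, +oo[)
  (((J r)%:R * (r `^ (p * s - 1) * `|1 - r `^ hexp| `^ p))%:E * Psi s p n r).

(** Since [p hexp = N - ps], the power [r^n r^(- hexp (p - 1))] equals [r^(ps - 1) r^hexp]; this
    brings both weights over the same density. *)
Lemma wx_wy r : (0 < r)%R -> (wx r * r ^+ n = r `^ (p * s - 1) * (r `^ hexp * wy r))%R.
Proof.
move=> r0; have rn0 : r != 0%R by rewrite gt_eqF.
have rh : (0 < r `^ hexp)%R by rewrite powR_gt0.
have I a : a ==> (r != 0%R) by rewrite rn0 implybT.
have -> : wx r = ((r `^ hexp) `^ (- (p - 1)) * wy r)%R.
  rewrite /wx /wy powRN (_ : _ - 1 = (1 - r `^ hexp) / r `^ hexp)%R; last first.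
    by rewrite mulrBl divff ?gt_eqF// mul1r.
  rewrite normrM (powRM _ (normr_ge0 _) (normr_ge0 _)) mulrC; congr (_ * _)%R.
  by rewrite normfV (gtr0_norm rh) -(powR_inv1 (ltW rh)) -powRrM mulN1r.
rewrite -(powR_mulrn _ (ltW r0)) -powRrM mulrAC [RHS]mulrA; congr (_ * _)%R.
rewrite -!powRD//; congr (_ `^ _)%R.
have pn0 : p != 0%R by rewrite gt_eqF.
rewrite /hexp -natr1; by field.
Qed.

Let mPsi := measurable_Psi s p n.

(** For [hexp > 0] and [r < 1], [1 - r^hexp] is nonnegative, so [wy - r^hexp wy = |1 - r^hexp|^p].
    For [hexp < 0] the sign is reversed and so are the roles of [kintP] and [kintQ]. *)
Lemma intPQC_pos : (0 < hexp)%R -> kintP = kintQ + kintC.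
Proof.
move=> h0; have m1 := measurable_wy; have m2 := measurable_wx.
rewrite /kintP /kintQ /kintC -ge0_integralD; last 5 first.
- exact: measurable_itv.
- move=> r; rewrite /= in_itv/= andbT => r0; rewrite mule_ge0 ?Psi_ge0// lee_fin.
  by rewrite mulr_ge0 ?exprn_ge0 ?(ltW r0)// mulr_ge0// powR_ge0.
- by apply: measurable_funTS; meas.
- by move=> r _; rewrite mule_ge0 ?Psi_ge0// lee_fin mulr_ge0// mulr_ge0// powR_ge0.
- by apply: measurable_funTS; meas.
apply: eq_integral => r; rewrite inE/= in_itv/= andbT => r0.
rewrite -ge0_muleDl; last 2 first.
- by rewrite lee_fin mulr_ge0 ?exprn_ge0 ?(ltW r0)// mulr_ge0// powR_ge0.
- by rewrite lee_fin mulr_ge0// mulr_ge0// powR_ge0.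
congr (_ * _); rewrite -EFinD; congr EFin.
have [Jr|_] := boolP (J r); last by rewrite !mul0r addr0.
have [_ r1] := andP (J01 Jr).
have rle : (0 <= 1 - r `^ hexp)%R.
  rewrite subr_ge0 -(powRr0 r); apply: ger_powR; first by rewrite r0 ltW.
  exact: ltW.
rewrite !mul1r wx_wy// -(mulr_powRB1 (normr_ge0 (1 - r `^ hexp)%R) p0) /wy (ger0_norm rle).
by ring.
Qed.

Lemma intPQC_neg : (hexp < 0)%R -> kintQ = kintP + kintC.
Proof.
move=> h0; have m1 := measurable_wy; have m2 := measurable_wx.
rewrite /kintP /kintQ /kintC -ge0_integralD; last 5 first.
- exact: measurable_itv.
- move=> r; rewrite /= in_itv/= andbT => r0; rewrite mule_ge0 ?Psi_ge0// lee_fin.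
  by rewrite mulr_ge0 ?powR_ge0// mulr_ge0// powR_ge0.
- by apply: measurable_funTS; meas.
- by move=> r _; rewrite mule_ge0 ?Psi_ge0// lee_fin mulr_ge0// mulr_ge0// powR_ge0.
- by apply: measurable_funTS; meas.
apply: eq_integral => r; rewrite inE/= in_itv/= andbT => r0.
rewrite -ge0_muleDl; last 2 first.
- by rewrite lee_fin mulr_ge0 ?powR_ge0// mulr_ge0// powR_ge0.
- by rewrite lee_fin mulr_ge0// mulr_ge0// powR_ge0.
congr (_ * _); rewrite -EFinD; congr EFin.
have [Jr|_] := boolP (J r); last by rewrite !mul0r addr0.
have [_ r1] := andP (J01 Jr).
have rle : (1 - r `^ hexp <= 0)%R.
  rewrite subr_le0 -{1}(powRr0 r); apply: ger_powR; first by rewrite r0 ltW.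
  exact: ltW.
rewrite !mul1r wx_wy// -(mulr_powRB1 (normr_ge0 (1 - r `^ hexp)%R) p0) /wy (ler0_norm rle).
by ring.
Qed.

Variable u : T -> R.
Hypothesis mu_u : measurable_fun setT u.

Definition hardyB := \int[lebN n.+1]_x (`|u x| `^ p * nrm x `^ (- (p * s)))%:E.

Let ps_neq0 : (- (p * s) != 0)%R. Proof. by rewrite oppr_eq0 mulf_neq0// gt_eqF. Qed.

Let nrm0 x : ~~ (0 < sqnorm x)%R -> nrm x = 0%R.
Proof.
rewrite -leNgt => x0; rewrite /nrm (_ : sqnorm x = 0)%R ?sqrtr0//.
by apply/eqP; rewrite eq_le x0 sqnorm_ge0.
Qed.

Lemma dint_wx : dlint (fun x y => ((Jxy x y)%:R * (wx (nrm y / nrm x) * `|u x| `^ p * ker x y))%:E) =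
  kintQ * hardyB.
Proof.
have m2 := measurable_wx.
have mb : measurable_fun setT (fun r => (J r)%:R * wx r)%R by meas.
have b0 r : (0 <= (J r)%:R * wx r)%R by rewrite mulr_ge0// powR_ge0.
have Q0 : 0 <= kintQ.
  apply: integral_ge0 => r; rewrite /= in_itv/= andbT => r0; rewrite mule_ge0 ?Psi_ge0// lee_fin.
  by rewrite mulr_ge0 ?exprn_ge0 ?(ltW r0)// mulr_ge0// powR_ge0.
have mn := measurable_nrm.
rewrite /hardyB -ge0_integralZl; last 4 first.
- by [].
- by meas.
- by move=> x _; rewrite lee_fin mulr_ge0// powR_ge0.
- by [].
rewrite /dint; apply: eq_integral => x _.
have [x0|x0] := boolP (0 < sqnorm x)%R; last first.
  (* At [x = 0] the Hardy weight [0^(-ps)] is [0] by convention, and the cutoff discards the pair,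
     so both sides vanish. *)
  rewrite (nrm0 x0) (powR0 ps_neq0) mulr0 mule0 integral0_eq// => y _.
  by rewrite /Jxy (negbTE x0) mul0r.
have ms := @measurable_sqnorm R n.+1; have md := @measurable_dotp R n.+1.
transitivity ((`|u x| `^ p)%:E * \int[lebN n.+1]_y
   ((J (nrm y / nrm x))%:R * wx (nrm y / nrm x) * ker x y)%:E).
  have mq : measurable_fun setT (fun y : T => nrm y / nrm x)%R.
    by apply: measurable_funM => //; exact: measurable_cst.
  have mky : measurable_fun setT (fun y : T => ker x y).
    by apply: (measurableT_comp measurable_ker (g := pair x)); exact: pair1_measurable.
  rewrite -ge0_integralZl; last 4 first.
  - by [].
  - by apply/measurable_EFinP; apply: measurable_funM; [exact: (measurableT_comp mb mq)|exact: mky].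
  - by move=> y _; rewrite lee_fin mulr_ge0 ?ker_ge0.
  - by rewrite lee_fin powR_ge0.
  by apply: eq_integral => y _; rewrite /Jxy x0/= -EFinM; congr EFin; ring.
by rewrite (integral_kernel _ _ mb b0 x0) -/kintQ -/(nrm x) muleA -EFinM muleC.
Qed.

(** Here [y] is held fixed and [x] is integrated, so the natural radius is [|x|/|y|], the inverse of
    the one in [J]. Inverting it, with the homogeneity of [Psi], restores [r] and explains the
    density [r^(ps - 1)] of [kintP]. *)
Lemma dint_wy : dlint (fun x y => ((Jxy x y)%:R * (wy (nrm y / nrm x) * `|u y| `^ p * ker x y))%:E) =
  kintP * hardyB.
Proof.
(* Cutoff and weight in the inverted radius; the factor [0 < r] mirrors the requirement
   [0 < sqnorm x] in [Jxy]. *)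
pose b r : R := ((0 < r)%R%:R * ((J r^-1)%:R * wy r^-1))%R.
have m1 := measurable_wy.
have mJV : measurable_fun setT (fun r : R => J r^-1) by apply: (measurableT_comp mJ measurable_invr).
have mwV : measurable_fun setT (fun r : R => wy r^-1) by apply: (measurableT_comp m1 measurable_invr).
have mb : measurable_fun setT b.
  rewrite /b; apply: measurable_funM; last by apply: measurable_funM => //; exact: measurable_boolR.
  apply: measurable_boolR; apply: measurable_fun_ltr; first exact: measurable_cst.
  exact: measurable_id.
have m2 := measurable_Jxy; have mk := measurable_ker.
have b0 (r : R) : (0 <= b r)%R by rewrite !mulr_ge0// powR_ge0.
have P0 : 0 <= kintP.
  apply: integral_ge0 => r _; rewrite mule_ge0 ?Psi_ge0// lee_fin.
  by rewrite mulr_ge0 ?powR_ge0// mulr_ge0// powR_ge0.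
have mn := measurable_nrm.
have mbx (y : T) : measurable_fun setT (fun x : T => b (nrm x / nrm y)%R).
  by apply: (measurableT_comp mb); apply: measurable_funM.
have mky (y : T) : measurable_fun setT (fun x : T => ker y x).
  by apply: (measurableT_comp mk (g := pair y)); exact: pair1_measurable.
have mW : measurable_fun setT (fun z : T * T =>
    ((Jxy z.1 z.2)%:R * (wy (nrm z.2 / nrm z.1) * `|u z.2| `^ p * ker z.1 z.2))%:E).
  apply/measurable_EFinP/measurable_funM; first exact: measurable_boolR.
  apply: measurable_funM => //; apply: measurable_funM.
    by apply: (measurableT_comp m1); clear m2 mk mb mJV mwV mbx mky; meas.
  by clear m2 mk mb mJV mwV mbx mky; meas.
rewrite dintC; last 2 first.
- exact: mW.
- by move=> x y; rewrite lee_fin !mulr_ge0 ?ker_ge0 ?powR_ge0.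
rewrite /hardyB -ge0_integralZl; last 4 first.
- by [].
- by clear mW m2 mk mb mJV mwV mbx mky; meas.
- by move=> x _; rewrite lee_fin mulr_ge0// powR_ge0.
- by [].
rewrite /dint; apply: eq_integral => y _.
have [y0|y0] := boolP (0 < sqnorm y)%R; last first.
  rewrite (nrm0 y0) (powR0 ps_neq0) mulr0 mule0 integral0_eq// => x _.
  have [/JxyP|_] := boolP (Jxy x y); last by rewrite mul0r.
  by rewrite (nrm0 y0) ltxx.
have ny : (0 < nrm y)%R by rewrite sqrtr_gt0.
have ms := @measurable_sqnorm R n.+1; have md := @measurable_dotp R n.+1.
transitivity ((`|u y| `^ p)%:E * \int[lebN n.+1]_x (b (nrm x / nrm y)%R * ker y x)%:E).
  rewrite -ge0_integralZl; last 4 first.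
  - by [].
  - by apply/measurable_EFinP; apply: measurable_funM; [exact: mbx|exact: mky].
  - by move=> x _; rewrite lee_fin mulr_ge0 ?ker_ge0.
  - by rewrite lee_fin powR_ge0.
  apply: eq_integral => x _; rewrite -EFinM; congr EFin.
  have -> : b (nrm x / nrm y)%R = ((Jxy x y)%:R * wy (nrm y / nrm x))%R.
    rewrite /b invf_div /Jxy pmulr_lgt0 ?invr_gt0// /nrm sqrtr_gt0.
    by case: (0 < sqnorm x)%R; rewrite ?mul1r// !mul0r.
  by rewrite kerC; ring.
rewrite (integral_kernel _ _ mb b0 y0) -/(nrm y) muleA -EFinM muleC; congr (_ * _).
rewrite ge0_integral_inv; last 2 first.
- apply: emeasurable_funM => //; apply/measurable_EFinP/measurable_funM => //.
- by move=> r r0; rewrite mule_ge0 ?Psi_ge0// lee_fin mulr_ge0// exprn_ge0// ltW.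
apply: eq_integral => r; rewrite inE/= in_itv/= andbT => r0.
rewrite Psi_inv// !muleA -!EFinM; congr (EFin _ * _).
rewrite /b invrK invr_gt0 r0 mul1r.
have I a : a ==> (r != 0%R) by rewrite gt_eqF// implybT.
have <- : (r ^- 2 * (r^-1 ^+ n * r `^ (n.+1%:R + p * s)) = r `^ (p * s - 1))%R.
  rewrite exprVn -!(powR_invn _ (ltW r0)) -!powRD//; congr (_ `^ _)%R.
  by rewrite -natr1; ring.
by ring.
Qed.

Let v x := (nrm x `^ hexp * u x)%R.

Definition hardyD x y := (`|v x - v y| `^ p * ker x y
  * nrm x `^ (- ((n.+1%:R - p * s) / 2)) * nrm y `^ (- ((n.+1%:R - p * s) / 2)))%R.
Definition hardyA x y := (`|u x - u y| `^ p * ker x y)%R.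

Lemma measurable_hardyA : measurable_fun setT (fun z : T * T => hardyA z.1 z.2).
Proof. by rewrite /hardyA; have mk := measurable_ker; meas. Qed.

Lemma measurable_hardyD : measurable_fun setT (fun z : T * T => hardyD z.1 z.2).
Proof. by rewrite /hardyD /v; have mk := measurable_ker; have mn := measurable_nrm; meas. Qed.

Lemma hardyA_ge0 x y : (0 <= hardyA x y)%R.
Proof. by rewrite mulr_ge0 ?ker_ge0 ?powR_ge0. Qed.

Lemma hardyD_ge0 x y : (0 <= hardyD x y)%R.
Proof. by rewrite !mulr_ge0 ?ker_ge0 ?powR_ge0. Qed.

Let Wx x y := (wx (nrm y / nrm x) * `|u x| `^ p * ker x y)%R.
Let Wy x y := (wy (nrm y / nrm x) * `|u y| `^ p * ker x y)%R.

(** The witnesses are [|x|^(-hexp)] and [|y|^(-hexp)]; then [(w1 w2)^(p/2)] has the exponent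
    [-(N - ps)/2] of the remainder weights. As [|y| < |x|], the sign of [hexp] orders [w1] and
    [w2]. *)
Let pointwise_data x y : Jxy x y ->
  exists w1 w2, [/\ (0 < w1)%R /\ (0 < w2)%R,
    (w1 * v x = u x)%R /\ (w2 * v y = u y)%R,
    wx (nrm y / nrm x) = (`|(w2 - w1) / w1| `^ (p - 1))%R /\
    wy (nrm y / nrm x) = (`|(w2 - w1) / w2| `^ (p - 1))%R,
    (hardyD x y = (w1 * w2) `^ (p / 2) * `|v x - v y| `^ p * ker x y)%R &
    ((0 < hexp)%R -> (w1 < w2)%R) /\ ((hexp < 0)%R -> (w2 < w1)%R)].
Proof.
move=> /JxyP/andP[ny nyx]; have nx : (0 < nrm x)%R by exact: lt_trans nyx.
have I z a : (0 < z)%R -> a ==> (z != 0 :> R)%R by move=> /gt_eqF ->; rewrite implybT.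
have inv z : (0 < z)%R -> (z `^ (- hexp) * z `^ hexp = 1 :> R)%R.
  by move=> z0; rewrite -powRD ?I// addNr powRr0.
exists (nrm x `^ (- hexp))%R, (nrm y `^ (- hexp))%R.
have q1 : ((nrm y / nrm x) `^ hexp = nrm x `^ (- hexp) / nrm y `^ (- hexp))%R.
  rewrite (powRM _ (ltW ny)) ?invr_ge0 ?(ltW nx)// -(powR_inv1 (ltW nx)) -powRrM mulN1r.
  by rewrite mulrC; congr (_ * _)%R; rewrite -powRN opprK.
have w1p : (0 < nrm x `^ (- hexp))%R by rewrite powR_gt0.
have w2p : (0 < nrm y `^ (- hexp))%R by rewrite powR_gt0.
split.
- by split.
- by split; rewrite /v mulrA ?(inv _ nx) ?(inv _ ny) mul1r.
- split.
    rewrite /wx powRN q1 invf_div; congr (`|_| `^ _)%R; field.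
    by rewrite gt_eqF.
  rewrite /wy q1; congr (`|_| `^ _)%R; field.
  by rewrite gt_eqF.
- rewrite /hardyD (powRM _ (ltW w1p) (ltW w2p)) -!powRrM.
  have -> : (- hexp * (p / 2) = - ((n.+1%:R - p * s) / 2))%R.
    by rewrite /hexp; field; rewrite gt_eqF.
  by ring.
- split => h.
    rewrite !powRN ltf_pV2 ?posrE ?powR_gt0//.
    by apply: gt0_ltr_powR; rewrite ?nnegrE ?nrm_ge0.
  by apply: gt0_ltr_powR; rewrite ?nnegrE ?nrm_ge0 ?oppr_gt0.
Qed.

(** For [hexp > 0] the larger weight sits at [y], so the pointwise inequality is applied with [y] as
    its first point; the case [hexp < 0] keeps the order. *)
Let pw_pos x y : (0 < hexp)%R -> Jxy x y ->
  (Wy x y + c_p p * hardyD x y <= hardyA x y + Wx x y)%R /\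
  (p = 2%R -> Wy x y + c_p p * hardyD x y = hardyA x y + Wx x y)%R.
Proof.
move=> h Jx; have [w1 [w2 [[w10 w20] [ex ey] [fx fy] fD [/(_ h) w12 _]]]] := pointwise_data Jx.
have wI : (0 < w1 < w2)%R by rewrite w10.
rewrite /Wy /Wx /hardyA fx fy fD -ex -ey (distrC (w1 * _)%R) (distrC (v x)) (mulrC w1 w2).
split.
  have := ler_wpM2r (ker_ge0 x y) (ground_state_weighted p2 (v y) (v x) wI).
  by rewrite !mulrDl; lra.
move=> pE; have := ground_state_weighted2 p2 (v y) (v x) pE wI => /(congr1 (fun z => z * ker x y)%R).
by rewrite !mulrDl; lra.
Qed.

Let pw_neg x y : (hexp < 0)%R -> Jxy x y ->
  (Wx x y + c_p p * hardyD x y <= hardyA x y + Wy x y)%R /\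
  (p = 2%R -> Wx x y + c_p p * hardyD x y = hardyA x y + Wy x y)%R.
Proof.
move=> h Jx; have [w1 [w2 [[w10 w20] [ex ey] [fx fy] fD [_ /(_ h) w12]]]] := pointwise_data Jx.
have wI : (0 < w2 < w1)%R by rewrite w20.
have Nd (z : R) : `|(w2 - w1) / z|%R = `|(w1 - w2) / z|%R by rewrite !normrM distrC.
rewrite /Wy /Wx /hardyA fx fy fD -ex -ey !Nd.
split.
  have := ler_wpM2r (ker_ge0 x y) (ground_state_weighted p2 (v x) (v y) wI).
  by rewrite !mulrDl; lra.
move=> pE; have := ground_state_weighted2 p2 (v x) (v y) pE wI => /(congr1 (fun z => z * ker x y)%R).
by rewrite !mulrDl; lra.
Qed.

Definition kcut (f : T -> T -> R) x y := ((Jxy x y)%:R%:E * (f x y)%:E).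

Let mcut f : measurable_fun setT (fun z : T * T => f z.1 z.2) ->
  measurable_fun setT (fun z : T * T => kcut f z.1 z.2).
Proof. by move=> mf; rewrite /kcut; have m2 := measurable_Jxy; meas. Qed.

Let cut_ge0 f : (forall x y, (0 <= f x y)%R) -> forall x y, 0 <= kcut f x y.
Proof. by move=> f0 x y; rewrite mule_ge0// lee_fin. Qed.

(** After integration both sides contain the same multiple of the Hardy integral, because the larger
    radial constant is the smaller one plus [kintC]. The finiteness hypotheses are what permits
    cancelling it. *)
Lemma cutoff_hardy : hardyB \is a fin_num -> kintP \is a fin_num -> kintQ \is a fin_num ->
  (kintC * hardyB + (c_p p)%:E * dlint (kcut hardyD) <= dlint (kcut hardyA)) /\
  (p = 2%R -> kintC * hardyB + (c_p p)%:E * dlint (kcut hardyD) = dlint (kcut hardyA)).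
Proof.
move=> Bf Pf Qf.
have /andP[c0 _] := c_p_bounds p2.
have mA := measurable_hardyA; have mD := measurable_hardyD.
have m1 := measurable_wy; have m2 := measurable_wx; have mn := measurable_nrm.
have mk := measurable_ker.
have mq : measurable_fun setT (fun z : T * T => nrm z.2 / nrm z.1)%R.
  apply: measurable_funM; first exact: (measurableT_comp mn measurable_snd).
  apply: (measurableT_comp measurable_invr); exact: (measurableT_comp mn measurable_fst).
have mWx : measurable_fun setT (fun z : T * T => Wx z.1 z.2).
  apply: measurable_funM; last exact: mk.
  apply: measurable_funM; first exact: (measurableT_comp m2 mq).
  apply: measurable_powRT; apply: (measurableT_comp (@normr_measurable _ setT)).
  exact: (measurableT_comp mu_u measurable_fst).
have mWy : measurable_fun setT (fun z : T * T => Wy z.1 z.2).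
  apply: measurable_funM; last exact: mk.
  apply: measurable_funM; first exact: (measurableT_comp m1 mq).
  apply: measurable_powRT; apply: (measurableT_comp (@normr_measurable _ setT)).
  exact: (measurableT_comp mu_u measurable_snd).
have Wx0 x y : (0 <= Wx x y)%R by rewrite !mulr_ge0 ?ker_ge0 ?powR_ge0.
have Wy0 x y : (0 <= Wy x y)%R by rewrite !mulr_ge0 ?ker_ge0 ?powR_ge0.
have IWx : dlint (kcut Wx) = kintQ * hardyB.
  by rewrite -dint_wx; apply: eq_dint => x y; rewrite /kcut -EFinM.
have IWy : dlint (kcut Wy) = kintP * hardyB.
  by rewrite -dint_wy; apply: eq_dint => x y; rewrite /kcut -EFinM.
have C0 : 0 <= kintC.
  by apply: integral_ge0 => r _; rewrite mule_ge0 ?Psi_ge0// lee_fin mulr_ge0// mulr_ge0// powR_ge0.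
have B0 : 0 <= hardyB by apply: integral_ge0 => x _; rewrite lee_fin mulr_ge0// powR_ge0.
have P0 : 0 <= kintP.
  apply: integral_ge0 => r _; rewrite mule_ge0 ?Psi_ge0// lee_fin.
  by rewrite mulr_ge0 ?powR_ge0// mulr_ge0// powR_ge0.
have Q0 : 0 <= kintQ.
  apply: integral_ge0 => r; rewrite /= in_itv/= andbT => r0; rewrite mule_ge0 ?Psi_ge0// lee_fin.
  by rewrite mulr_ge0 ?exprn_ge0 ?(ltW r0)// mulr_ge0// powR_ge0.
have cD0 := dint_ge0 (lebN n.+1) (cut_ge0 hardyD_ge0).
have cA0 := dint_ge0 (lebN n.+1) (cut_ge0 hardyA_ge0).
(* [W1] and [I1] belong to the larger radial constant, [W2] and [I2] to the smaller; the two signs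
   of [hexp] only exchange them. *)
have gen (W1 W2 : T -> T -> R) (I1 I2 : \bar R) :
    measurable_fun setT (fun z : T * T => W1 z.1 z.2) ->
    measurable_fun setT (fun z : T * T => W2 z.1 z.2) ->
    (forall x y, (0 <= W1 x y)%R) -> (forall x y, (0 <= W2 x y)%R) ->
    dlint (kcut W1) = I1 * hardyB -> dlint (kcut W2) = I2 * hardyB ->
    0 <= I2 -> I2 \is a fin_num -> I1 = I2 + kintC ->
    (forall x y, Jxy x y -> (W1 x y + c_p p * hardyD x y <= hardyA x y + W2 x y)%R /\
      (p = 2%R -> W1 x y + c_p p * hardyD x y = hardyA x y + W2 x y)%R) ->
    (kintC * hardyB + (c_p p)%:E * dlint (kcut hardyD) <= dlint (kcut hardyA)) /\
    (p = 2%R -> kintC * hardyB + (c_p p)%:E * dlint (kcut hardyD) = dlint (kcut hardyA)).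
  move=> mW1 mW2 W10 W20 E1 E2 I20 I2f IE pw.
  pose L x y := kcut W1 x y + (c_p p)%:E * kcut hardyD x y.
  pose M x y := kcut hardyA x y + kcut W2 x y.
  have mcD := mcut mD; have mcA := mcut mA; have mc1 := mcut mW1; have mc2 := mcut mW2.
  have mL : measurable_fun setT (fun z : T * T => L z.1 z.2).
    by apply: emeasurable_funD; [exact: mc1|apply: emeasurable_funM; [exact: measurable_cst|exact: mcD]].
  have mM : measurable_fun setT (fun z : T * T => M z.1 z.2) by apply: emeasurable_funD; [exact: mcA|exact: mc2].
  have mcD' : measurable_fun setT (fun z : T * T => (c_p p)%:E * kcut hardyD z.1 z.2).
    by apply: emeasurable_funM; [exact: measurable_cst|exact: mcD].
  have c0D x y : 0 <= (c_p p)%:E * kcut hardyD x y.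
    by rewrite mule_ge0 ?cut_ge0 ?lee_fin ?(ltW c0)//; exact: hardyD_ge0.
  have L0 x y : 0 <= L x y by rewrite adde_ge0// cut_ge0.
  have LE : dlint L = (kintC * hardyB + (c_p p)%:E * dlint (kcut hardyD)) + I2 * hardyB.
    rewrite /L dintD//; last by move=> x y; exact: cut_ge0.
    rewrite dintZl ?(ltW c0)//; last by move=> x y; apply: cut_ge0; exact: hardyD_ge0.
    by rewrite E1 IE ge0_muleDl// -addeA addeC.
  have ME : dlint M = dlint (kcut hardyA) + I2 * hardyB.
    rewrite /M dintD// ?E2//; first by move=> x y; apply: cut_ge0; exact: hardyA_ge0.
    by move=> x y; exact: cut_ge0.
  have If : I2 * hardyB \is a fin_num by rewrite fin_numM.
  have LM x y : L x y <= M x y.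
    rewrite /L /M /kcut; have [Jx|_] := boolP (Jxy x y); last by rewrite !mul0e mule0 !adde0.
    by rewrite !mul1e -EFinM -!EFinD lee_fin; exact: (pw _ _ Jx).1.
  split.
    have := le_dint (lebN n.+1) mL mM L0 LM; rewrite LE ME.
    by rewrite leeD2rE.
  move=> pE; have : dlint L = dlint M.
    apply: eq_dint => x y; rewrite /L /M /kcut; have [Jx|_] := boolP (Jxy x y); last by rewrite !mul0e mule0 !adde0.
    by rewrite !mul1e -EFinM -!EFinD; congr EFin; exact: (pw _ _ Jx).2.
  rewrite LE ME => E; apply/eqP; rewrite eq_le; apply/andP; split.
    by rewrite -(leeD2rE _ _ If) E.
  by rewrite -(leeD2rE _ _ If) E.
have [h|h|h] := ltgtP hexp 0%R; last by move: hexp_neq0; rewrite h eqxx.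
  apply: (gen Wx Wy kintQ kintP) => //; first exact: intPQC_neg.
  by move=> x y Jx; exact: pw_neg.
apply: (gen Wy Wx kintP kintQ) => //; first exact: intPQC_pos.
by move=> x y Jx; exact: pw_pos.
Qed.

End cutoff.

(** * Size of the averaged kernel near the singular radius *)

Section Psi_bounds.
Context {R : realType}.
Variables (s p : R).
Hypothesis p2 : 2 <= p.
Hypothesis s0 : 0 < s.
Hypothesis s1 : s < 1.
Local Open Scope ereal_scope.
Local Notation mu := (@lebesgue_measure R).
Implicit Types (n : nat) (r t : R).

Let p0 : (0 < p)%R. Proof. by rewrite (lt_le_trans _ p2). Qed.
Let ps0 : (0 < p * s)%R. Proof. by rewrite mulr_gt0. Qed.

Let kexp_lt0 n : (kexp s p n < 0)%R.
Proof.
rewrite /kexp ltr_pdivrMr// mul0r oppr_lt0 addr_gt0//.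
Qed.

Let powR_anti (a x y : R) : (a <= 0)%R -> (0 < x <= y)%R -> (y `^ a <= x `^ a)%R.
Proof.
move=> a0 /andP[x0 xy]; have y0 : (0 < y)%R by exact: lt_le_trans xy.
rewrite -[a]opprK !(powRN _ (- a)) lef_pV2 ?posrE ?powR_gt0//.
by apply: ge0_ler_powR; rewrite ?oppr_ge0// nnegrE ltW.
Qed.

Let kbase_ge r t : (0 <= r < 1)%R -> (-1 <= t <= 1)%R ->
  (0 < (1 - r) ^+ 2 <= 1 - 2 * r * t + r ^+ 2)%R.
Proof.
move=> /andP[r0 r1] /andP[t1 t2]; rewrite exprn_gt0 ?subr_gt0//=; nra.
Qed.

Let arc_bound m t : (-1 < t < 1)%R ->
  ((1 - t ^+ 2) `^ ((m.+2%:R - 3) / 2) <= (1 - t ^+ 2) `^ (- 2^-1) :> R)%R.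
Proof.
move=> /andP[t1 t2]; apply: ger_powR; first by apply/andP; split; nra.
have : (0 <= m%:R :> R)%R by [].
rewrite (_ : m.+2%:R = m%:R + 2 :> R)%R; last by rewrite -!natr1; ring.
lra.
Qed.

Let measurable_arc (a : R) : measurable_fun setT (fun t : R => ((1 - t ^+ 2) `^ a)%:E).
Proof. by meas. Qed.

(** The kernel base is at least [(1 - r)^2], and the angular density is at most the arcsine density,
    of mass [pi]. For [N >= 2] the resulting order at [r = 1] is not sharp, so this bound serves
    away from that radius. *)
Lemma Psi_le n : exists2 K : R, (0 <= K)%R & forall r, (0 <= r < 1)%R ->
  Psi s p n r <= (K * ((1 - r) ^+ 2) `^ kexp s p n)%:E.
Proof.
have kle r t : (0 <= r < 1)%R -> (-1 <= t <= 1)%R -> (kfun s p n r t <= ((1 - r) ^+ 2) `^ kexp s p n)%R.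
  by move=> rI tI; apply: powR_anti; [exact: ltW|exact: kbase_ge].
case: n kle => [|m] kle.
  exists 2%R => // r rI; rewrite /= lee_fin mulrDl mul1r.
  by apply: lerD; apply: kle => //; apply/andP; split; lra.
exists (sphere_area R m * pi)%R; first by rewrite mulr_ge0 ?sphere_area_ge0// pi_ge0.
move=> r rI; rewrite /= -mulrA EFinM; apply: lee_wpmul2l; first by rewrite lee_fin sphere_area_ge0.
rewrite [X in _ <= X%:E]mulrC [X in _ <= X]EFinM -integral_arcsine -ge0_integralZl; last 4 first.
- exact: measurable_itv.
- by apply: measurable_funTS; exact: measurable_arc.
- by move=> t _; rewrite lee_fin powR_ge0.
- by rewrite lee_fin powR_ge0.
have mk := measurable_kfun s p m.+1.
apply: ge0_le_integral.
- exact: measurable_itv.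
- by move=> t _; rewrite lee_fin mulr_ge0// powR_ge0.
- by apply: measurable_funTS; meas.
- by apply: measurable_funTS; apply: emeasurable_funM => //; exact: measurable_arc.
move=> t; rewrite /= in_itv/= => tI.
rewrite -EFinM lee_fin mulrC; apply: ler_pM; rewrite ?powR_ge0//.
  by apply: kle => //; have [? ?] := andP tI; rewrite !ltW.
exact: arc_bound.
Qed.

Let integral_pow_refl (a : R) : (0 < a)%R ->
  \int[mu]_(t in `](-1)%R, 1%R[) ((1 - t) `^ (a - 1))%:E = (2 `^ a / a)%:E.
Proof.
move=> a0; rewrite -(integral_powR_itv a0 (ltr0n _ 2)).
rewrite (integral_mu_boolR (b := fun t => -1 < t < 1)%R); last by apply/seteqP; split => t /=; rewrite in_itv.
rewrite [RHS](integral_mu_boolR (b := fun t => 0 < t < 2)%R); last by apply/seteqP; split => t /=; rewrite in_itv.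
pose g (q : R) : \bar R := (0 < q < 2)%R%:R%:E * (q `^ (a - 1))%:E.
have mg : measurable_fun setT g by rewrite /g; meas.
have g0 q : 0 <= g q by rewrite mule_ge0// lee_fin powR_ge0.
have n0 : (-1 != 0 :> R)%R by rewrite oppr_eq0 oner_eq0.
rewrite -[RHS](ge0_integral_affine 1 n0 mg g0) normrN normr1 mul1e.
apply: eq_integral => t _; rewrite /g mulN1r (addrC _ 1%R).
by congr (_ * _); congr ((nat_of_bool _)%:R%:E); apply/andP/andP => -[? ?]; split; lra.
Qed.

Let integral_pow_refl' (a : R) : (0 < a)%R ->
  \int[mu]_(t in `](-1)%R, 1%R[) ((1 + t) `^ (a - 1))%:E = (2 `^ a / a)%:E.
Proof.
move=> a0; rewrite -(integral_powR_itv a0 (ltr0n _ 2)).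
rewrite (integral_mu_boolR (b := fun t => -1 < t < 1)%R); last by apply/seteqP; split => t /=; rewrite in_itv.
rewrite [RHS](integral_mu_boolR (b := fun t => 0 < t < 2)%R); last by apply/seteqP; split => t /=; rewrite in_itv.
pose g (q : R) : \bar R := (0 < q < 2)%R%:R%:E * (q `^ (a - 1))%:E.
have mg : measurable_fun setT g by rewrite /g; meas.
have g0 q : 0 <= g q by rewrite mule_ge0// lee_fin powR_ge0.
rewrite -[RHS](ge0_integral_shift 1 mg g0).
apply: eq_integral => t _; rewrite /g (addrC _ 1%R).
by congr (_ * _); congr ((nat_of_bool _)%:R%:E); apply/andP/andP => -[? ?]; split; lra.
Qed.

(* Interpolating [1 - 2 r t + r^2] between [(1 - r)^2] and [1 - t] costs an
   arbitrarily small power [eta] of [1 - r]. *)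
Lemma Psi_near1 n (eta : R) : (0 < eta <= 1)%R -> exists2 K : R, (0 <= K)%R &
  forall r, (1 / 2 <= r < 1)%R -> Psi s p n r <= (K * (1 - r) `^ (-1 - p * s - eta))%:E.
Proof.
move=> /andP[e0 e1].
case: n => [|m].
  have [K K0 HK] := Psi_le 0; exists K => // r /andP[r0 r1].
  have rp : (0 < 1 - r)%R by lra.
  apply: (le_trans (HK r _)); first by apply/andP; split; lra.
  rewrite lee_fin ler_wpM2l// -(powR_mulrn _ (ltW rp)) -powRrM.
  by apply: ger_powR; [apply/andP; split; lra|rewrite /kexp; lra].
(* The power [-ka] of the base is spent on [1 - t]: it leaves the integrable [(1 - t)^(eta/2 - 1)]
   in the angle, and the rest of the exponent gives [(1 - r)^(-1 - ps - eta)]. *)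
pose ka : R := ((m.+1%:R - eta) / 2)%R.
have m0 : (0 <= m%:R :> R)%R by [].
have mS : (m.+1%:R = m%:R + 1 :> R)%R by rewrite natr1.
have mSS : (m.+2%:R = m%:R + 2 :> R)%R by rewrite -!natr1; ring.
have ka0 : (0 <= ka)%R by rewrite /ka mS; lra.
have kka : (kexp s p m.+1 + ka <= 0)%R by rewrite /kexp /ka mSS mS; have := ps0; lra.
pose M : R := (2 `^ ((m.+1%:R) / 2) * (2 `^ (eta / 2) / (eta / 2) + 2 `^ (2^-1) / 2^-1))%R.
have M0 : (0 <= M)%R by rewrite mulr_ge0 ?powR_ge0// addr_ge0// divr_ge0 ?powR_ge0// divr_ge0// ltW.
exists (sphere_area R m * M)%R; first by rewrite mulr_ge0// sphere_area_ge0.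
move=> r /andP[r0 r1]; have rp : (0 < 1 - r)%R by lra.
rewrite /= -mulrA EFinM; apply: lee_wpmul2l; first by rewrite lee_fin sphere_area_ge0.
have mk := measurable_kfun s p m.+1.
apply: (@le_trans _ _ (\int[mu]_(t in `](-1)%R, 1%R[)
   (((1 - r) `^ (-1 - p * s - eta) * 2 `^ (m.+1%:R / 2))%:E *
    (((1 - t) `^ (eta / 2 - 1))%:E + ((1 + t) `^ (2^-1 - 1))%:E)))).
  apply: ge0_le_integral.
  - exact: measurable_itv.
  - by move=> t _; rewrite lee_fin mulr_ge0// powR_ge0.
  - by apply: measurable_funTS; meas.
  - apply: measurable_funTS; apply: emeasurable_funM => //.
    by apply: emeasurable_funD; meas.
  move=> t; rewrite /= in_itv/= => /andP[t1 t2].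
  rewrite -EFinD -EFinM lee_fin.
  have tp : (0 < 1 - t)%R by lra.
  have tq : (0 < 1 + t)%R by lra.
  have tI : (-1 <= t <= 1)%R by rewrite !ltW.
  have rI : (0 <= r < 1)%R by apply/andP; split; lra.
  have [b0 bge] := andP (kbase_ge rI tI).
  (* The difference is [r^2 - (2 r - 1) t], at least [(1 - r)^2] because [r >= 1/2] and [t <= 1]. *)
  have bt : (1 - t <= 1 - 2 * r * t + r ^+ 2)%R by nra.
  have Bp : (0 < 1 - 2 * r * t + r ^+ 2)%R by exact: lt_le_trans bge.
  have k1 : (kfun s p m.+1 r t <= (1 - r) `^ (-1 - p * s - eta) * (1 - t) `^ (- ka))%R.
    have -> : ((1 - r) `^ (-1 - p * s - eta) = ((1 - r) ^+ 2) `^ (kexp s p m.+1 + ka))%R.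
      rewrite -(powR_mulrn _ (ltW rp)) -powRrM; congr (_ `^ _)%R.
      by rewrite /kexp /ka mSS mS; field.
    rewrite /kfun (_ : kexp s p m.+1 = kexp s p m.+1 + ka - ka)%R; last by ring.
    rewrite powRD; last by rewrite (gt_eqF Bp) /= implybT.
    rewrite (_ : kexp s p m.+1 + ka - ka + ka = kexp s p m.+1 + ka)%R; last by ring.
    apply: ler_pM; rewrite ?powR_ge0//; apply: powR_anti => //.
    - by rewrite b0.
    - by rewrite oppr_le0.
    - by rewrite tp.
  have k2 : ((1 - t ^+ 2) `^ ((m.+2%:R - 3) / 2) * (1 - t) `^ (- ka) <=
      2 `^ (m.+1%:R / 2) * ((1 - t) `^ (eta / 2 - 1) + (1 + t) `^ (2^-1 - 1)))%R.
    rewrite (_ : 1 - t ^+ 2 = (1 - t) * (1 + t))%R; last by ring.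
    rewrite (powRM _ (ltW tp) (ltW tq)) mulrAC -powRD; last by rewrite (gt_eqF tp) /= implybT.
    rewrite (_ : (m.+2%:R - 3) / 2 - ka = eta / 2 - 1)%R; last by rewrite /ka mSS mS; field.
    rewrite (_ : (m.+2%:R - 3) / 2 = m%:R / 2 + (2^-1 - 1))%R; last by rewrite mSS; field.
    rewrite [X in (_ * X <= _)%R]powRD; last by rewrite (gt_eqF tq) /= implybT.
    rewrite mulrCA; apply: ler_pM; rewrite ?powR_ge0 ?mulr_ge0 ?powR_ge0//.
      apply: (@le_trans _ _ (2 `^ (m%:R / 2))%R).
        apply: ge0_ler_powR; rewrite ?nnegrE ?divr_ge0//; [exact: ltW|lra].
      by apply: ler_powR; [lra|rewrite mS; lra].
    have le1 (x a : R) : (1 <= x)%R -> (a <= 0)%R -> (x `^ a <= 1)%R.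
      by move=> x1 a0; rewrite -(powRr0 x); exact: ler_powR.
    (* On each sign of [t] one of the two endpoint singularities is at most one, so their product is
       bounded by their sum. *)
    have [tn|tn] := leP t 0%R.
      have h1 : ((1 - t) `^ (eta / 2 - 1) <= 1)%R by apply: le1; lra.
      have h2 := powR_ge0 (1 + t)%R (2^-1 - 1)%R; have h3 := powR_ge0 (1 - t)%R (eta / 2 - 1)%R.
      by nra.
    have h1 : ((1 + t) `^ (2^-1 - 1) <= 1)%R by apply: le1; lra.
    have h2 := powR_ge0 (1 + t)%R (2^-1 - 1)%R; have h3 := powR_ge0 (1 - t)%R (eta / 2 - 1)%R.
    by nra.
  have h4 := powR_ge0 (1 - t ^+ 2)%R ((m.+2%:R - 3) / 2)%R.
  apply: (le_trans (ler_wpM2l h4 k1)).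
  rewrite mulrCA -!mulrA; apply: ler_wpM2l => //; exact: powR_ge0.
rewrite ge0_integralZl; last 4 first.
- exact: measurable_itv.
- by apply: measurable_funTS; apply: emeasurable_funD; meas.
- by move=> t _; rewrite -EFinD lee_fin addr_ge0// powR_ge0.
- by rewrite lee_fin mulr_ge0// powR_ge0.
rewrite ge0_integralD; last 5 first.
- exact: measurable_itv.
- by move=> t _; rewrite lee_fin powR_ge0.
- by apply: measurable_funTS; meas.
- by move=> t _; rewrite lee_fin powR_ge0.
- by apply: measurable_funTS; meas.
rewrite integral_pow_refl ?divr_gt0// integral_pow_refl' ?invr_gt0//.
rewrite -EFinD -EFinM lee_fin le_eqVlt; apply/orP; left; apply/eqP; rewrite /M; by ring.
Qed.

Lemma integral_gt0 (D : set R) (f : R -> \bar R) : measurable D -> 0 < mu D ->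
  measurable_fun D f -> (forall x, D x -> 0 < f x) -> 0 < \int[mu]_(x in D) f x.
Proof.
move=> mD D0 mf f0; rewrite lt_neqAle integral_ge0 ?andbT; last by move=> x /f0/ltW.
apply/eqP => /esym I0.
have : \int[mu]_(x in D) `|f x| = 0.
  by rewrite -[RHS]I0; apply: eq_integral => x /set_mem /f0/ltW/gee0_abs.
move=> /(ae_eq_integral_abs mu mD mf).1 [A [mA A0 sub]].
have DA : D `<=` A.
  by move=> x Dx; apply: sub => /= /(_ Dx) fx; have := f0 x Dx; rewrite fx ltxx.
have h := le_measure mu (mem_set mD) (mem_set mA) DA.
have : mu D <= 0 by rewrite -A0.
by rewrite leNgt D0.
Qed.

Lemma Psi_gt0 n r : (0 < r < 1)%R -> 0 < Psi s p n r.
Proof.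
move=> /andP[r0 r1].
have kpos m t : (-1 <= t <= 1)%R -> (0 < kfun s p m r t)%R.
  move=> tI; apply: powR_gt0.
  have rI : (0 <= r < 1)%R by rewrite ltW.
  by have [h /(lt_le_trans h)] := andP (kbase_ge rI tI).
case: n => [|m] /=; first by rewrite lte_fin addr_gt0// kpos//; apply/andP; split; lra.
have sa k : (0 < sphere_area R k)%R.
  elim/ltn_ind: k => -[|[|k]] ih //=; first by rewrite mulr_gt0// pi_gt0.
  by rewrite mulr_gt0 ?ih// divr_gt0// mulr_gt0// pi_gt0.
apply: mule_gt0; first by rewrite lte_fin.
have mk := measurable_kfun s p m.+1.
apply: integral_gt0.
- exact: measurable_itv.
- by rewrite /= lebesgue_measure_itv/= lte_fin (_ : (-1 < 1)%R) -?EFinB ?lte_fin; lra.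
- by apply: measurable_funTS; meas.
- move=> t; rewrite /= in_itv/= => /andP[t1 t2].
  by rewrite lte_fin mulr_gt0// ?kpos ?ltW// powR_gt0//; nra.
Qed.

End Psi_bounds.

(** * Finiteness and positivity of the radial constants *)

Section finiteness.
Context {R : realType}.
Variables (s p : R) (n : nat).
Hypothesis p2 : 2 <= p.
Hypothesis s0 : 0 < s.
Hypothesis s1 : s < 1.
Local Open Scope ereal_scope.
Local Notation mu := (@lebesgue_measure R).
Local Notation Psi := (Psi s p n).

Let p0 : (0 < p)%R. Proof. by rewrite (lt_le_trans _ p2). Qed.
Let ps0 : (0 < p * s)%R. Proof. exact: mulr_gt0. Qed.

Lemma powR_le_norm (d r a : R) : (0 < d)%R -> (d <= r <= 1)%R -> (r `^ a <= d `^ (- `|a|))%R.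
Proof.
move=> d0 /andP[dr r1]; have r0 := lt_le_trans d0 dr.
rewrite /powR !gt_eqF// ler_expR mulNr -mulrN.
have l1 : (ln d <= ln r)%R by rewrite ler_ln ?posrE.
have l2 : (ln r <= 0)%R by rewrite -ln1 ler_ln ?posrE.
apply: (@le_trans _ _ (`|a| * - ln r)%R); last by rewrite ler_wpM2l// lerN2.
by rewrite -(ler0_norm l2) -normrM ler_norm.
Qed.

Lemma norm_1subr_expR (t : R) : (`|1 - expR t| <= `|t| * expR `|t|)%R.
Proof.
have [t0|t0] := leP 0%R t.
  rewrite (ger0_norm t0) ler0_norm; last by rewrite subr_le0 -expR0 ler_expR.
  have := ler_wpM2l (expR_ge0 t) (expR_ge1Dx (- t)%R).
  by rewrite -expRD subrr expR0; lra.
rewrite (ltr0_norm t0) ger0_norm; last by rewrite subr_ge0 -expR0 ler_expR ltW.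
have h1 := expR_ge1Dx t.
have h2 : (1 <= expR (- t))%R by rewrite -{1}expR0 ler_expR oppr_ge0 ltW.
have : (- t <= - t * expR (- t))%R by rewrite ler_peMr// oppr_ge0 ltW.
by lra.
Qed.

(** With [t = h ln r], the estimate [|1 - e^t| <= |t| e^|t|] applies, and [|ln r| <= 2 (1 - r)] for
    [r >= 1/2]; hence also [|t| <= |h|]. *)
Lemma norm_1subr_powR (h r : R) : (1 / 2 <= r < 1)%R ->
  (`|1 - r `^ h| <= (2 * `|h| * expR `|h|) * (1 - r))%R.
Proof.
move=> /andP[r2 r1]; have r0 : (0 < r)%R by lra.
have rV : (r^-1 <= 2)%R by rewrite -[2%R]invrK lef_pV2 ?posrE//; lra.
have l2 : (ln r <= 0)%R by rewrite -ln1 ler_ln ?posrE//; lra.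
have l1 : (`|ln r| <= 2 * (1 - r))%R.
  rewrite (ler0_norm l2) -lnV ?posrE//.
  have rV0 : (0 < r^-1)%R by rewrite invr_gt0.
  have lr : (ln r^-1 <= r^-1 - 1)%R.
    have /le_ln1Dx : (-1 < r^-1 - 1)%R by lra.
    by rewrite (_ : 1 + (r^-1 - 1) = r^-1)%R; last by ring.
  apply: le_trans lr _.
  have -> : (r^-1 - 1 = r^-1 * (1 - r))%R by rewrite mulrBr mulVf ?gt_eqF// mulr1.
  by rewrite ler_wpM2r// subr_ge0 ltW.
rewrite /powR gt_eqF//.
have t1 : (`|h * ln r| <= `|h| * (2 * (1 - r)))%R by rewrite normrM ler_wpM2l.
have t2 : (`|h * ln r| <= `|h|)%R.
  by apply: le_trans t1 _; rewrite ler_piMr//; lra.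
apply: le_trans (norm_1subr_expR _) _.
apply: (@le_trans _ _ (`|h| * (2 * (1 - r)) * expR `|h|)%R).
  by apply: ler_pM => //; rewrite ?expR_ge0 ?ler_expR.
by rewrite le_eqVlt; apply/orP; left; apply/eqP; ring.
Qed.

Lemma integral_pos_01 (F : R -> \bar R) : (forall r, (1 <= r)%R -> F r = 0) ->
  \int[mu]_(r in `]0%R, +oo[) F r = \int[mu]_(r in `]0%R, 1%R[) F r.
Proof.
move=> F1; have D1 : (`]0%R, 1%R[%classic : set R) = [set r | (0 < r < 1)%R].
  by apply/seteqP; split => r /=; rewrite in_itv.
rewrite integral_pos_boolR (integral_mu_boolR _ D1).
apply: eq_integral => r _; have [r1|r1] := ltP r 1%R; first by rewrite andbT.
by rewrite F1// !mule0.
Qed.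

Lemma kexp_mono (a b : R) : (0 < a <= b)%R -> (b `^ kexp s p n <= a `^ kexp s p n)%R.
Proof.
move=> /andP[a0 ab]; have b0 := lt_le_trans a0 ab.
have k0 : (0 <= (n.+1%:R + p * s) / 2)%R by rewrite divr_ge0// addr_ge0// ltW.
rewrite /kexp mulNr !powRN lef_pV2 ?posrE ?powR_gt0//.
by apply: ge0_ler_powR => //; rewrite nnegrE ltW.
Qed.

Lemma int_Psi_bounded (d M : R) (b : R -> bool) (g : R -> R) : (0 < d)%R ->
  (forall r, b r -> (d <= r <= 1 - d)%R) ->
  measurable_fun setT b -> measurable_fun setT g -> (forall r, b r -> (0 <= g r <= M)%R) ->
  \int[mu]_(r in `]0%R, +oo[) (((b r)%:R * g r)%:E * Psi r) < +oo.
Proof.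
move=> d0 bd mb mg gM; have [K K0 KP] := Psi_le p2 s0 n.
have mP := @measurable_Psi R s p n.
rewrite integral_pos_01; last first.
  move=> r r1; have [/bd/andP[_ ?]|_] := boolP (b r); last by rewrite mul0r mul0e.
  by exfalso; lra.
apply: (@le_lt_trans _ _ (\int[mu]_(r in `]0%R, 1%R[) cst (`|M| * (K * (d ^+ 2) `^ kexp s p n))%:E r)).
  apply: ge0_le_integral.
  - exact: measurable_itv.
  - move=> r _; have [br|_] := boolP (b r); last by rewrite mul0r mul0e.
    by rewrite mule_ge0 ?Psi_ge0// lee_fin mul1r; have /andP[] := gM _ br.
  - by apply: measurable_funTS; meas.
  - exact: measurable_cst.
  - move=> r; rewrite /= in_itv/= => /andP[r0 r1].
    have K'0 : (0 <= K * (d ^+ 2) `^ kexp s p n)%R by rewrite mulr_ge0// powR_ge0.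
    have [br|_] := boolP (b r); last by rewrite mul0r mul0e lee_fin mulr_ge0.
    have /andP[g0 gm] := gM _ br; have /andP[dr rd] := bd _ br.
    rewrite mul1r EFinM; apply: lee_pmul; rewrite ?lee_fin ?Psi_ge0//.
      exact: le_trans gm (ler_norm _).
    apply: le_trans (KP r _) _; first by rewrite (ltW r0).
    rewrite lee_fin ler_wpM2l// kexp_mono// exprn_gt0//= ler_pXn2r// ?nnegrE; lra.
rewrite integral_cst; last exact: measurable_itv.
by rewrite /= lebesgue_measure_itv /= lte_fin ltr01 -EFinB -EFinM ltry.
Qed.

Lemma integral_1subr_powR (a : R) : (0 < a)%R ->
  \int[mu]_(r in `]0%R, 1%R[) ((1 - r) `^ (a - 1))%:E = (1 / a)%:E.
Proof.
move=> a0; have <- : (1 `^ a / a = 1 / a :> R)%R by rewrite powR1.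
rewrite -(integral_powR_itv a0 ltr01).
have D1 : (`]0%R, 1%R[%classic : set R) = [set r | (0 < r < 1)%R].
  by apply/seteqP; split => r /=; rewrite in_itv.
rewrite !(integral_mu_boolR _ D1).
pose f (r : R) := (0 < r < 1)%R%:R%:E * (r `^ (a - 1))%:E.
have mf : measurable_fun setT f by rewrite /f; meas.
have f0 r : 0 <= f r by rewrite mule_ge0 ?lee_fin ?powR_ge0.
have n1 : (-1 != 0 :> R)%R by rewrite oppr_eq0 oner_eq0.
rewrite -[RHS](@ge0_integral_affine R f (-1)%R 1%R n1 mf f0) normrN normr1 mul1e.
apply: eq_integral => r _; rewrite /f mulN1r (addrC (- r)%R).
have -> // : (0 < 1 - r < 1)%R = (0 < r < 1)%R.
by rewrite subr_gt0 ltrBlDr ltrDl andbC.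
Qed.

(** Near [r = 1] the factor [|1 - r^h|^p] is of order [(1 - r)^p], and against the kernel it leaves
    [(1 - r)^(p (1 - s) - eta - 1)], integrable for small [eta]. Near [r = 0] the kernel average is
    bounded and [r^(ps - 1)] is integrable. *)
Lemma int_CPsi_fin (h : R) : (p * h = n.+1%:R - p * s)%R ->
  \int[mu]_(r in `]0%R, +oo[)
    (((0 < r < 1)%R%:R * (r `^ (p * s - 1) * `|1 - r `^ h| `^ p))%:E * Psi r) < +oo.
Proof.
move=> ph; have [Ka Ka0 KaP] := Psi_le p2 s0 n.
have mP := @measurable_Psi R s p n.
have q0 : (0 < p * (1 - s))%R by rewrite mulr_gt0// subr_gt0.
(* Half of the minimum keeps [eta <= 1], as the bound near [r = 1] requires, and leaves
   [a = p (1 - s) - eta] positive. *)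
pose eta : R := (Num.min 1 (p * (1 - s)) / 2)%R.
have m1 : (0 < Num.min 1 (p * (1 - s)))%R by rewrite lt_min ltr01.
have m2 : (Num.min 1 (p * (1 - s)) <= 1)%R by rewrite ge_min lexx.
have m3 : (Num.min 1 (p * (1 - s)) <= p * (1 - s))%R by rewrite ge_min lexx orbT.
have eta01 : (0 < eta <= 1)%R by rewrite /eta; apply/andP; split; lra.
have [Kb Kb0 KbP] := Psi_near1 p2 s0 n eta01.
pose a : R := (p * (1 - s) - eta)%R.
have a0 : (0 < a)%R by rewrite /a /eta; lra.
pose K1 := (Ka * ((1 / 2) ^+ 2) `^ kexp s p n)%R.
have K10 : (0 <= K1)%R by rewrite mulr_ge0// powR_ge0.
pose L := (2 * `|h| * expR `|h|)%R.
have L0 : (0 <= L)%R by rewrite !mulr_ge0// expR_ge0.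
pose K2 := ((1 / 2) `^ (- `|p * s - 1|) * L `^ p * Kb)%R.
have K20 : (0 <= K2)%R by rewrite !mulr_ge0// powR_ge0.
rewrite integral_pos_01; last by move=> r r1; rewrite [(r < 1)%R]ltNge r1 andbF mul0r mul0e.
have mi : measurable (`]0%R, 1%R[%classic : set (measurableTypeR R)) by exact: measurable_itv.
(* For [h < 0] the product is at most [r^(ps - 1 + p h)], which is [r^(N - 1)], hence at most one;
   for [h >= 0] the second factor is at most one. *)
have g_le (r : R) : (0 < r < 1)%R -> (r `^ (p * s - 1) * `|1 - r `^ h| `^ p <= r `^ (p * s - 1) + 1)%R.
  move=> /andP[r0 r1]; have I c : c ==> (r != 0%R) by rewrite gt_eqF// implybT.
  have [h0|h0] := leP 0%R h.
    apply: (@le_trans _ _ (r `^ (p * s - 1))%R); last by rewrite lerDl.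
    have e1 : (1 `^ p = 1 :> R)%R by rewrite powR1.
    rewrite ler_piMr ?powR_ge0// -[leRHS]e1.
    apply: ge0_ler_powR; rewrite ?nnegrE ?(ltW p0)//.
    have : (r `^ h <= 1)%R by rewrite -(powRr0 r); apply: ger_powR => //; rewrite r0 (ltW r1).
    by have := powR_ge0 r h; rewrite ler_norml => ? ?; apply/andP; split; lra.
  apply: (@le_trans _ _ 1%R); last by rewrite lerDr powR_ge0.
  have rh : (1 <= r `^ h)%R by rewrite -{1}(powRr0 r); apply: ger_powR; [rewrite r0 (ltW r1)|exact: ltW].
  apply: (@le_trans _ _ (r `^ (p * s - 1) * (r `^ h) `^ p)%R).
    rewrite ler_wpM2l ?powR_ge0//; apply: ge0_ler_powR; rewrite ?nnegrE ?(ltW p0) ?powR_ge0//.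
    by rewrite ler_norml; apply/andP; split; lra.
  rewrite -powRrM -powRD// (mulrC h) ph -[leRHS](powRr0 r); apply: ger_powR; first by rewrite r0 (ltW r1).
  by have := ler0n R n; rewrite -natr1; lra.
pose B1 (r : R) := (K1 * r `^ (p * s - 1))%:E.
pose B2 (r : R) := (K2 * (1 - r) `^ (a - 1))%:E.
have mB1 : measurable_fun (`]0%R, 1%R[%classic : set (measurableTypeR R)) B1.
  by apply: measurable_funTS; rewrite /B1; meas.
have mB2 : measurable_fun (`]0%R, 1%R[%classic : set (measurableTypeR R)) B2.
  by apply: measurable_funTS; rewrite /B2; meas.
have mB12 : measurable_fun (`]0%R, 1%R[%classic : set (measurableTypeR R)) (fun r => B1 r + B2 r).
  exact: emeasurable_funD.
have B10 r : 0 <= B1 r by rewrite lee_fin mulr_ge0// powR_ge0.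
have B20 r : 0 <= B2 r by rewrite lee_fin mulr_ge0// powR_ge0.
apply: (@le_lt_trans _ _ (\int[mu]_(r in `]0%R, 1%R[) ((B1 r + B2 r) + cst K1%:E r))).
  apply: ge0_le_integral.
  - exact: mi.
  - by move=> r _; rewrite mule_ge0 ?Psi_ge0// lee_fin !mulr_ge0 ?powR_ge0.
  - by apply: measurable_funTS; meas.
  - by apply: emeasurable_funD => //; exact: measurable_cst.
  - move=> r; rewrite /= in_itv/= => r01; rewrite r01 mul1r.
    have /andP[r0 r1] := r01.
    have gp : (0 <= r `^ (p * s - 1) * `|1 - r `^ h| `^ p)%R by rewrite mulr_ge0// powR_ge0.
    have [r2|r2] := leP r (1/2)%R.
      apply: (@le_trans _ _ (B1 r + K1%:E)); last first.
        by rewrite addeAC leeDl.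
      rewrite /B1 -EFinD.
      apply: (@le_trans _ _ ((r `^ (p * s - 1) + 1)%:E * K1%:E)); last first.
        by rewrite -EFinM lee_fin le_eqVlt; apply/orP; left; apply/eqP; ring.
      apply: lee_pmul; rewrite ?lee_fin ?Psi_ge0//; first exact: g_le.
      apply: le_trans (KaP r _) _; first by rewrite (ltW r0).
      by rewrite lee_fin ler_wpM2l// kexp_mono// exprn_gt0//= ?ler_pXn2r// ?nnegrE; lra.
    apply: (@le_trans _ _ (B2 r)); last first.
      by apply: (@le_trans _ _ (B1 r + B2 r)); [apply: leeDr|apply: leeDl; rewrite lee_fin].
    have r2' : (1 / 2 <= r < 1)%R by rewrite (ltW r2).
    apply: (@le_trans _ _ (((1 / 2) `^ (- `|p * s - 1|) * (L * (1 - r)) `^ p)%:E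
        * (Kb * (1 - r) `^ (-1 - p * s - eta))%:E)).
      apply: lee_pmul; rewrite ?lee_fin ?Psi_ge0//; last exact: KbP.
      apply: ler_pM; rewrite ?powR_ge0//.
        by apply: powR_le_norm; [lra|apply/andP; split; lra].
      apply: ge0_ler_powR; rewrite ?nnegrE ?(ltW p0)//.
        by rewrite mulr_ge0// subr_ge0 ltW.
      exact: norm_1subr_powR.
    have q1 : (0 < 1 - r)%R by rewrite subr_gt0.
    have I c : c ==> ((1 - r)%R != 0%R) by rewrite gt_eqF// implybT.
    rewrite /B2 -EFinM lee_fin (powRM _ L0 (ltW q1)) /K2.
    have -> : ((1 - r) `^ (a - 1) = (1 - r) `^ p * (1 - r) `^ (-1 - p * s - eta))%R.
      by rewrite -powRD//; congr (_ `^ _)%R; rewrite /a; ring.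
    by rewrite le_eqVlt; apply/orP; left; apply/eqP; ring.
rewrite ge0_integralD; last 5 first.
- exact: mi.
- by move=> r _; rewrite adde_ge0.
- exact: mB12.
- by move=> r _; rewrite lee_fin.
- exact: measurable_cst.
rewrite ge0_integralD; last 5 first.
- exact: mi.
- by move=> r _.
- exact: mB1.
- by move=> r _.
- exact: mB2.
rewrite integral_cst; last exact: measurable_itv.
rewrite [X in _ + X](_ : _ = K1%:E); last first.
  by rewrite /= lebesgue_measure_itv /= lte_fin ltr01 -EFinB -EFinM subr0 mulr1.
have mW (f : R -> R) : measurable_fun setT f ->
    measurable_fun (`]0%R, 1%R[%classic : set (measurableTypeR R)) (fun r => (f r)%:E).
  by move=> mf; apply: measurable_funTS; apply/measurable_EFinP.
rewrite /B1 /B2.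
under eq_integral do rewrite EFinM.
rewrite ge0_integralZl; last 4 first.
- exact: mi.
- by apply: mW; meas.
- by move=> r _; rewrite lee_fin powR_ge0.
- by rewrite lee_fin.
rewrite (integral_powR_itv ps0 ltr01).
under [X in _ * _ + X]eq_integral do rewrite EFinM.
rewrite [X in _ * _ + X]ge0_integralZl; last 4 first.
- exact: mi.
- by apply: mW; meas.
- by move=> r _; rewrite lee_fin powR_ge0.
- by rewrite lee_fin.
by rewrite (integral_1subr_powR a0) -!EFinM -!EFinD ltry.
Qed.

(** Positivity of the constant in the inequality with a fixed cutoff, by which the Hardy integral is
    later bounded; [h != 0] makes [|1 - r^h|] positive. *)
Lemma int_CPsi_gt0 (h : R) : h != 0%R ->
  0 < \int[mu]_(r in `]0%R, +oo[)
    (((1/4 <= r <= 1/2)%R%:R * (r `^ (p * s - 1) * `|1 - r `^ h| `^ p))%:E * Psi r).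
Proof.
move=> h0; have mP := @measurable_Psi R s p n.
have D1 : (`[(1/4)%R, (1/2)%R]%classic : set R) = [set r | (1/4 <= r <= 1/2)%R].
  by apply/seteqP; split => r /=; rewrite in_itv.
have -> : \int[mu]_(r in `]0%R, +oo[)
    (((1/4 <= r <= 1/2)%R%:R * (r `^ (p * s - 1) * `|1 - r `^ h| `^ p))%:E * Psi r) =
  \int[mu]_(r in `[(1/4)%R, (1/2)%R]) ((r `^ (p * s - 1) * `|1 - r `^ h| `^ p)%:E * Psi r).
  rewrite integral_pos_boolR (integral_mu_boolR _ D1); apply: eq_integral => r _.
  have [/andP[r4 _]|_] := boolP (1/4 <= r <= 1/2)%R; last by rewrite mul0r !mul0e mule0.
  by rewrite (_ : (0 < r)%R) ?mul1e ?mul1r//; lra.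
apply: integral_gt0.
- exact: measurable_itv.
- by rewrite lebesgue_measure_itv /= lte_fin ifT -?EFinB ?lte_fin; lra.
- by apply: measurable_funTS; meas.
move=> r; rewrite /= in_itv/= => /andP[r4 r2].
have r0 : (0 < r)%R by lra.
have r1 : (r < 1)%R by lra.
rewrite mule_gt0 ?Psi_gt0 ?r0// lte_fin mulr_gt0 ?powR_gt0// normr_gt0 subr_eq0.
have lr : (ln r < 0)%R by rewrite ln_lt0// r0.
rewrite eq_sym /powR (gt_eqF r0); apply/eqP; rewrite -[RHS]expR0 => /expR_inj/eqP.
by rewrite mulf_eq0 (negbTE h0) (lt_eqF lr).
Qed.

End finiteness.

(** * Test functions: measurability, bounds and supports *)

Section test_functions.
Context {R : realType}.
Local Open Scope ereal_scope.
Local Notation mu := (@lebesgue_measure R).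

(** Monotonicity taken directly from the supremum over simple functions, without measurability:
    [ae_N] integrates the indicator of a set that need not be measurable. *)
Lemma ge0_le_integralT d (T : measurableType d) (m : {measure set T -> \bar R}) (f g : T -> \bar R) :
  (forall x, 0 <= f x) -> (forall x, f x <= g x) -> \int[m]_x f x <= \int[m]_x g x.
Proof.
move=> f0 fg; have g0 x : 0 <= g x by exact: le_trans (f0 x) (fg x).
rewrite (ge0_integralTE _ f0) (ge0_integralTE _ g0).
apply: le_ereal_sup => _ [h /= hf <-]; exists h => //= x.
exact: le_trans (hf x) (fg x).
Qed.

Lemma iint_ge0 n (f : n.-tuple R -> \bar R) : (forall t, 0 <= f t) -> 0 <= iint f.
Proof.
elim: n f => [|n IH] f f0 /=; first exact: f0.
by apply: integral_ge0 => x _; exact: IH.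
Qed.

Lemma le_iint n (f g : n.-tuple R -> \bar R) :
  (forall t, 0 <= f t) -> (forall t, f t <= g t) -> iint f <= iint g.
Proof.
elim: n f g => [|n IH] f g f0 fg /=; first exact: fg.
by apply: ge0_le_integralT => x; [exact: iint_ge0|exact: IH].
Qed.

Local Close Scope ereal_scope.

(** The preimage of an open ray is the union of the countably many boxes with rational centre and
    radius [1/(k + 1)] that it contains, and boxes are measurable for the product structure on
    tuples. *)
Lemma continuous_measurableN N (f : 'rV[R]_N -> R) : continuous f -> measurableN f.
Proof.
move=> cf; rewrite /measurableN.
have H := @measurability _ _ _ (measurableTypeR R) setT (fun t : N.-tuple R => f (tup2row t)) _ (RGenOInfty.measurableE R).
apply: H => _ [_ [r ->] <-]; rewrite setTI.
pose box (z : N.-tuple rat * nat) : set (N.-tuple R) :=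
  [set t | forall i, `|tnth t i - ratr (tnth z.1 i)| < z.2.+1%:R^-1].
pose good z := box z `<=` (fun t : N.-tuple R => f (tup2row t)) @^-1` `]r, +oo[.
rewrite (_ : _ @^-1` _ = \bigcup_z (if `[< good z >] then box z else set0)); last first.
  apply/seteqP; split => [t /=|t [z _]]; last by case: asboolP => // gz /gz.
  rewrite in_itv/= andbT => ft.
  have : \forall x \near tup2row t, r < f x by exact: (cvgr_gt _ (cf (tup2row t)) _ ft).
  move=> /nbhs_ballP[e /= e0 ball_sub].
  (* This makes [2 c < e] for [c = 1/(k + 1)]: [t] and any point of the box both lie within [c] of
     the rational centre in each coordinate. *)
  pose k := Num.bound (2 / e).
  pose c : R := k.+1%:R^-1.
  have ke : 2 * c < e.
    rewrite /c ltr_pdivrMr ?ltr0n// mulrC -ltr_pdivrMr//.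
    apply: lt_trans (archi_boundP _) _; first by rewrite divr_ge0// ltW.
    by rewrite ltr_nat.
  have k0 : 0 < c by rewrite invr_gt0 ltr0n.
  have /choice[q qP] : forall i : 'I_N, exists q : rat, `|tnth t i - ratr q| < c.
    move=> i; have [|q] := @rat_in_itvoo R (tnth t i - c) (tnth t i + c).
      by lra.
    by rewrite in_itv/= => /andP[q1 q2]; exists q; rewrite ltr_norml; apply/andP; split; lra.
  exists ([tuple q i | i < N], k) => //; case: asboolP => [_ i /=|[]].
    by rewrite tnth_mktuple; exact: qP.
  move=> t' /= t'q; rewrite in_itv/= andbT; apply: ball_sub.
  have B : @mx_ball 1 N R R (tup2row t) e (tup2row t').
    split => // i j; rewrite !mxE /ball /= .
    have h1 := qP j; have := t'q j; rewrite tnth_mktuple -/c => h2.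
    rewrite -(subrK (ratr (q j)) (tnth t j)) -addrA.
    apply: le_lt_trans (ler_normD _ _) _; rewrite distrC in h2.
    by apply: lt_trans ke; lra.
  exact: B.
apply: countable_bigcupT_measurable; first exact: countableP.
move=> z; case: ifP => _; last exact: measurable0.
have -> : box z = \bigcap_(i in [set: 'I_N])
    [set t | `|tnth t i - ratr (tnth z.1 i)| < z.2.+1%:R^-1].
  by apply/seteqP; split => [t bt i _|t bt i]; [exact: bt|exact: (bt i I)].
apply: fin_bigcap_measurable; first exact: finite_finset.
move=> i _; apply: measurable_set_bool; apply: measurable_fun_ltr; last exact: measurable_cst.
apply: (measurableT_comp (@normr_measurable _ setT)); apply: measurable_funB.
  exact: measurable_tnth.
exact: measurable_cst.
Qed.

Lemma compact_continuous_bounded N (K : set 'rV[R]_N) (g : 'rV[R]_N -> R) :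
  compact K -> continuous g -> exists2 C, 0 <= C & forall x, K x -> `|g x| <= C.
Proof.
move=> cK cg.
have /compact_bounded : compact (g @` K) by apply: continuous_compact => //; exact: continuous_subspaceT.
move=> [C0 [_ HC]]; exists (`|C0| + 1); first by rewrite addr_ge0.
move=> x Kx; apply: (HC (`|C0| + 1)); first by rewrite (le_lt_trans (ler_norm _))// ltrDl.
by exists x.
Qed.

Lemma smooth_continuous N (f : 'rV[R]_N -> R) : smooth f -> continuous f.
Proof. by move=> sf x; apply: differentiable_continuous; exact: (sf [::] x). Qed.

Lemma compact_support_bounded N (f : 'rV[R]_N -> R) :
  continuous f -> compact (fsupport f) ->
  exists C M, [/\ 0 <= C, 0 < M, forall x, `|f x| <= C &
    forall t : N.-tuple R, f (tup2row t) != 0 -> sqnorm t < M].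
Proof.
move=> cf cK; have [C C0 CP] := compact_continuous_bounded cK cf.
have /choice[M MP] : forall i : 'I_N, exists M : R, forall x : 'rV[R]_N, fsupport f x -> `|x ord0 i| <= M.
  move=> i; have [|M _ MP] := @compact_continuous_bounded _ _ (fun x : 'rV[R]_N => x ord0 i) cK.
    exact: coord_continuous.
  by exists M.
exists C, (\sum_i M i ^+ 2 + 1); split => //.
- by rewrite ltr_wpDl// sumr_ge0// => i _; rewrite sqr_ge0.
- move=> x; have [->|fx] := eqVneq (f x) 0; first by rewrite normr0.
  by apply: CP; exact: subset_closure.
- move=> t ft; rewrite ltr_pwDr// ler_sum// => i _.
  have := MP i (tup2row t) (@subset_closure _ [set x | f x != 0] (tup2row t) ft); rewrite mxE => h.
  by rewrite -(real_normK (num_real (tnth t i))) lerXn2r ?nnegrE// (le_trans _ h).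
Qed.

Lemma punctured_support N (f : 'rV[R]_N -> R) : ~ fsupport f 0 ->
  exists2 e, 0 < e & forall t : N.-tuple R, sqnorm t < e ^+ 2 -> f (tup2row t) = 0.
Proof.
rewrite /fsupport /closure /= => /existsNP[B /not_implyP[/nbhs_ballP[e /= e0 eB] H]].
exists e => // t te; apply/eqP; apply: contrapT => /negP ft; apply: H; exists (tup2row t); split => //.
apply: eB.
have Bm : @mx_ball 1 N R R (0%R : 'rV[R]_N) e (tup2row t).
  split => // i j; rewrite !mxE /ball /= sub0r normrN.
  rewrite -(ltr_pXn2r (n := 2)) ?nnegrE ?normr_ge0 ?(ltW e0)// real_normK ?num_real//.
  apply: le_lt_trans te; rewrite /sqnorm (bigD1 j)//= lerDl sumr_ge0// => k _.
  exact: sqr_ge0.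
exact: Bm.
Qed.

End test_functions.

(** * Removal of the cutoff *)

Section hardy.
Context {R : realType}.
Variables (n : nat) (s p : R).
Hypothesis p2 : 2 <= p.
Hypothesis s0 : 0 < s.
Hypothesis s1 : s < 1.
Local Open Scope ereal_scope.
Local Notation mu := (@lebesgue_measure R).
Local Notation T := (n.+1.-tuple R).
Local Notation dlint := (@dint _ T R (lebN n.+1)).
Local Notation h := (hexp n s p).
Hypothesis h_neq0 : h != 0%R.

Let p0 : (0 < p)%R. Proof. by rewrite (lt_le_trans _ p2). Qed.
Let p1 : (0 <= p - 1)%R. Proof. by rewrite subr_ge0 (le_trans _ p2)// ler1n. Qed.
Let ph : (p * h = n.+1%:R - p * s)%R.
Proof. by rewrite /hexp mulrC divfK// gt_eqF. Qed.

(** The radial formula turns the measure of the sphere into an integral over the single value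
    [Q = c]. *)
Lemma lebN_sphere (c : R) : lebN n.+1 [set t : T | sqnorm t = c] = 0.
Proof.
have ms := @measurable_sqnorm R n.+1.
have E : [set t : T | sqnorm t = c] = [set t : T | ((sqnorm t <= c) && (c <= sqnorm t))%R].
  by apply/seteqP; split => t /=; [move=> ->; rewrite lexx|exact: le_anti].
have mS : measurable [set t : T | sqnorm t = c].
  by rewrite E; apply: measurable_set_bool; meas.
have := integral_indic (lebN n.+1) measurableT mS; rewrite setIT => <-.
pose g (Q : R) : \bar R := ((Q <= c) && (c <= Q))%R%:R%:E.
have mg : measurable_fun setT g by rewrite /g; meas.
have g0 (Q : R) : 0 <= g Q by rewrite lee_fin.
transitivity (\int[lebN n.+1]_t g (sqnorm t)).
  apply: eq_integral => t _; rewrite /g indicE.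
  have -> // : (t \in [set t : T | sqnorm t = c]) = ((sqnorm t <= c) && (c <= sqnorm t))%R.
  apply/idP/idP => [|/le_anti H]; last by rewrite inE.
  by rewrite inE /= => ->; rewrite lexx.
rewrite (radial_formulaP n mg g0) (@ae_eq_integral _ _ R mu _ (cst 0)); last 4 first.
- exact: measurable_itv.
- by apply: measurable_funTS; meas.
- exact: measurable_cst.
- exists [set c]; split; [exact: measurable_set1|exact: lebesgue_measure_set1|].
  move=> Q /= nH; apply: contrapT => Qc; apply: nH => _; rewrite /g.
  have -> : ((Q <= c) && (c <= Q))%R = false by apply/negbTE/negP => /le_anti.
  by rewrite mule0.
by rewrite integral_cst ?mul0e ?mule0//; exact: measurable_itv.
Qed.

Definition unitJ (r : R) := (0 < r < 1)%R.

Lemma measurable_unitJ : measurable_fun setT unitJ.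
Proof. by rewrite /unitJ; meas. Qed.

Lemma Jxy_unit (x y : T) : (0 < nrm x)%R -> (0 < nrm y)%R ->
  Jxy unitJ x y = (nrm y < nrm x)%R.
Proof.
move=> x0 y0; rewrite /Jxy /unitJ -sqrtr_gt0 -/(nrm x) x0 /=.
by rewrite divr_gt0// ltr_pdivrMr// mul1r.
Qed.

(* Spheres are null sets, so the diagonal [|x| = |y|] can be dropped. *)
Lemma dint_symmetric (f : T -> T -> \bar R) :
  measurable_fun setT (fun z : T * T => f z.1 z.2) -> (forall x y, 0 <= f x y) ->
  (forall x y, f x y = f y x) ->
  dlint f = 2%:E * dlint (fun x y => (Jxy unitJ x y)%:R%:E * f x y).
Proof.
move=> mf f0 fC; have mJ := measurable_Jxy (n := n) measurable_unitJ.
pose g x y := (Jxy unitJ x y)%:R%:E * f x y.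
have g0 x y : 0 <= g x y by rewrite mule_ge0// lee_fin.
have mg : measurable_fun setT (fun z : T * T => g z.1 z.2) by rewrite /g; meas.
have mgC : measurable_fun setT (fun z : T * T => g z.2 z.1).
  by apply: (measurable_fun_app mg); [exact: measurable_snd|exact: measurable_fst].
have mS (c : R) : measurable [set t : T | sqnorm t = c].
  have ms := @measurable_sqnorm R n.+1.
  have -> : [set t : T | sqnorm t = c] = [set t : T | ((sqnorm t <= c) && (c <= sqnorm t))%R].
    by apply/seteqP; split => t /=; [move=> ->; rewrite lexx|exact: le_anti].
  by apply: measurable_set_bool; meas.
have null2 (c c' : R) : lebN n.+1 ([set t : T | sqnorm t = c] `|` [set t : T | sqnorm t = c']) = 0.
  exact: etrans (measureU0 (mS _) (mS _) (lebN_sphere _)) (lebN_sphere _).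
have mgg : measurable_fun setT (fun z : T * T => g z.1 z.2 + g z.2 z.1) by exact: emeasurable_funD.
have nz (x : T) : sqnorm x <> 0%R -> (0 < nrm x)%R.
  by move=> /eqP x0; rewrite sqrtr_gt0 lt_neqAle eq_sym x0 sqnorm_ge0.
have E : dlint f = dlint (fun x y => g x y + g y x).
  rewrite /dint; apply: ae_eq_integral.
  - exact: measurableT.
  - exact: measurable_integral_lebN.
  - by apply: (measurable_integral_lebN mgg) => x y; rewrite adde_ge0.
  exists [set t : T | sqnorm t = 0%R]; split; [exact: mS|exact: lebN_sphere|].
  move=> x /= nH; apply: contrapT => x0; apply: nH => _.
  apply: ae_eq_integral.
  - exact: measurableT.
  - by apply: (measurable_fun_app mf); [exact: measurable_cst|exact: measurable_id].
  - apply: emeasurable_funD.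
      by apply: (measurable_fun_app (f := g) (g := fun=> x) (h := id) mg); [exact: measurable_cst|exact: measurable_id].
    by apply: (measurable_fun_app (f := g) (g := id) (h := fun=> x) mg); [exact: measurable_id|exact: measurable_cst].
  (* For fixed [x], the exceptional [y] are the origin and the sphere through [x]; elsewhere exactly
     one of the two orders of the pair is counted. *)
  exists ([set t : T | sqnorm t = 0%R] `|` [set t : T | sqnorm t = sqnorm x]); split.
  - by apply: measurableU; exact: mS.
  - exact: null2.
  move=> y /= nH; apply: contrapT => /not_orP[y0 yx]; apply: nH => _.
  have nx := nz _ x0; have ny := nz _ y0.
  rewrite /g !Jxy_unit// (fC y x).
  have [xy|xy|xy] := ltgtP (nrm y) (nrm x); rewrite ?mul1e ?mul0e ?adde0 ?add0e//.
  exfalso; apply: yx; rewrite -(sqr_sqrtr (sqnorm_ge0 y)) -(sqr_sqrtr (sqnorm_ge0 x)).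
  by rewrite -/(nrm y) -/(nrm x) xy.
rewrite E dintD//.
by rewrite -(dintC (lebN n.+1) mg g0) (_ : 2%:E = 1%:E + 1%:E) ?ge0_muleDl ?lee_fin// !mul1e.
Qed.

Definition mesh (m : nat) : R := m.+2%:R^-1.
Definition innerJ m (r : R) := ((mesh m <= r) && (r <= 1 - mesh m))%R.

Lemma mesh_gt0 m : (0 < mesh m)%R. Proof. by rewrite invr_gt0 ltr0n. Qed.

Lemma measurable_innerJ m : measurable_fun setT (innerJ m).
Proof. by rewrite /innerJ; meas. Qed.

Lemma innerJ01 m r : innerJ m r -> (0 < r < 1)%R.
Proof. by move=> /andP[r1 r2]; have m0 := mesh_gt0 m; apply/andP; split; lra. Qed.

Lemma innerJ_homo (i j : nat) r : (i <= j)%N -> innerJ i r -> innerJ j r.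
Proof.
move=> ij /andP[r1 r2]; have m0 := mesh_gt0 j.
have : (mesh j <= mesh i)%R by rewrite lef_pV2 ?posrE ?ltr0n// ler_nat !ltnS.
by move=> ?; apply/andP; split; lra.
Qed.

Lemma innerJ_exhaust (r : R) : (0 < r < 1)%R -> exists m, innerJ m r.
Proof.
move=> /andP[r0 r1]; pose e : R := Num.min r (1 - r)%R.
have e0 : (0 < e)%R by rewrite lt_min r0 subr_gt0.
have me : (mesh (Num.bound e^-1) <= e)%R.
  rewrite -[leRHS]invrK lef_pV2 ?posrE ?ltr0n ?invr_gt0//.
  apply: le_trans (ltW (archi_boundP _)) _; first by rewrite invr_ge0 ltW.
  by rewrite ler_nat (leq_trans (leqnSn _))// leqnSn.
exists (Num.bound e^-1); move: me; rewrite le_min => /andP[? ?].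
by apply/andP; split; lra.
Qed.

Section finite.
Variables (J : R -> bool) (d : R).
Hypothesis d0 : (0 < d)%R.
Hypothesis mJ : measurable_fun setT J.
Hypothesis Jd : forall r, J r -> (d <= r <= 1 - d)%R.

Let pow_le r a : J r -> (r `^ a <= d `^ (- `|a|))%R.
Proof.
move=> /Jd/andP[r1 r2]; apply: powR_le_norm => //; rewrite r1 (le_trans r2)//.
by rewrite gerBl ltW.
Qed.

(** For radii in [[d, 1 - d]] every power of [r] is bounded by a power of [d], whatever the sign of
    the exponent, and the averaged kernel stays away from its singularity. *)
Lemma intP_fin : kintP n s p J \is a fin_num.
Proof.
have m1 := measurable_wy n s p.
rewrite ge0_fin_numE; last first.
  apply: integral_ge0 => r _; rewrite mule_ge0 ?Psi_ge0// lee_fin.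
  by rewrite mulr_ge0 ?powR_ge0// mulr_ge0// powR_ge0.
have := @int_Psi_bounded R s p n p2 s0 d
  ((1 + d `^ (- `|h|)) `^ (p - 1) * d `^ (- `|p * s - 1|))%R J
  (fun r => wy n s p r * r `^ (p * s - 1))%R d0 Jd mJ.
under eq_integral do rewrite mulrA.
apply; first by meas.
move=> r Jr; rewrite mulr_ge0 ?powR_ge0//=.
apply: ler_pM; rewrite ?powR_ge0 ?pow_le//.
apply: ge0_ler_powR; rewrite ?nnegrE ?normr_ge0 ?p1//; first by rewrite addr_ge0 ?powR_ge0.
apply: le_trans (ler_normB _ _) _; rewrite normr1 lerD2l ger0_norm ?powR_ge0//.
exact: pow_le.
Qed.

Lemma intQ_fin : kintQ n s p J \is a fin_num.
Proof.
have m1 := measurable_wx n s p.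
rewrite ge0_fin_numE; last first.
  apply: integral_ge0 => r; rewrite /= in_itv/= andbT => r0; rewrite mule_ge0 ?Psi_ge0// lee_fin.
  by rewrite mulr_ge0 ?exprn_ge0 ?(ltW r0)// mulr_ge0// powR_ge0.
have := @int_Psi_bounded R s p n p2 s0 d
  ((d `^ (- `|- h|) + 1) `^ (p - 1) * 1)%R J
  (fun r => wx n s p r * r ^+ n)%R d0 Jd mJ.
under eq_integral do rewrite mulrA.
apply; first by meas.
move=> r Jr; have /andP[r1 r2] := Jd Jr; have r0 : (0 <= r)%R := le_trans (ltW d0) r1.
have r1' : (r <= 1)%R by rewrite (le_trans r2)// gerBl ltW.
rewrite mulr_ge0 ?powR_ge0 ?exprn_ge0//=.
apply: ler_pM; rewrite ?powR_ge0 ?exprn_ge0 ?exprn_ile1//.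
apply: ge0_ler_powR; rewrite ?nnegrE ?normr_ge0 ?p1//; first by rewrite addr_ge0 ?powR_ge0.
apply: le_trans (ler_normB _ _) _; rewrite normr1 lerD2r ger0_norm ?powR_ge0//.
exact: pow_le.
Qed.

End finite.

Lemma intC_unit_fin : kintC n s p unitJ \is a fin_num.
Proof.
rewrite ge0_fin_numE; last first.
  by apply: integral_ge0 => r _; rewrite mule_ge0 ?Psi_ge0// lee_fin !mulr_ge0 ?powR_ge0.
exact: (@int_CPsi_fin R s p n p2 s0 s1 h ph).
Qed.

Lemma intC_cvg : kintC n s p (innerJ m) @[m --> \oo] --> kintC n s p unitJ.
Proof.
have mP := @measurable_Psi R s p n.
pose g m (r : R) : \bar R :=
  ((innerJ m r)%:R * (r `^ (p * s - 1) * `|1 - r `^ h| `^ p))%:E * Psi s p n r.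
have mg m : measurable_fun (`]0%R, +oo[%classic : set (measurableTypeR R)) (g m).
  by apply: measurable_funTS; have mJ := @measurable_innerJ m; rewrite /g; meas.
have g0 m r : 0 <= g m r by rewrite mule_ge0 ?Psi_ge0// lee_fin !mulr_ge0 ?powR_ge0.
have gh r : {homo g^~ r : i j / (i <= j)%N >-> (i <= j)%E}.
  move=> i j ij; rewrite /g; have [Ji|_] := boolP (innerJ i r); last first.
    by rewrite mul0r mul0e; exact: g0.
  by rewrite (innerJ_homo ij Ji).
have mi : measurable (`]0%R, +oo[%classic : set (measurableTypeR R)) by exact: measurable_itv.
have := @cvg_monotone_convergence _ _ R mu _ mi g mg (fun m r _ => g0 m r) (fun r _ => gh r).
rewrite (_ : \int[mu]_(x in `]0%R, +oo[) limn (g^~ x) = kintC n s p unitJ)//.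
rewrite /kintC; apply: eq_integral => r _; apply/cvg_lim => //.
have [/innerJ_exhaust[k Jk]|nJ] := boolP (0 < r < 1)%R.
  apply: cvg_near_cst; exists k => // m /= km.
  by rewrite /g /unitJ (innerJ_homo km Jk) (innerJ01 Jk).
apply: cvg_near_cst; exists 0%N => // m _; rewrite /g /unitJ (negbTE nJ).
by case: (boolP (innerJ m r)) => // /innerJ01 H; move: nJ; rewrite H.
Qed.

Variable u : T -> R.
Hypothesis mu_u : measurable_fun setT u.
Hypothesis Bf : hardyB s p u \is a fin_num.

Lemma hardyA_sym x y : hardyA s p u x y = hardyA s p u y x.
Proof. by rewrite /hardyA distrC kerC. Qed.

Lemma hardyD_sym x y : hardyD s p u x y = hardyD s p u y x.
Proof. by rewrite /hardyD distrC kerC mulrAC. Qed.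

Let mA : measurable_fun setT (fun z : T * T => (hardyA s p u z.1 z.2)%:E).
Proof. by apply/measurable_EFinP; exact: measurable_hardyA. Qed.
Let mD : measurable_fun setT (fun z : T * T => (hardyD s p u z.1 z.2)%:E).
Proof. by apply/measurable_EFinP; exact: measurable_hardyD. Qed.
Let A0 x y : 0 <= (hardyA s p u x y)%:E. Proof. by rewrite lee_fin hardyA_ge0. Qed.
Let D0 x y : 0 <= (hardyD s p u x y)%:E. Proof. by rewrite lee_fin hardyD_ge0. Qed.

Let cut_cvg (f : T -> T -> R) : measurable_fun setT (fun z : T * T => (f z.1 z.2)%:E) ->
  (forall x y, 0 <= (f x y)%:E) ->
  dlint (kcut (innerJ m) f) @[m --> \oo] --> dlint (kcut unitJ f).
Proof.
move=> mf f0; apply: (@dint_cut _ T R (lebN n.+1) (fun m => Jxy (innerJ m)) (Jxy unitJ)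
  (fun x y => (f x y)%:E)).
- by move=> m; apply: measurable_Jxy; exact: measurable_innerJ.
- by move=> x y i j ij /andP[x0 Ji]; rewrite /Jxy x0 (innerJ_homo ij Ji).
- by move=> x y /andP[x0 /innerJ_exhaust[k Jk]]; exists k; rewrite /Jxy x0.
- by move=> x y k /andP[x0 Jk]; rewrite /Jxy x0; exact: innerJ01 Jk.
- by apply: measurable_Jxy; exact: measurable_unitJ.
- exact: mf.
- exact: f0.
Qed.

Let cutoff m :
  (kintC n s p (innerJ m) * hardyB s p u + (c_p p)%:E * dlint (kcut (innerJ m) (hardyD s p u))
    <= dlint (kcut (innerJ m) (hardyA s p u))) /\
  (p = 2%R -> kintC n s p (innerJ m) * hardyB s p u
    + (c_p p)%:E * dlint (kcut (innerJ m) (hardyD s p u)) = dlint (kcut (innerJ m) (hardyA s p u))).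
Proof.
have Jd r : innerJ m r -> (mesh m <= r <= 1 - mesh m)%R by [].
exact: (cutoff_hardy p2 s0 h_neq0 (measurable_innerJ m) (@innerJ01 m) mu_u Bf
  (intP_fin (mesh_gt0 m) (measurable_innerJ m) Jd) (intQ_fin (mesh_gt0 m) (measurable_innerJ m) Jd)).
Qed.

(** The constants that may diverge are cancelled at each fixed cutoff, so only monotone quantities
    remain in the limit; inequality and, for [p = 2], equality both pass to it. The factor two comes
    from the two orders of a pair. *)
Lemma hardy_remainder :
  (2%:E * kintC n s p unitJ * hardyB s p u
    + (c_p p)%:E * dlint (fun x y => (hardyD s p u x y)%:E)
    <= dlint (fun x y => (hardyA s p u x y)%:E)) /\
  (p = 2%R -> 2%:E * kintC n s p unitJ * hardyB s p u
    + (c_p p)%:E * dlint (fun x y => (hardyD s p u x y)%:E)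
    = dlint (fun x y => (hardyA s p u x y)%:E)).
Proof.
have /andP[c0 _] := c_p_bounds p2.
have -> : dlint (fun x y => (hardyA s p u x y)%:E) = 2%:E * dlint (kcut unitJ (hardyA s p u)).
  by apply: (dint_symmetric mA A0) => x y; rewrite hardyA_sym.
have -> : dlint (fun x y => (hardyD s p u x y)%:E) = 2%:E * dlint (kcut unitJ (hardyD s p u)).
  by apply: (dint_symmetric mD D0) => x y; rewrite hardyD_sym.
have Cf := intC_unit_fin.
have C0 : 0 <= kintC n s p unitJ.
  by apply: integral_ge0 => r _; rewrite mule_ge0 ?Psi_ge0// lee_fin !mulr_ge0 ?powR_ge0.
have B0 : 0 <= hardyB s p u by apply: integral_ge0 => x _; rewrite lee_fin mulr_ge0// powR_ge0.
have DD0 : 0 <= dlint (kcut unitJ (hardyD s p u)).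
  by apply: dint_ge0 => x y; rewrite mule_ge0// lee_fin.
have hx : 0 <= kintC n s p unitJ * hardyB s p u by rewrite mule_ge0.
have hy : 0 <= (c_p p)%:E * dlint (kcut unitJ (hardyD s p u)) by rewrite mule_ge0// lee_fin ltW.
have E : 2%:E * kintC n s p unitJ * hardyB s p u + (c_p p)%:E * (2%:E * dlint (kcut unitJ (hardyD s p u)))
  = 2%:E * (kintC n s p unitJ * hardyB s p u + (c_p p)%:E * dlint (kcut unitJ (hardyD s p u))).
  by rewrite (ge0_muleDr _ hx hy) -[in LHS]muleA; congr (_ + _); exact: muleCA.
(* The remainder may be infinite; the limit of the sum is legitimate because both limits are
   nonnegative. *)
have cl : (kintC n s p (innerJ m) * hardyB s p u + (c_p p)%:E * dlint (kcut (innerJ m) (hardyD s p u)))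
    @[m --> \oo] --> kintC n s p unitJ * hardyB s p u + (c_p p)%:E * dlint (kcut unitJ (hardyD s p u)).
  apply: cvgeD; first by apply: ge0_adde_def; rewrite inE; [exact: hx|exact: hy].
    by apply: cvgeZr => //; exact: intC_cvg.
  by apply: cvgeZl => //; apply: cut_cvg => //; exact: D0.
have cr := cut_cvg mA A0.
rewrite E; split.
  apply: lee_wpmul2l; first by rewrite lee_fin.
  rewrite -(cvg_lim (@ereal_hausdorff R) cl) -(cvg_lim (@ereal_hausdorff R) cr).
  apply: lee_lim; [by apply/cvg_ex; eexists; exact: cl|by apply/cvg_ex; eexists; exact: cr|].
  by apply: nearW => m; exact: (cutoff m).1.
move=> pE; congr (_ * _).
rewrite -(cvg_lim (@ereal_hausdorff R) cl) -(cvg_lim (@ereal_hausdorff R) cr).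
apply: (congr1 (fun f : nat -> \bar R => limn f)); apply/funext => m.
exact: ((cutoff m).2 pE).
Qed.

(** One compact interval inside [(0, 1)]: the radial constants are finite there, and only positivity
    of [kintC] is needed. *)
Definition midJ (r : R) := (1/4 <= r <= 1/2)%R.

Lemma hardy_weak : kintC n s p midJ * hardyB s p u <= dlint (fun x y => (hardyA s p u x y)%:E).
Proof.
have /andP[c0 _] := c_p_bounds p2.
have mJ : measurable_fun setT midJ by rewrite /midJ; meas.
have J01 r : midJ r -> (0 < r < 1)%R by move=> /andP[? ?]; apply/andP; split; lra.
have Jd r : midJ r -> (1/4 <= r <= 1 - 1/4)%R by move=> /andP[? ?]; apply/andP; split; lra.
have d0 : (0 < 1 / 4 :> R)%R by lra.
have [H _] := cutoff_hardy p2 s0 h_neq0 mJ J01 mu_u Bf (intP_fin d0 mJ Jd) (intQ_fin d0 mJ Jd).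
have mJx := measurable_Jxy (n := n) mJ.
apply: (@le_trans _ _ (dlint (kcut midJ (hardyA s p u)))).
  apply: le_trans H; rewrite leeDl// mule_ge0 ?lee_fin ?(ltW c0)//.
  by apply: dint_ge0 => x y; rewrite mule_ge0// lee_fin.
apply: le_dint.
- apply: emeasurable_funM; last exact: mA.
  by apply/measurable_EFinP; apply: measurable_boolR.
- exact: mA.
- by move=> x y; rewrite mule_ge0// lee_fin.
- by move=> x y; rewrite /kcut; case: (Jxy midJ x y); rewrite ?mul1e ?mul0e.
Qed.

End hardy.

(** * Passage from test functions to the completion *)

Section completion.
Context {R : realType}.
Variables (n : nat) (s p : R).
Hypothesis p2 : 2 <= p.
Hypothesis s0 : 0 < s.
Hypothesis s1 : s < 1.
Local Open Scope ereal_scope.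
Local Notation mu := (@lebesgue_measure R).
Local Notation T := (n.+1.-tuple R).
Local Notation dlint := (@dint _ T R (lebN n.+1)).
Local Notation h := (hexp n s p).
Local Notation hA u := (fun x y => (hardyA s p u x y)%:E).

Let p0 : (0 < p)%R. Proof. by rewrite (lt_le_trans _ p2). Qed.
Let pn0 : (p != 0)%R. Proof. by rewrite gt_eqF. Qed.
Let ps0 : (0 < p * s)%R. Proof. exact: mulr_gt0. Qed.

(** With [m] the larger of [|a - b|] and [|b|], [|a| <= 2 m] and [m^p] is at most the sum. The crude
    constant suffices, since only finiteness is at stake. *)
Lemma norm_powR_split (a b : R) : (`|a| `^ p <= 2 `^ p * (`|a - b| `^ p + `|b| `^ p))%R.
Proof.
pose m := Num.max `|a - b|%R `|b|%R.
have m0 : (0 <= m)%R by rewrite le_max normr_ge0.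
have am : (`|a| <= 2 * m)%R.
  have := ler_normD (a - b)%R b; rewrite subrK => H.
  have : (`|a - b| <= m)%R by rewrite le_max lexx.
  have : (`|b| <= m)%R by rewrite le_max lexx orbT.
  by lra.
apply: (@le_trans _ _ ((2 * m) `^ p)%R).
  by apply: ge0_ler_powR; rewrite ?nnegrE ?(ltW p0) ?mulr_ge0.
rewrite (powRM _ _ m0)// ler_wpM2l ?powR_ge0// /m.
by case: (leP `|a - b|%R `|b|%R) => _; rewrite ?lerDl ?lerDr powR_ge0.
Qed.

Let wB (f : T -> R) x := (`|f x| `^ p * nrm x `^ (- (p * s)))%R.
Let mwB f : measurable_fun setT f -> measurable_fun setT (fun x => (wB f x)%:E).
Proof. by move=> mf; rewrite /wB; have mn := @measurable_nrm R n; meas. Qed.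
Let wB0 f x : (0 <= wB f x)%R. Proof. by rewrite mulr_ge0// powR_ge0. Qed.

Lemma hardyB_ge0 (f : T -> R) : 0 <= hardyB s p f.
Proof. by apply: integral_ge0 => x _; rewrite lee_fin; exact: wB0. Qed.

Lemma hardyB_split (f g : T -> R) : measurable_fun setT f -> measurable_fun setT g ->
  hardyB s p f <= (2 `^ p)%:E * (hardyB s p (fun x => f x - g x)%R + hardyB s p g).
Proof.
move=> mf mg.
have mfg : measurable_fun setT (fun x => f x - g x)%R by exact: measurable_funB.
have m1 := mwB mf; have m2 := mwB mfg; have m3 := mwB mg.
rewrite /hardyB -[X in _ * X]ge0_integralD; last 5 first.
- exact: measurableT.
- by move=> x _; rewrite lee_fin mulr_ge0 ?powR_ge0.
- exact: m2.
- by move=> x _; rewrite lee_fin mulr_ge0 ?powR_ge0.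
- exact: m3.
have m23 : measurable_fun setT (fun x => (wB (fun x => f x - g x)%R x)%:E + (wB g x)%:E).
  exact: emeasurable_funD.
rewrite -ge0_integralZl; last 4 first.
- exact: measurableT.
- exact: m23.
- by move=> x _; rewrite adde_ge0 ?lee_fin ?mulr_ge0 ?powR_ge0.
- by rewrite lee_fin powR_ge0.
apply: ge0_le_integral.
- exact: measurableT.
- by move=> x _; rewrite lee_fin mulr_ge0 ?powR_ge0.
- exact: m1.
- by apply: emeasurable_funM; [exact: measurable_cst|exact: m23].
move=> x _; rewrite -EFinD -EFinM lee_fin -mulrDl mulrA ler_wpM2r ?powR_ge0//.
exact: norm_powR_split.
Qed.

Lemma dlintA_split (f g : T -> R) : measurable_fun setT f -> measurable_fun setT g ->
  dlint (hA f) <= (2 `^ p)%:E * (dlint (hA (fun x => f x - g x)%R) + dlint (hA g)).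
Proof.
move=> mf mg.
have mfg : measurable_fun setT (fun x => f x - g x)%R by exact: measurable_funB.
have mA u : measurable_fun setT u -> measurable_fun setT (fun z : T * T => (hardyA s p u z.1 z.2)%:E).
  by move=> m; apply/measurable_EFinP; exact: measurable_hardyA.
have A0 u x y : 0 <= (hardyA s p u x y)%:E by rewrite lee_fin hardyA_ge0.
have mS : measurable_fun setT (fun z : T * T =>
    (hardyA s p (fun x => f x - g x)%R z.1 z.2)%:E + (hardyA s p g z.1 z.2)%:E).
  by apply: emeasurable_funD; exact: mA.
rewrite -dintD; [|exact: mA|exact: mA|exact: A0|exact: A0].
rewrite -dintZl; last 3 first.
- exact: mS.
- by move=> x y; rewrite adde_ge0.
- exact: powR_ge0.
apply: le_dint.
- exact: mA.
- by apply: emeasurable_funM; [exact: measurable_cst|exact: mS].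
- exact: A0.
move=> x y; rewrite -EFinD -EFinM lee_fin /hardyA -mulrDl mulrA ler_wpM2r ?ker_ge0//.
have := norm_powR_split (f x - f y)%R (g x - g y)%R.
by rewrite (_ : f x - f y - (g x - g y) = f x - g x - (f y - g y))%R//; ring.
Qed.

(** In the squared radius the majorant turns into a multiple of [Q^(a - 1)] on []0, M[], integrable
    because [a > 0]. *)
Lemma hardyB_radial_fin (f : T -> R) (a C M : R) : measurable_fun setT f ->
  (0 < a)%R -> (0 <= C)%R -> (0 < M)%R ->
  (forall t, `|f t| `^ p * nrm t `^ (- (p * s)) <=
    C * ((0 < sqnorm t < M)%R%:R * sqnorm t `^ (a - n.+1%:R / 2)))%R ->
  hardyB s p f \is a fin_num.
Proof.
move=> mf a0 C0 M0 fle; rewrite ge0_fin_numE ?hardyB_ge0//.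
pose g (Q : R) : \bar R := (C * ((0 < Q < M)%R%:R * Q `^ (a - n.+1%:R / 2)))%:E.
have mg : measurable_fun setT g by rewrite /g; meas.
have g0 (Q : R) : 0 <= g Q by rewrite lee_fin !mulr_ge0 ?powR_ge0.
apply: (@le_lt_trans _ _ (\int[lebN n.+1]_t g (sqnorm t))).
  apply: ge0_le_integral.
  - exact: measurableT.
  - by move=> x _; rewrite lee_fin; exact: wB0.
  - exact: mwB.
  - by apply: (measurableT_comp mg); exact: measurable_sqnorm.
  by move=> t _; rewrite lee_fin.
rewrite (radial_formulaP n mg g0).
have DM : (`]0%R, M[%classic : set R) = [set r | (0 < r < M)%R].
  by apply/seteqP; split => r /=; rewrite in_itv.
have -> : \int[mu]_(Q in `]0%R, +oo[) ((Q `^ (n.+1%:R / 2 - 1))%:E * g Q) =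
    C%:E * \int[mu]_(Q in `]0%R, M[) (Q `^ (a - 1))%:E.
  rewrite -ge0_integralZl; last 4 first.
  - exact: measurable_itv.
  - by apply: measurable_funTS; meas.
  - by move=> x _; rewrite lee_fin powR_ge0.
  - by rewrite lee_fin.
  rewrite integral_pos_boolR (integral_mu_boolR _ DM); apply: eq_integral => Q _.
  rewrite /g; have [Q0|Q0] := boolP (0 < Q)%R; last by rewrite !mul0e.
  have [QM|QM] := boolP (Q < M)%R; last by rewrite !mul0r !mulr0 mule0 mul0e mule0.
  have I c : c ==> (Q != 0%R) by rewrite gt_eqF// implybT.
  rewrite !mul1e !mul1r -!EFinM mulrCA -powRD//; congr (_ * _ `^ _)%:E; ring.
by rewrite (integral_powR_itv a0 M0) -!EFinM ltry.
Qed.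

(** For [ps < N] the weight [|x|^(-ps)] is itself integrable at the origin, which gives
    [a = (N - ps)/2]. In the punctured case [f] vanishes on a ball, the weight is bounded on the
    support, and [a = N/2]. *)
Lemma hardyB_test_fin (f : 'rV[R]_n.+1 -> R) :
  (p * s < n.+1%:R)%R /\ Cc_inf f \/ Cc_inf_punct f ->
  hardyB s p (fun t : T => f (tup2row t)) \is a fin_num.
Proof.
move=> H; have [sf cK] : smooth f /\ compact (fsupport f) by case: H => [[_ []]|[? []]].
have cf := smooth_continuous sf.
have [C [M [C0 M0 fC fM]]] := compact_support_bounded cf cK.
have mf := continuous_measurableN cf.
suff [a [K [a0 K0 HK]]] : exists a K, [/\ (0 < a)%R, (0 <= K)%R &
    forall t : T, f (tup2row t) != 0%R -> (0 < sqnorm t)%R ->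
      (sqnorm t `^ (- (p * s) / 2) <= K * sqnorm t `^ (a - n.+1%:R / 2))%R].
  apply: (@hardyB_radial_fin _ a (C `^ p * K) M mf a0 _ M0); first by rewrite mulr_ge0 ?powR_ge0.
  move=> t; have rhs0 : (0 <= C `^ p * K * ((0 < sqnorm t < M)%R%:R * sqnorm t `^ (a - n.+1%:R / 2)))%R.
    by rewrite !mulr_ge0 ?powR_ge0.
  have [->|ft] := eqVneq (f (tup2row t)) 0%R; first by rewrite normr0 (powR0 pn0) mul0r.
  rewrite /nrm (sqrt_powR _ (sqnorm_ge0 t)).
  (* At the origin the negative power of [0] is [0] by convention, so the bound holds trivially. *)
  have [t0|t0] := boolP (0 < sqnorm t)%R; last first.
    have -> : sqnorm t = 0%R by apply/eqP; rewrite eq_le sqnorm_ge0 leNgt t0.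
    by rewrite [(0 `^ (- (p * s) / 2))%R]powR0 ?mulr0 ?mulr_ge0 ?powR_ge0// mulf_neq0// oppr_eq0 gt_eqF.
  rewrite (fM _ ft) mul1r -mulrA; apply: ler_pM; rewrite ?powR_ge0 ?HK//.
  by apply: ge0_ler_powR; rewrite ?nnegrE ?(ltW p0).
case: H => [[psn _]|[_ [_ /punctured_support[e e0 fe]]]].
  exists ((n.+1%:R - p * s) / 2)%R, 1%R; split => //; first by rewrite divr_gt0// subr_gt0.
  move=> t _ _; rewrite mul1r (_ : - (p * s) / 2 = (n.+1%:R - p * s) / 2 - n.+1%:R / 2)%R//.
  by field.
exists (n.+1%:R / 2)%R, ((e ^+ 2) `^ (- (p * s) / 2))%R; split.
- by rewrite divr_gt0.
- exact: powR_ge0.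
move=> t ft t0; rewrite subrr powRr0 mulr1.
have te : (e ^+ 2 <= sqnorm t)%R by rewrite leNgt; apply: contra ft => /fe ->.
rewrite mulNr !powRN lef_pV2 ?posrE ?powR_gt0 ?exprn_gt0//.
by apply: ge0_ler_powR; rewrite ?nnegrE ?exprn_ge0 ?(ltW e0) ?sqnorm_ge0// divr_ge0// ltW.
Qed.

(** Fatou's lemma. Convergence almost everywhere is phrased through measurable sets of
    non-convergence points, the only form that can be extracted from [ae_N]. *)
Lemma hardyB_liminf (phi : nat -> T -> R) (u : T -> R) (M : R) (K : nat) :
  (forall k, measurable_fun setT (phi k)) -> measurable_fun setT u ->
  (forall E : set T, measurable E ->
    (forall t, E t -> ~ (phi k t @[k --> \oo] --> u t)) -> lebN n.+1 E = 0) ->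
  (forall k, (K <= k)%N -> hardyB s p (phi k) <= M%:E) -> hardyB s p u <= M%:E.
Proof.
move=> mphi mu_u nullE phiM.
pose F k t := (wB (phi k) t)%:E.
have mF k : measurable_fun setT (F k) by exact: mwB.
have F0 k t : 0 <= F k t by rewrite lee_fin; exact: wB0.
pose G t := limn_einf (F^~ t).
have mG : measurable_fun setT G.
  apply: (@emeasurable_fun_cvg _ _ _ _ (fun k t => einfs (F^~ t) k)).
    by move=> k; apply: measurable_fun_einfs => // j; exact: mF.
  by move=> t _; rewrite /G limn_einf_lim; exact: is_cvg_einfs.
have mW := mwB mu_u.
(* Measurable, being defined by two measurable functions, and disjoint from the points of
   convergence; so the hypothesis makes it null. *)
pose E : set T := [set t | (wB u t)%:E != G t].
have -> : hardyB s p u = \int[lebN n.+1]_t G t.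
  apply: ae_eq_integral => //.
  exists E; split.
  - have -> : E = [set t | (wB u t)%:E - G t != 0].
      apply/seteqP; split => t; rewrite /E /=; case: (G t) => [r||]//=.
        by rewrite -EFinB !eqe subr_eq0.
      by rewrite -EFinB !eqe subr_eq0.
    have := emeasurable_neq measurableT (emeasurable_funB mW mG) 0; rewrite setTI; exact.
  - apply: nullE => [|t /eqP Et cvt].
      have -> : E = [set t | (wB u t)%:E - G t != 0].
        apply/seteqP; split => t; rewrite /E /=; case: (G t) => [r||]//=.
          by rewrite -EFinB !eqe subr_eq0.
        by rewrite -EFinB !eqe subr_eq0.
      have := emeasurable_neq measurableT (emeasurable_funB mW mG) 0; rewrite setTI; exact.
    apply: Et; rewrite /G; apply/esym.
    have cF : F k t @[k --> \oo] --> (wB u t)%:E.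
      apply: cvg_EFin; first exact: nearW.
      apply: cvgM; last exact: cvg_cst.
      have cn := @continuous_normpow R p p0 (u t).
      by first [exact: (cvg_comp (fun k => phi k t) (fun x : R => `|x| `^ p)%R cvt cn) | apply: (continuous_cvg _ cn cvt)].
    by have [-> _] := cvg_limn_einf_sup cF.
  - by move=> t /= nH; apply: contrapT => Et; apply: nH => _; apply/eqP/negPn/negP.
apply: le_trans (fatou _ _ _ _) _ => //.
rewrite limn_einf_lim; apply: lime_le; first exact: is_cvg_einfs.
exists K => // k /= Kk; apply: le_trans (phiM _ Kk).
by apply: ereal_inf_lbound; exists k => /=.
Qed.

(** The weak inequality presupposes a finite Hardy integral, so it is applied to [phi k - phi K],
    where finiteness is known, and not to [u - phi k]. The resulting bound is uniform in [k] and
    passes to [u]. *)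
Lemma completion_hardyB_fin (phi : nat -> T -> R) (u : T -> R) : h != 0%R ->
  (forall k, measurable_fun setT (phi k)) -> measurable_fun setT u ->
  (forall k, hardyB s p (phi k) \is a fin_num) ->
  dlint (hA (fun t => u t - phi k t)%R) @[k --> \oo] --> 0 ->
  (forall E : set T, measurable E ->
    (forall t, E t -> ~ (phi k t @[k --> \oo] --> u t)) -> lebN n.+1 E = 0) ->
  hardyB s p u \is a fin_num.
Proof.
move=> h0 mphi mu_u Bphi Acvg nullE.
have : \forall k \near \oo, dlint (hA (fun t => u t - phi k t)%R) < 1%:E.
  have /fine_cvgP[Af Ac] : dlint (hA (fun t => u t - phi k t)%R) @[k --> \oo] --> 0%:E by exact: Acvg.
  have Al := cvgr_lt _ Ac _ (@ltr01 R).
  move: Af Al => [K1 _ K1P] [K2 _ K2P]; exists (maxn K1 K2) => // k /=.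
  rewrite geq_max => /andP[k1 k2].
  have Afk : dlint (hA (fun t => u t - phi k t)%R) \is a fin_num by exact: K1P.
  by rewrite -(fineK Afk) lte_fin; exact: (K2P k k2).
move=> [K _ KP].
have C0 : 0 < kintC n s p midJ by rewrite /kintC /midJ; apply: int_CPsi_gt0.
(* A positive real lower bound for the constant is enough to divide by; its finiteness does not have
   to be established here. *)
have [c c0 cC] : exists2 c : R, (0 < c)%R & c%:E <= kintC n s p midJ.
  case: (kintC n s p midJ) C0 => [r|_|//]; first by rewrite lte_fin => r0; exists r.
  by exists 1%R => //; rewrite leey.
have two0 : 0 <= (2 `^ p)%:E :> \bar R by rewrite lee_fin powR_ge0.
(* Both [phi k] and [phi K] have energy distance below one from [u]; splitting through [u] bounds
   the energy of their difference by [2^p * 2]. *)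
have Bd k : (K <= k)%N -> hardyB s p (fun t => phi k t - phi K t)%R <= (c^-1 * (2 `^ p * 2))%:E.
  move=> Kk.
  have mk : measurable_fun setT (fun t => phi k t - phi K t)%R by exact: measurable_funB.
  have Bf : hardyB s p (fun t => phi k t - phi K t)%R \is a fin_num.
    rewrite ge0_fin_numE ?hardyB_ge0//.
    have mN : measurable_fun setT (fun t => - phi K t)%R by exact: measurableT_comp.
    apply: le_lt_trans (hardyB_split mk mN) _.
    have E1 : hardyB s p (fun t => phi k t - phi K t - - phi K t)%R = hardyB s p (phi k).
      by rewrite /hardyB; apply: eq_integral => t _; rewrite opprK subrK.
    have E2 : hardyB s p (fun t => - phi K t)%R = hardyB s p (phi K).
      by rewrite /hardyB; apply: eq_integral => t _; rewrite normrN.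
    by rewrite E1 E2 -(fineK (Bphi k)) -(fineK (Bphi K)) -EFinD -EFinM ltry.
  have W := hardy_weak p2 s0 h0 mk Bf.
  have mg : measurable_fun setT (fun t => phi k t - u t)%R by exact: measurable_funB.
  have A1 : dlint (hA (fun t => phi k t - phi K t)%R) <= (2 `^ p)%:E * (1%:E + 1%:E).
    apply: le_trans (dlintA_split mk mg) _; apply: lee_wpmul2l => //; apply: leeD.
      apply: le_trans (ltW (KP K (leqnn _))); rewrite le_eqVlt; apply/orP; left; apply/eqP.
      by apply: eq_dint => x y; rewrite /hardyA; congr (`|_| `^ _ * _)%:E; ring.
    apply: le_trans (ltW (KP k Kk)); rewrite le_eqVlt; apply/orP; left; apply/eqP.
    apply: eq_dint => x y; rewrite /hardyA -normrN; congr (`|_| `^ _ * _)%:E; ring.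
  have : c%:E * hardyB s p (fun t => phi k t - phi K t)%R <= (2 `^ p * 2)%:E.
    apply: (@le_trans _ _ (kintC n s p midJ * hardyB s p (fun t => phi k t - phi K t)%R)).
      by apply: lee_wpmul2r => //; exact: hardyB_ge0.
    by apply: le_trans W _; apply: le_trans A1 _; rewrite -EFinD -EFinM lee_fin.
  rewrite -(fineK Bf) -EFinM !lee_fin => H.
  by rewrite mulrC ler_pdivlMr// mulrC.
pose M := (2 `^ p * (c^-1 * (2 `^ p * 2) + fine (hardyB s p (phi K))))%R.
rewrite ge0_fin_numE ?hardyB_ge0//; apply: (@le_lt_trans _ _ M%:E); last exact: ltry.
apply: (hardyB_liminf mphi mu_u nullE (K := K)) => k Kk.
apply: le_trans (hardyB_split (mphi k) (mphi K)) _.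
rewrite /M EFinM EFinD fineK//; apply: lee_wpmul2l => //.
by apply: leeD => //; exact: Bd.
Qed.

Lemma iint2E (F : T -> T -> R) : measurable_fun setT (fun z : T * T => F z.1 z.2) ->
  (forall x y, (0 <= F x y)%R) ->
  iint (fun x : T => iint (fun y : T => (F x y)%:E)) = dlint (fun x y => (F x y)%:E).
Proof.
move=> mF F0; have mFE : measurable_fun setT (fun z : T * T => (F z.1 z.2)%:E) by apply/measurable_EFinP.
have F0E x y : 0 <= (F x y)%:E by rewrite lee_fin.
have -> : (fun x : T => iint (fun y : T => (F x y)%:E)) = (fun x => \int[lebN n.+1]_y (F x y)%:E).
  apply/funext => x; apply: iintE => // .
  apply/measurable_EFinP.
  by apply: (measurable_fun_app (f := F) (g := fun=> x) (h := id) mF); [exact: measurable_cst|exact: measurable_id].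
rewrite iintE//; first exact: measurable_integral_lebN.
by move=> x; apply: integral_ge0.
Qed.

Lemma enorm_ker (x y : T) : (enorm (tup2row x - tup2row y) `^ (- (n.+1%:R + p * s)) = ker s p x y)%R.
Proof. by rewrite enorm_sub_tup2row (sqrt_powR _ (sqdist_ge0 _ _)). Qed.

Lemma gagliardoE (u : 'rV[R]_n.+1 -> R) : measurableN u ->
  gagliardo s p u = dlint (hA (fun t : T => u (tup2row t))).
Proof.
move=> mu_u; rewrite -iint2E; last 2 first.
- exact: measurable_hardyA.
- exact: hardyA_ge0.
rewrite /gagliardo /intN; congr iint; apply/funext => x; congr iint; apply/funext => y.
by rewrite enorm_ker.
Qed.

Lemma CNspE : CNsp n.+1 s p = 2%:E * kintC n s p unitJ.
Proof.
rewrite /CNsp; congr (_ * _).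
have mP := @measurable_Psi R s p n.
have mi : measurable (`]0%R, 1%R[%classic : set (measurableTypeR R)) by exact: measurable_itv.
pose g (r : R) : \bar R := (r `^ (p * s - 1) * `|1 - r `^ h| `^ p)%:E * Psi s p n r.
have gE : {in (`]0%R, 1%R[%classic : set R), g =1 fun r =>
    (r `^ (p * s - 1) * `|1 - r `^ ((n.+1%:R - p * s) / p)| `^ p)%:E * Phi n.+1 s p r}.
  by move=> r; rewrite inE /= in_itv /= => r01; rewrite /g (Psi_Phi _ _ _ r01).
rewrite integral_itv_bndoo; last first.
  apply: (eq_measurable_fun g gE); apply: measurable_funTS; rewrite /g; meas.
transitivity (\int[mu]_(z in `]0%R, 1%R[) g z).
  by apply: eq_integral => r rD; exact/esym/(gE r rD).
rewrite /kintC integral_pos_01; last first.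
  by move=> r r1; rewrite /unitJ [(r < 1)%R]ltNge r1 andbF mul0r mul0e.
apply: eq_integral => r; rewrite inE /= in_itv /= => r01.
by rewrite /unitJ r01 mul1r.
Qed.

(** [ae_N] states that an iterated integral of an indicator vanishes, for a set that need not be
    measurable. A measurable set of non-convergence points lies inside it and inherits the zero by
    monotonicity of [iint]. *)
Lemma in_completion_hardyB_fin (test : ('rV[R]_n.+1 -> R) -> Prop) (u : 'rV[R]_n.+1 -> R) :
  h != 0%R -> (forall f, test f -> smooth f /\ hardyB s p (fun t : T => f (tup2row t)) \is a fin_num) ->
  in_completion s p test u -> hardyB s p (fun t : T => u (tup2row t)) \is a fin_num.
Proof.
move=> h0 testP [mu_u [phi [tphi [Acvg aecvg]]]].
have mphi k : measurableN (phi k).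
  by apply: continuous_measurableN; apply: smooth_continuous; exact: (testP _ (tphi k)).1.
apply: (@completion_hardyB_fin (fun k t => phi k (tup2row t)) _ h0 mphi mu_u).
- by move=> k; exact: (testP _ (tphi k)).2.
- have -> // : (fun k => dlint (hA (fun t : T => u (tup2row t) - phi k (tup2row t))%R)) =
      (fun k => gagliardo s p (u \- phi k)%R).
  apply/funext => k.
  have mk : measurableN (u \- phi k)%R by exact: (measurable_funB mu_u (mphi k)).
  by rewrite gagliardoE.
move=> E mE nE; have := integral_indic (lebN n.+1) measurableT mE; rewrite setIT => <-.
rewrite -iintE; last 2 first.
- by apply/measurable_EFinP; exact: measurable_indic.
- by move=> t; rewrite lee_fin.
apply/eqP; rewrite eq_le iint_ge0 ?andbT; last by move=> t; rewrite lee_fin.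
move: aecvg; rewrite /ae_N /intN => <-; apply: le_iint => t; rewrite lee_fin// !indicE.
have [|//] := boolP (t \in E); rewrite inE => Et.
by rewrite mem_set//=; exact: nE.
Qed.

Lemma hardyB_intN (u : 'rV[R]_n.+1 -> R) : measurableN u ->
  intN (fun x => (`|u x| `^ p * enorm x `^ (- (p * s)))%:E) = hardyB s p (fun t : T => u (tup2row t)).
Proof.
move=> mu_u; pose U (t : T) := u (tup2row t).
have E : (fun t : T => (`|u (tup2row t)| `^ p * enorm (tup2row t) `^ (- (p * s)))%:E) =
    (fun t : T => (wB U t)%:E).
  by apply/funext => t; rewrite enorm_tup2row.
rewrite /intN E iintE; first by [].
- exact: mwB.
- by move=> t; rewrite lee_fin; exact: wB0.
Qed.

Lemma hardyD_intN (u : 'rV[R]_n.+1 -> R) : measurableN u ->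
  intN (fun x => intN (fun y =>
    (`|enorm x `^ ((n.+1%:R - p * s) / p) * u x - enorm y `^ ((n.+1%:R - p * s) / p) * u y| `^ p
     * enorm (x - y) `^ (- (n.+1%:R + p * s))
     * enorm x `^ (- ((n.+1%:R - p * s) / 2)) * enorm y `^ (- ((n.+1%:R - p * s) / 2)))%:E)) =
  dlint (fun x y => (hardyD s p (fun t : T => u (tup2row t)) x y)%:E).
Proof.
move=> mu_u; rewrite -iint2E; last 2 first.
- exact: measurable_hardyD.
- exact: hardyD_ge0.
rewrite /intN; apply: (congr1 (@iint R n.+1)); apply/funext => x.
apply: (congr1 (@iint R n.+1)); apply/funext => y.
by rewrite enorm_ker !enorm_tup2row.
Qed.

Lemma hexp_neq0 : (p < n.+1%:R / s)%R \/ (n.+1%:R / s < p)%R -> h != 0%R.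
Proof.
rewrite ltr_pdivlMr// ltr_pdivrMr// => H.
rewrite /hexp mulf_neq0 ?invr_eq0 ?(gt_eqF p0)// subr_eq0.
by case: H => H; rewrite ?(gt_eqF H) ?(lt_eqF H).
Qed.

Lemma Wdot_hardyB_fin (u : 'rV[R]_n.+1 -> R) :
  (p < n.+1%:R / s)%R /\ Wdot s p u \/ (n.+1%:R / s < p)%R /\ Wdot_punct s p u ->
  hardyB s p (fun t : T => u (tup2row t)) \is a fin_num.
Proof.
case=> [[pN W]|[pN W]].
  apply: (in_completion_hardyB_fin (hexp_neq0 (or_introl pN)) _ W) => f tf.
  split; first exact: tf.1.
  by apply: hardyB_test_fin; left; split => //; rewrite -ltr_pdivlMr.
apply: (in_completion_hardyB_fin (hexp_neq0 (or_intror pN)) _ W) => f tf.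
by split; [exact: tf.1|apply: hardyB_test_fin; right].
Qed.

End completion.

Unset Implicit Arguments.

Theorem theorem1p2 (R : realType) (N : nat) (s p : R) (u : 'rV[R]_N -> R) :
  (1 <= N)%N -> 0 < s < 1 -> 2 <= p ->
  ((p < N%:R / s /\ Wdot s p u) \/ (p > N%:R / s /\ Wdot_punct s p u)) ->
  let v := fun x => enorm x `^ ((N%:R - p * s) / p) * u x in
  let A := gagliardo s p u in
  let B := intN (fun x => (`|u x| `^ p * enorm x `^ (- (p * s)))%:E) in
  let D := intN (fun x => intN (fun y =>
             (`|v x - v y| `^ p * enorm (x - y) `^ (- (N%:R + p * s))
              * enorm x `^ (- ((N%:R - p * s) / 2))
              * enorm y `^ (- ((N%:R - p * s) / 2)))%:E)) in
  (exists2 tau, 0 < tau < 1/2 & gtau p tau = c_p p) /\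
  0 < c_p p <= 1 /\
  ((c_p p)%:E * D <= A - CNsp N s p * B)%E /\
  (p = 2 -> c_p p = 1 /\ (A - CNsp N s p * B = D)%E).
Proof.
case: N u => [//|n] u _ /andP[s0 s1] p2 H v A B D.
have mu_u : measurableN u by case: H => [[_ []]|[_ []]].
have h0 : hexp n s p != 0.
  by apply: hexp_neq0 => //; case: H => [[? _]|[? _]]; [left|right].
have Bf := Wdot_hardyB_fin p2 s0 H.
have AE : A = dint (lebN n.+1) (fun x y => (hardyA s p (fun t => u (tup2row t)) x y)%:E) by exact: gagliardoE.
have BE : B = hardyB s p (fun t => u (tup2row t)) by exact: hardyB_intN.
have DE : D = dint (lebN n.+1) (fun x y => (hardyD s p (fun t => u (tup2row t)) x y)%:E) by exact: hardyD_intN.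
have [Hle Heq] := hardy_remainder p2 s0 s1 h0 mu_u Bf.
(* Finiteness of this product allows it to be moved across the inequality, and cancelled when
   [p = 2], in the extended reals. *)
have CBf : (CNsp n.+1 s p * B)%E \is a fin_num.
  rewrite BE CNspE; apply: fin_numM => //; apply: fin_numM => //.
  exact: intC_unit_fin.
split; first exact: c_p_attained.
split; first exact: c_p_bounds.
split.
  by rewrite leeBrDr// addeC DE AE BE CNspE.
move=> pE; have c2 := c_2 p2 pE; split => //.
have -> : A = (CNsp n.+1 s p * B + D)%E by rewrite AE -(Heq pE) c2 mul1e -CNspE -BE -DE.
by rewrite addeAC subee// add0e.
Qed.
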